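(* Let $\mathsf{X}$ be a subshift. Then $\widetilde{\mathcal{O}}_{\mathsf{X}}\cong C^*(\mathbb{F}\ltimes_{\widehat{\varphi}}\widehat{\mathcal{U}})$.
   Context: An alphabet is a non-empty, possibly infinite set $\mathscr{A}$; $\mathscr{A}^*=\bigcup_{k\ge 0}\mathscr{A}^k$ is the set of finite words and $\omega$ is the empty word. A subshift over $\mathscr{A}$ is a set $\mathsf{X}=\mathsf{X}_F\subseteq\mathscr{A}^{\mathbb{N}}$, for some $F\subseteq\mathscr{A}^*$, of all sequences none of whose finite blocks lies in $F$. $\mathcal{L}_{\mathsf{X}}$ is the set of all finite words occurring in elements of $\mathsf{X}$ (including $\omega$). For $\alpha,\beta\in\mathcal{L}_{\mathsf{X}}$ put $C(\alpha,\beta)=\{\beta x\in\mathsf{X}:\alpha x\in\mathsf{X}\}$. $\mathcal{U}$ is the Boolean algebra of subsets of $\mathsf{X}$ generated by all $C(\alpha,\beta)$, $\alpha,\beta\in\mathcal{L}_{\mathsf{X}}$. $\widetilde{\mathcal{O}}_{\mathsf{X}}$ is the universal unital C*-algebra generated by projections $\{p_A:A\in\mathcal{U}\}$ and partial isometries $\{s_a:a\in\mathscr{A}\}$ subject to: (1) $p_{\mathsf{X}}=1$, $p_{A\cap B}=p_Ap_B$, $p_{A\cup B}=p_A+p_B-p_{A\cap B}$, $p_\emptyset=0$ for all $A,B\in\mathcal{U}$; (2) $s_\beta s_\alpha^*s_\alpha s_\beta^*=p_{C(\alpha,\beta)}$ for all $\alpha,\beta\in\mathcal{L}_{\mathsf{X}}$,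 where $s_\omega=1$ and $s_\alpha=s_{\alpha_1}\cdots s_{\alpha_n}$ for $\alpha=\alpha_1\cdots\alpha_n$. $\widehat{\mathcal{U}}$ is the Stone dual of $\mathcal{U}$ (the space of ultrafilters on $\mathcal{U}$), with basis of open sets $O_A=\{\xi\in\widehat{\mathcal{U}}:A\in\xi\}$, $A\in\mathcal{U}$. For $A\in\mathcal{U}$ and $\alpha\in\mathcal{L}_{\mathsf{X}}$, $r(A,\alpha)=\{x\in\mathsf{X}:\alpha x\in A\}$. Let $\mathbb{F}$ be the free group generated by $\mathscr{A}$. The partial action $\widehat{\varphi}$ of $\mathbb{F}$ on $\widehat{\mathcal{U}}$ is given by the open sets $V_{\beta\alpha^{-1}}=O_{C(\alpha,\beta)}$ for $\alpha,\beta\in\mathcal{L}_{\mathsf{X}}$ with $\beta\alpha^{-1}$ in reduced form, $V_t=\emptyset$ if $t\in\mathbb{F}$ is not of this form, and the homeomorphisms $\widehat{\varphi}_{\alpha\beta^{-1}}:V_{\beta\alpha^{-1}}\to V_{\alpha\beta^{-1}}$, $\widehat{\varphi}_{\alpha\beta^{-1}}(\xi)=\{A\in\mathcal{U}: r(B,\beta)\subseteq r(A,\alpha)\text{ for some }B\in\xi\}$. The transformation groupoid is $\mathbb{F}\ltimes_{\widehat{\varphi}}\widehat{\mathcal{U}}=\{(\xi,t,\eta)\in\widehat{\mathcal{U}}\times\mathbb{F}\times\widehat{\mathcal{U}}:\eta\in V_{t^{-1}},\ \xi=\widehat{\varphi}_t(\eta)\}$, with the topology inherited from the product ($\mathbb{F}$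 discrete), product $(\xi,s,\eta)(\eta,t,\gamma)=(\xi,st,\gamma)$ and inverse $(\xi,t,\eta)^{-1}=(\eta,t^{-1},\xi)$; it is an ample Hausdorff groupoid and $C^*(\cdot)$ denotes its (full) groupoid C*-algebra.
   Formalization: The relation s_a = 0 is added for letters a not occurring in X (void if all letters occur); without it the claim fails, e.g. for X = {1^∞} over {0,1}, where s_0 would be a free partial isometry and the universal algebra noncommutative, while the groupoid algebra is C(T). *)

(* Defs.v *)
From HB Require Import structures.
From mathcomp Require Import all_boot all_order all_algebra.
From mathcomp Require Import all_classical all_reals all_analysis.
From mathcomp Require Import complex.

Set Implicit Arguments.
Unset Strict Implicit.
Unset Printing Implicit Defensive.

Import Order.TTheory GRing.Theory Num.Theory.
Import numFieldNormedType.Exports.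

Local Open Scope classical_set_scope.
Local Open Scope ring_scope.

Declare Scope cstar_scope.
Delimit Scope cstar_scope with cstar.

(* MathComp's algebras are unital and nontrivial, so the product is part of
   this structure: C*-algebras may lack a unit, and may be zero. *)
HB.mixin Record CompleteNormedModule_isCstar (R : realType) A
    & CompleteNormedModule (R[i] : numFieldType) A := {
  cmul : A -> A -> A;
  adj : A -> A;
  cmulA : associative cmul;
  cmulDl : left_distributive cmul +%R;
  cmulDr : right_distributive cmul +%R;
  cmulZl : forall (c : R[i]) (x y : A), cmul (c *: x) y = c *: cmul x y;
  cmulZr : forall (c : R[i]) (x y : A), cmul x (c *: y) = c *: cmul x y;
  cmul_norm : forall x y : A, `|cmul x y| <= `|x| * `|y|;
  adjK : involutive adj;
  adjD : {morph adj : x y / x + y};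
  adjZ : forall (c : R[i]) (x : A), adj (c *: x) = c^* *: adj x;
  adjM : forall x y : A, adj (cmul x y) = cmul (adj y) (adj x);
  cstar_identity : forall x : A, `|cmul (adj x) x| = `|x| ^+ 2
}.

#[short(type="cstarType")]
HB.structure Definition Cstar (R : realType) :=
  {A of CompleteNormedModule (R[i] : numFieldType) A
      & CompleteNormedModule_isCstar R A}.

Notation "x ** y" := (cmul x y) (at level 40, left associativity) : cstar_scope.
Notation "x ^#" := (adj x) (at level 2, format "x ^#") : cstar_scope.
Local Open Scope cstar_scope.

Section CstarAlgebras.
Context {R : realType}.

Definition is_unit_of (A : cstarType R) (e : A) :=
  forall x : A, e ** x = x /\ x ** e = x.

Definition star_hom (A B : cstarType R) (phi : A -> B) :=
  [/\ {morph phi : x y / x + y},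
      forall (c : R[i]) x, phi (c *: x) = c *: phi x,
      {morph phi : x y / x ** y} &
      {morph phi : x / x^#}].

Definition cstar_isomorphic (A B : cstarType R) :=
  exists phi : A -> B, star_hom phi /\ bijective phi.

Definition is_projection (A : cstarType R) (p : A) := p^# = p /\ p ** p = p.

Definition is_partial_isometry (A : cstarType R) (s : A) := s ** s^# ** s = s.

End CstarAlgebras.

(* The groupoid is the subspace [arrows] of an ambient space: [gcomp x y] says
   that the product x y is defined, and the operations are meaningful only on
   arrows, respectively on composable pairs of arrows. *)
Record groupoid := Groupoid {
  ambient : topologicalType;
  arrows : set ambient;
  gcomp : ambient -> ambient -> Prop;
  gmul : ambient -> ambient -> ambient;
  ginv : ambient -> ambient
}.
Arguments arrows : clear implicits.

Section GroupoidAlgebra.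
Context {R : realType} (G : groupoid).
Let T := ambient G.

(* C_c(G), its elements being extended by 0 outside of [arrows G]; the closure
   of the support is taken in the subspace [arrows G]. *)
Definition Cc : set (T -> R[i]) :=
  [set f | [/\ {within arrows G, continuous (f : T -> R[i]^o)},
               [set x | f x != 0] `<=` arrows G &
               compact (arrows G `&` closure [set x | f x != 0])]].

Definition convolution (f g : T -> R[i]) : T -> R[i] := fun z =>
  \sum_(xy \in [set xy : T * T | [/\ arrows G xy.1, arrows G xy.2,
      gcomp xy.1 xy.2 & gmul xy.1 xy.2 = z]]) f xy.1 * g xy.2.

Definition involution (f : T -> R[i]) : T -> R[i] := fun z => (f (ginv z))^*.

(* *-homomorphisms from C_c(G) to a C*-algebra; values outside C_c(G) are
   irrelevant. *)
Definition Cc_rep (D : cstarType R) (pi : (T -> R[i]) -> D) :=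
  [/\ {in Cc &, {morph pi : f g / f + g}},
      forall c : R[i], {in Cc, forall f, pi (fun x => c * f x) = c *: pi f},
      {in Cc &, forall f g, pi (convolution f g) = pi f ** pi g} &
      {in Cc, forall f, pi (involution f) = (pi f)^#}].

(* B is the completion of C_c(G) for the norm
   f |-> sup {`|pi f| : pi a *-homomorphism from C_c(G) to a C*-algebra}. *)
Definition is_full_groupoid_Cstar (B : cstarType R) :=
  exists iota : (T -> R[i]) -> B,
    [/\ Cc_rep iota,
        closure (iota @` Cc) = setT &
        forall f, Cc f ->
          supremums [set r : R[i] | exists (D : cstarType R)
                                           (pi : (T -> R[i]) -> D),
                                      Cc_rep pi /\ r = `|pi f|]
                    `|iota f|].

End GroupoidAlgebra.

Section FreeGroup.
Context {A : choiceType}.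

(* (a, true) stands for a and (a, false) for its inverse *)
Definition letter_inv (l : A * bool) : A * bool := (l.1, ~~ l.2).

Definition reduced (w : seq (A * bool)) :=
  sorted (fun l m => m != letter_inv l) w.

Record free_group := Free {
  free_word :> seq (A * bool);
  free_reduced : reduced free_word
}.

HB.instance Definition _ := [isSub for free_word].
HB.instance Definition _ := [Choice of free_group by <:].

Definition push (l : A * bool) (w : seq (A * bool)) :=
  if w is m :: w' then if m == letter_inv l then w' else l :: w else [:: l].

Lemma letter_invK : involutive letter_inv.
Proof. by case=> a b; rewrite /letter_inv /= negbK. Qed.

Lemma push_reduced l w : reduced w -> reduced (push l w).
Proof.
rewrite /reduced; case: w => [//|m w] /= Hw; case: ifPn => [_|ne].
  exact: path_sorted Hw.
by rewrite /= ne.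
Qed.

Lemma pushK l w : reduced w -> push (letter_inv l) (push l w) = w.
Proof.
case: w => [|m w] /=; first by rewrite letter_invK eqxx.
case: ifPn => [/eqP -> |_ _]; last by rewrite /= letter_invK eqxx.
by case: w => [//|n w] /= /andP[]; rewrite letter_invK => /negbTE ->.
Qed.

Lemma foldr_push_reduced u v : reduced v -> reduced (foldr push v u).
Proof. by move=> rv; elim: u => //= l u; exact: push_reduced. Qed.

Lemma foldr_push_push l v w : reduced w ->
  foldr push w (push l v) = push l (foldr push w v).
Proof.
move=> rw; case: v => [//|m v] /=; case: ifPn => //= /eqP ->.
by have := pushK (letter_inv l) (foldr_push_reduced v rw); rewrite letter_invK.
Qed.

Lemma foldr_push_nil u : reduced u -> foldr push [::] u = u.
Proof.
elim: u => //= l u IH ru; rewrite IH; last exact: path_sorted ru.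
by case: u ru {IH} => //= m u /andP[/negbTE ->].
Qed.

Definition free_mul (u v : free_group) : free_group :=
  Free (foldr_push_reduced u (free_reduced v)).

Lemma rev_inv_reduced u : reduced u -> reduced (rev (map letter_inv u)).
Proof.
rewrite /reduced rev_sorted sorted_map; apply: sub_sorted => l m /=.
by rewrite letter_invK eq_sym.
Qed.

Definition free_inv (u : free_group) : free_group :=
  Free (rev_inv_reduced (free_reduced u)).

Definition free_one : free_group := @Free [::] isT.

Lemma free_mulA : associative free_mul.
Proof.
move=> u v w; apply: val_inj => /=.
elim: (free_word u) => //= l s ->; rewrite foldr_push_push //.
exact: free_reduced.
Qed.

Lemma free_mul1 : left_id free_one free_mul.
Proof. by move=> u; apply: val_inj. Qed.

Lemma free_mulr1 : right_id free_one free_mul.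
Proof.
move=> u; apply: val_inj => /=.
by rewrite foldr_push_nil //; exact: free_reduced.
Qed.

Lemma free_mulV : left_inverse free_one free_inv free_mul.
Proof.
move=> [u ru]; apply: val_inj => /=.
elim: u ru => //= l u IH ru.
rewrite rev_cons foldr_rcons /= letter_invK eqxx IH //.
exact: path_sorted ru.
Qed.

Lemma free_invK : involutive free_inv.
Proof.
move=> u; apply: val_inj; rewrite /= map_rev revK -map_comp -[RHS]map_id.
by apply: eq_map => l; exact: letter_invK.
Qed.

Lemma free_mulrV : right_inverse free_one free_inv free_mul.
Proof. by move=> u; rewrite -{1}[u]free_invK free_mulV. Qed.

HB.instance Definition _ := isGroup.Build free_group
  free_mulA free_mul1 free_mulr1 free_mulV free_mulrV.

End FreeGroup.
Arguments free_group : clear implicits.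

HB.instance Definition _ (A : choiceType) :=
  DiscreteTopology.copy (free_group A) (discrete_topology (free_group A)).

Section Subshift.
Context {A : pointedType}.
Implicit Types (X Y Z : set (nat -> A)) (a b w : seq A) (x : nat -> A).

Definition wcat w x : nat -> A := fun n => nth (x (n - size w)%N) w n.

Definition block w x := exists m n, w = [seq x i | i <- iota m n].

Definition subshift (F : set (seq A)) : set (nat -> A) :=
  [set x | forall w, F w -> ~ block w x].

(* The empty word belongs to the language even if X is empty. *)
Definition language X : set (seq A) :=
  [set w | w = [::] \/ exists2 x, X x & block w x].

Definition Cset X a b : set (nat -> A) :=
  [set y | exists x, [/\ y = wcat b x, X (wcat b x) & X (wcat a x)]].

Definition balg X : set (set (nat -> A)) :=
  smallest [set M | [/\ M set0, M X, setU_closed M, setI_closed M &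
                        forall Y, M Y -> M (X `\` Y)]]
           [set Cset X a b | a in language X & b in language X].

Definition rel_range X Y a : set (nat -> A) := [set x | X x /\ Y (wcat a x)].

Definition proper_filter X (xi : set (set (nat -> A))) :=
  [/\ xi `<=` balg X, xi X, ~ xi set0, setI_closed xi &
      forall Y Z, xi Y -> balg X Z -> Y `<=` Z -> xi Z].

Definition ultrafilter X (xi : set (set (nat -> A))) :=
  proper_filter X xi /\
  forall zeta, proper_filter X zeta -> xi `<=` zeta -> zeta = xi.

Definition stone X := {xi | ultrafilter X xi}.

HB.instance Definition _ X := gen_eqMixin (stone X).
HB.instance Definition _ X := gen_choiceMixin (stone X).

Definition stone_open X Y : set (stone X) := [set xi | sval xi Y].
Arguments stone_open : clear implicits.

Lemma balgI X : setI_closed (balg X).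
Proof.
move=> Y Z BY BZ M MP; have [[_ _ _ MI _] _] := MP.
by apply: MI; [exact: BY|exact: BZ].
Qed.

Lemma stone_cover X : \bigcup_(Y in balg X) stone_open X Y = setT.
Proof.
apply/seteqP; split=> // xi _; have [[sub xiX _ _ _] _] := svalP xi.
by exists X; [exact: sub|].
Qed.

Lemma stone_join X Y Z (xi : stone X) : balg X Y -> balg X Z ->
  stone_open X Y xi -> stone_open X Z xi ->
  exists W, [/\ balg X W, stone_open X W xi &
    stone_open X W `<=` stone_open X Y `&` stone_open X Z].
Proof.
move=> BY BZ xiY xiZ; exists (Y `&` Z); split; first exact: balgI.
  by have [[_ _ _ xiI _] _] := svalP xi; exact: xiI.
move=> zeta zYZ; have [[_ _ _ _ up] _] := svalP zeta.
by split; apply: (up (Y `&` Z)) => // t [].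
Qed.

HB.instance Definition _ X :=
  isBaseTopological.Build (stone X) (@stone_cover X) (@stone_join X).

(* a b^-1 is in reduced form and is equal to t *)
Definition is_reduced_form (t : free_group A) a b :=
  free_word t = [seq (l, true) | l <- a] ++ rev [seq (l, false) | l <- b].

(* V_t: the pair (b, a) is determined by t, and b a^-1 is t *)
Definition stone_act_dom X (t : free_group A) : set (stone X) :=
  [set xi | exists a b, [/\ language X a, language X b, is_reduced_form t b a &
                            stone_open X (Cset X a b) xi]].
Arguments stone_act_dom : clear implicits.

(* phi_t(xi) for xi in V_(t^-1), where t is a b^-1; it is given as a family of
   sets, its being an ultrafilter is a property of the action *)
Definition stone_act X (t : free_group A) (xi : stone X) :
    set (set (nat -> A)) :=
  [set Y | balg X Y /\ exists a b, [/\ language X a, language X b,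
     is_reduced_form t a b &
     exists2 Z, sval xi Z & rel_range X Z b `<=` rel_range X Y a]].

Definition transformation_groupoid X : groupoid := {|
  ambient := (stone X * free_group A * stone X)%type;
  arrows := [set g | stone_act_dom X (g.1.2)^-1%g g.2 /\
                     sval g.1.1 = stone_act g.1.2 g.2];
  gcomp := fun g h => g.2 = h.1.1;
  gmul := fun g h => (g.1.1, (g.1.2 * h.1.2)%g, h.2);
  ginv := fun g => (g.2, (g.1.2)^-1%g, g.1.1)
|}.

Section Relations.
Context {R : realType} (X : set (nat -> A)).
Context (O : cstarType R) (e : O) (p : set (nat -> A) -> O) (s : A -> O).

Definition sword w : O := foldr (fun l y => s l ** y) e w.

(* The last clause is void when every letter of the alphabet occurs in X, as is
   customarily assumed. It is needed otherwise: no other relation but being a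
   partial isometry would bear on s_l for a letter l that does not occur. *)
Definition subshift_relations :=
  [/\ (forall Y, balg X Y -> is_projection (p Y)),
      (forall l, is_partial_isometry (s l)),
      [/\ p X = e,
          (forall Y Z, balg X Y -> balg X Z -> p (Y `&` Z) = p Y ** p Z),
          (forall Y Z, balg X Y -> balg X Z ->
             p (Y `|` Z) = p Y + p Z - p (Y `&` Z)) &
          p set0 = 0],
      (forall a b, language X a -> language X b ->
         sword b ** (sword a)^# ** sword a ** (sword b)^# = p (Cset X a b)) &
      (forall l, ~ language X [:: l] -> s l = 0)].

End Relations.

Definition is_subshift_Cstar {R : realType} X (O : cstarType R) :=
  exists (e : O) (p : set (nat -> A) -> O) (s : A -> O),
    [/\ is_unit_of e, subshift_relations X e p s &
        forall (D : cstarType R) (e' : D) (p' : set (nat -> A) -> D)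
               (s' : A -> D),
          is_unit_of e' -> subshift_relations X e' p' s' ->
          exists! phi : O -> D,
            [/\ star_hom phi, phi e = e',
                (forall Y, balg X Y -> phi (p Y) = p' Y) &
                (forall l, phi (s l) = s' l)]].

End Subshift.
Arguments stone_open {A} X Y _.
Arguments stone_act_dom {A} X t _.

(* Main.v *)
From HB Require Import structures.
From mathcomp Require Import all_boot all_order all_algebra.
From mathcomp Require Import all_classical all_reals all_analysis.
From mathcomp Require Import complex.
Require Import Defs.

(** The free group acts on X by partial bijections: a letter is put in front of
    a sequence, or deleted from it ([chain]).  The image [theta t Y] of a member
    Y of the Boolean algebra belongs to the Boolean algebra again, V_t is the
    clopen set of [theta t X], and (xi, t, eta) is an arrow of the groupoid iff
    [theta t] maps the sets of eta into xi ([arrowsE]).  Since V_t is clopen, a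
    function in C_c(G) is a finite sum of slices h delta_t, where t is a group
    element and h a continuous function on the Stone space ([Cc_ind]), and
    [convolution_slice] and [involution_slice] say that C_c(G) is the algebraic
    partial crossed product:

      (h delta_s) . (k delta_t) = (h . (k transported by s)) delta_(st).

    The strategy is to prove that every full C*-algebra B of the groupoid has
    the universal property that defines the algebra of the subshift
    ([full_groupoid_Cstar_universal]).  The existence of both algebras then
    comes down to that of B, and the isomorphism is the uniqueness of a
    universal object ([subshift_Cstar_unique]).

    Existence of B.  The norms of f in C_c(G) under all representations have to
    be bounded.  If h is a real function on the Stone space with |h| <= M, then
    u = h + i sqrt(M^2 - h^2) satisfies u^# u = M^2, whence the image of u has
    norm at most M, and so has that of h = (u + u^#) / 2 ([unitary_bound]).  The
    C*-identity reduces any slice to this case ([rep_slice_le]).  Then B is the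
    closure of C_c(G) in a product of sufficiently many representations
    ([closed_span], [full_groupoid_Cstar_exists]).

    The relations in B.  The generators are the slices p_Y = 1_Y delta_1 and
    s_a = 1 delta_a, and the relations are computed with indicator functions
    ([slice_opM], [slice_op_adj], [representation_relations]).

    The universal property.  Generators in D that satisfy the relations give
    operators u_t, products of letters s_a and s_a^# along the reduced word of
    t, such that u_t p_Y u_t^# = p_(theta t Y) and u_s u_t = p_(theta s X) u_st
    ([word_op_cov], [word_op_push]).  The projections p_Y integrate to a
    *-homomorphism h |-> Int h on the continuous functions ([integral]), again
    bounded by the trick with sqrt(M^2 - h^2).  Covariance makes
    h delta_t |-> (Int h) u_t a representation of C_c(G)
    ([rep_of_relationsP]); it extends to B because B carries the largest norm
    ([factorization]).

    Uniqueness of the extension.  The generators determine the image of every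
    slice ([eq_rep]), and a *-homomorphism of C*-algebras is automatically
    continuous ([star_hom_bounded]), by the same trick, the square root being
    now the solution of a fixed-point equation ([cstar_sqrt]). *)

Set Implicit Arguments.
Unset Strict Implicit.
Unset Printing Implicit Defensive.

Import Order.TTheory GRing.Theory Num.Theory.
Import numFieldNormedType.Exports.

Local Open Scope classical_set_scope.
Local Open Scope ring_scope.
Local Open Scope cstar_scope.

(** * Approximation in complete spaces *)

Lemma real_le_addgt0 (K : numFieldType) (x y : K) :
  x \is Num.real -> y \is Num.real ->
  (forall e, 0 < e -> x <= y + e) -> x <= y.
Proof.
move=> xr yr h; case: (real_leP xr yr) => // yx.
(* Otherwise e = (x - y) / 2 contradicts the hypothesis. *)
have e0 : 0 < (x - y) / 2 by rewrite divr_gt0 ?subr_gt0// ltr0n.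
have := h _ e0; rewrite -lerBlDl ler_pMr ?subr_gt0// => /le_lt_trans.
by move=> /(_ 1); rewrite invf_lt1 ?ltr0n ?ltr1n// ltxx => ->.
Qed.

Lemma norm_le_addgt0 (K : numFieldType) (V : normedModType K) (x : V) (y : K) :
  0 <= y -> (forall e, 0 < e -> `|x| <= y + e) -> `|x| <= y.
Proof. by move=> y0; apply: real_le_addgt0; rewrite ?normr_real ?ger0_real. Qed.

Lemma norm_small_eq0 (K : numFieldType) (V : normedModType K) (x : V) :
  (forall e : K, 0 < e -> `|x| <= e) -> x = 0.
Proof.
move=> h; apply/eqP; rewrite -normr_le0; apply: norm_le_addgt0 => // e e0.
by rewrite add0r; exact: h.
Qed.

(** A limit from approximations at every scale: the sets of Q-approximations
    with error at most e generate a Cauchy filter.  The field K is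
    a field of complex numbers in all applications; a filter, unlike a sequence,
    does not call for its Archimedean property. *)
Lemma complete_approx (K : numFieldType) (D : completeNormedModType K)
    (Q : K -> D -> Prop) :
  (forall e, 0 < e -> exists d, Q e d) ->
  (forall e e' d d', 0 < e -> 0 < e' -> Q e d -> Q e' d' ->
     `|d - d'| <= e + e') ->
  exists d0, forall e d, 0 < e -> Q e d -> `|d0 - d| <= e.
Proof.
move=> Qex Qc.
pose B (e : K) := [set d | exists e', [/\ 0 < e', e' <= e & Q e' d]].
pose F : set_system D := filter_from [set e : K | 0 < e] B.
have FF : ProperFilter F.
  apply: filter_from_proper => [|e /= e0]; last first.
    by have [d Qd] := Qex e e0; exists d; exists e.
  apply: filter_from_filter; first by exists 1 => /=.
  (* The order on K may be partial: this is a common lower bound of e and e'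
   that does not resort to their minimum. *)
  move=> e e' /= e0 e'0; exists (e * e' / (e + e')).
    by rewrite /= divr_gt0 ?mulr_gt0 ?addr_gt0.
  have s0 : 0 < e + e' by rewrite addr_gt0.
  move=> d [e2 [e20 le2 Q2]]; split; exists e2; split => //.
    apply: (le_trans le2); rewrite -mulrA ger_pMr// ler_pdivrMr// mul1r.
    by rewrite lerDr ltW.
  apply: (le_trans le2); rewrite mulrAC ger_pMl// ler_pdivrMr// mul1r.
  by rewrite lerDl ltW.
have cF : cauchy F.
  apply: cauchy_exP => e e0; have e3 : 0 < e / 3 by rewrite divr_gt0 ?ltr0n.
  have [d Qd] := Qex _ e3; exists d; exists (e / 3) => // d' [e' [e'0 le' Q']].
  rewrite -ball_normE /=; apply: le_lt_trans (Qc _ _ _ _ e3 e'0 Qd Q') _.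
  apply: le_lt_trans (_ : e / 3 + e / 3 < e); first by rewrite lerD2l.
  by rewrite [X in _ < X](splitr e) -mulr2n -mulrnAr -[X in _ < X]mulr2n
     -[X in _ < X]mulrnAr ltr_pM2l// ltrMn2r//= ltf_pV2 ?posrE ?ltr0n ?ltr_nat.
have cvF : F --> lim F by exact: cauchy_cvg.
exists (lim F) => e d e0 Qd; apply: norm_le_addgt0; first exact: ltW.
move=> g g0; have g2 : 0 < g / 2 by rewrite divr_gt0 ?ltr0n.
have FA : F [set x | `|lim F - x| < g / 2].
  by move/fcvgrPdist_lt : cvF => /(_ _ g2).
have FB : F (B (g / 2)) by exists (g / 2).
have [x [xA [e' [e'0 le' Q']]]] := filter_ex (filterI FA FB).
have -> : lim F - d = (lim F - x) + (x - d) by rewrite addrA subrK.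
rewrite (splitr g) [leRHS]addrCA; apply: le_trans (ler_normD _ _) _.
rewrite lerD//; first exact: ltW.
by apply: le_trans (Qc _ _ _ _ e'0 e0 Q' Qd) _; rewrite [leLHS]addrC lerD2l.
Qed.

(** * Elementary facts on C*-algebras *)

Section Basics.
Context {R : realType} {A : cstarType R}.
Implicit Types (x y z p e : A).

Lemma cmulBl x y z : (x - y) ** z = x ** z - y ** z.
Proof. by rewrite cmulDl -scaleN1r cmulZl scaleN1r. Qed.

Lemma cmulBr x y z : z ** (x - y) = z ** x - z ** y.
Proof. by rewrite cmulDr -scaleN1r cmulZr scaleN1r. Qed.

Lemma cmul0 x : 0 ** x = 0.
Proof. by rewrite -[in LHS](subrr x) cmulBl subrr. Qed.

Lemma cmulr0 x : x ** 0 = 0.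
Proof. by rewrite -[in LHS](subrr x) cmulBr subrr. Qed.

Lemma adjB x y : (x - y)^# = x^# - y^#.
Proof. by rewrite adjD -(scaleN1r y) adjZ rmorphN1 scaleN1r. Qed.

Lemma adj0 : (0 : A)^# = 0.
Proof. by rewrite -[in LHS](subrr 0) adjB subrr. Qed.

(** From |y|^2 = |y^# y| <= |y^#| |y|. *)
Lemma adj_norm x : `|x^#| = `|x|.
Proof.
suff le (y : A) : `|y| <= `|y^#|.
  by apply/eqP; rewrite eq_le le -{2}[x]adjK le.
have [->|y0] := eqVneq y 0; first by rewrite normr0.
have := cmul_norm y^# y; rewrite cstar_identity expr2.
by rewrite ler_pM2r ?normr_gt0.
Qed.

Lemma cstar_eq0 x : x^# ** x = 0 -> x = 0.
Proof.
move=> h; apply/eqP; rewrite -normr_eq0 -sqrf_eq0 -cstar_identity h.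
by rewrite normr0.
Qed.

Lemma cstar_norm_le x (c : R[i]) : 0 <= c -> `|x^# ** x| <= c ^+ 2 -> `|x| <= c.
Proof. by move=> c0; rewrite cstar_identity ler_pXn2r ?nnegrE. Qed.

Lemma projection_norm p : is_projection p -> `|p| <= 1.
Proof.
move=> [pa pp]; have := cstar_identity p; rewrite pa pp expr2.
have [->|p0] := eqVneq p 0; first by rewrite normr0 ler01.
by rewrite -[LHS]mul1r => /mulIf <-//; rewrite normr_eq0.
Qed.

(** Both e^# e = e^# and its adjoint e^# e = e hold. *)
Lemma unit_adj e : is_unit_of e -> e^# = e.
Proof.
move=> ue; have h := (ue e^#).2.
by rewrite -[RHS]adjK -[in RHS]h adjM adjK h.
Qed.

Lemma unit_projection e : is_unit_of e -> is_projection e.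
Proof. by move=> ue; split; [exact: unit_adj | rewrite (ue e).1]. Qed.

(** The element u = h + i k satisfies u^# u = c^2 q and u + u^# = 2 h.  This
    bounds h without any notion of positivity or of spectrum. *)
Lemma unitary_bound (h k q : A) (c : R[i]) : 0 <= c ->
  h^# = h -> k^# = k -> h ** k = k ** h -> is_projection q ->
  h ** h + k ** k = c ^+ 2 *: q -> `|h| <= c.
Proof.
move=> c0 ha ka hk pq hq; pose u := h + 'i *: k.
have ua : u^# = h - 'i *: k by rewrite adjD adjZ ha ka conjCi scaleNr.
have uu : u^# ** u = c ^+ 2 *: q.
  rewrite ua cmulBl !cmulDr !cmulZl !cmulZr scalerA -expr2 sqrCi scaleN1r hk.
  by rewrite opprB addrACA subrr addr0.
have un : `|u| <= c.
  apply: cstar_norm_le => //; rewrite uu normrZ ger0_norm ?exprn_ge0//.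
  by rewrite ler_piMr ?exprn_ge0// projection_norm.
have h2 : h = 2^-1 *: (u + u^#).
  rewrite ua /u addrACA subrr addr0 -[h in RHS]scale1r -scalerDl scalerA.
  by rewrite mulVf ?scale1r// pnatr_eq0.
rewrite h2 normrZ ger0_norm ?invr_ge0 ?ler0n// mulrC ler_pdivrMr ?ltr0n//.
apply: le_trans (ler_normD _ _) _.
by rewrite adj_norm mulr_natr mulr2n lerD.
Qed.

End Basics.

(** * Extension of a contractive relation *)

(** A *-homomorphism known on part of an algebra, given by its graph [Gm].  The
    predicate [N x r] stands for the bound of the norm of x by r; it allows E to
    be a space of functions that carries no norm, such as the functions on a
    compact space with the uniform bound. *)
Record contractive_relation {R : realType} (D : cstarType R) (E : lmodType R[i])
    (mulE : E -> E -> E) (starE : E -> E) (N : E -> R[i] -> Prop)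
    (Gm : E -> D -> Prop) : Prop := ContractiveRelation {
  rel_N0 : forall x r, N x r -> 0 <= r;
  rel_Nle : forall x r s, N x r -> r <= s -> N x s;
  rel_ND : forall x y r s, N x r -> N y s -> N (x + y) (r + s);
  rel_NZ : forall c x r, N x r -> N (c *: x) (`|c| * r);
  rel_NM : forall x y r s, N x r -> N y s -> N (mulE x y) (r * s);
  rel_Nstar : forall x r, N x r -> N (starE x) r;
  rel_mulBl : forall x y z, mulE (x - y) z = mulE x z - mulE y z;
  rel_mulBr : forall x y z, mulE z (x - y) = mulE z x - mulE z y;
  rel_starB : forall x y, starE (x - y) = starE x - starE y;
  rel_D : forall x y d f, Gm x d -> Gm y f -> Gm (x + y) (d + f);
  rel_Z : forall c x d, Gm x d -> Gm (c *: x) (c *: d);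
  rel_M : forall x y d f, Gm x d -> Gm y f -> Gm (mulE x y) (d ** f);
  rel_star : forall x d, Gm x d -> Gm (starE x) d^#;
  rel_le : forall x d r, Gm x d -> N x r -> `|d| <= r;
  rel_bounded : forall x d, Gm x d -> exists r, N x r
}.

Section Extension.
Context {R : realType} (D : cstarType R) (E : lmodType R[i]).
Context (mulE : E -> E -> E) (starE : E -> E) (N : E -> R[i] -> Prop).
Context (Gm : E -> D -> Prop).

Definition approx x (e : R[i]) (d : D) := exists2 x', N (x - x') e & Gm x' d.

Definition ext_dom x := forall e, 0 < e -> exists d, approx x e d.

(** The value at x is the common limit of the approximations of x in the graph;
    it is meaningful on [ext_dom]. *)
Definition extension x : D :=
  xget 0 [set d | forall e d', 0 < e -> approx x e d' -> `|d - d'| <= e].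

Hypothesis rel : contractive_relation mulE starE N Gm.
Let N0 := rel_N0 rel.
Let Nle := rel_Nle rel.
Let ND := rel_ND rel.
Let NZ := rel_NZ rel.
Let NM := rel_NM rel.
Let Nstar := rel_Nstar rel.
Let mulBl := rel_mulBl rel.
Let mulBr := rel_mulBr rel.
Let starB := rel_starB rel.
Let GmD := rel_D rel.
Let GmZ := rel_Z rel.
Let GmM := rel_M rel.
Let Gmstar := rel_star rel.
Let Gmle := rel_le rel.
Let GmN := rel_bounded rel.

Let NN x r : N x r -> N (- x) r.
Proof. by move=> /(NZ (-1)); rewrite scaleN1r normrN1 mul1r. Qed.

Let GmB x y d f : Gm x d -> Gm y f -> Gm (x - y) (d - f).
Proof.
by move=> Gx /(GmZ (-1)); rewrite !scaleN1r; exact: GmD.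
Qed.

Lemma approx_compat x e e' d d' : approx x e d -> approx x e' d' ->
  `|d - d'| <= e + e'.
Proof.
move=> [y Ny Gy] [y' Ny' Gy']; apply: (Gmle (GmB Gy Gy')).
have -> : y - y' = - (x - y) + (x - y').
  by rewrite opprB addrA subrK.
by apply: ND => //; exact: NN.
Qed.

Lemma extension_approx x e d : ext_dom x -> 0 < e -> approx x e d ->
  `|extension x - d| <= e.
Proof.
move=> dx e0 xd; have [|d0 h] := complete_approx dx.
  by move=> *; exact: (@approx_compat x).
rewrite /extension; case: xgetP => [d1 _ /=|]; first exact.
by move=> /(_ d0); case.
Qed.

Lemma extension_unique x d : ext_dom x ->
  (forall e, 0 < e -> exists2 d', approx x e d' & `|d - d'| <= e) ->
  extension x = d.
Proof.
move=> dx h; apply/subr0_eq/norm_small_eq0 => e e0.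
have e2 : 0 < e / 2 by rewrite divr_gt0 ?ltr0n.
have [d' xd' dd'] := h _ e2.
rewrite -(subrK d' (extension x)) -addrA (splitr e).
apply: le_trans (ler_normD _ _) _; rewrite lerD//; last by rewrite distrC.
exact: extension_approx.
Qed.

Lemma ext_dom_Gm x d : Gm x d -> ext_dom x.
Proof.
move=> Gx e e0; exists d, x => //; have [r Nr] := GmN Gx.
have := NZ 0 Nr; rewrite normr0 mul0r scale0r subrr => n0.
by apply: Nle n0 _; exact: ltW.
Qed.

Lemma extension_Gm x d : Gm x d -> extension x = d.
Proof.
move=> Gx; apply: extension_unique; first exact: ext_dom_Gm Gx.
move=> e e0; exists d; last by rewrite subrr normr0 ltW.
exists x => //; have [r Nr] := GmN Gx.
have := NZ 0 Nr; rewrite normr0 mul0r scale0r subrr => n0.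
by apply: Nle n0 _; exact: ltW.
Qed.

Let approxD x y e f d g : approx x e d -> approx y f g ->
  approx (x + y) (e + f) (d + g).
Proof.
move=> [x' Nx Gx] [y' Ny Gy]; exists (x' + y'); last exact: GmD.
by rewrite opprD addrACA; exact: ND.
Qed.

Lemma extensionD x y : ext_dom x -> ext_dom y ->
  ext_dom (x + y) /\ extension (x + y) = extension x + extension y.
Proof.
move=> dx dy; have h e : 0 < e -> exists d f,
    [/\ approx (x + y) e (d + f), approx x (e / 2) d & approx y (e / 2) f].
  move=> e0; have e2 : 0 < e / 2 by rewrite divr_gt0 ?ltr0n.
  have [d xd] := dx _ e2; have [f yf] := dy _ e2; exists d, f; split => //.
  by rewrite (splitr e); exact: approxD.
have dxy : ext_dom (x + y).
  by move=> e /h [d [f [? _ _]]]; exists (d + f).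
split=> //; apply: extension_unique => // e e0; have [d [f [xy xd yf]]] := h e e0.
have e2 : 0 < e / 2 by rewrite divr_gt0 ?ltr0n.
exists (d + f) => //; rewrite opprD addrACA (splitr e).
by apply: le_trans (ler_normD _ _) _; rewrite lerD// extension_approx.
Qed.

Lemma extensionZ c x : ext_dom x ->
  ext_dom (c *: x) /\ extension (c *: x) = c *: extension x.
Proof.
move=> dx; have h e : 0 < e -> exists d,
    approx (c *: x) e (c *: d) /\ `|c *: extension x - c *: d| <= e.
  move=> e0; have c1 : 0 < `|c| + 1 by rewrite ltr_wpDl.
  have e2 : 0 < e / (`|c| + 1) by rewrite divr_gt0.
  have le : `|c| * (e / (`|c| + 1)) <= e.
    by rewrite mulrCA ger_pMr// ler_pdivrMr// mul1r lerDl.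
  have [d xd] := dx _ e2; exists d; split; last first.
    rewrite -scalerBr normrZ; apply: le_trans le; rewrite ler_wpM2l//.
    exact: extension_approx.
  case: xd => x' Nx Gx; exists (c *: x'); last exact: GmZ.
  by rewrite -scalerBr; apply: Nle le; exact: NZ.
have dcx : ext_dom (c *: x) by move=> e /h [d [? _]]; exists (c *: d).
split=> //; apply: extension_unique => // e /h [d [? ?]].
by exists (c *: d).
Qed.

Lemma extension_star x : ext_dom x ->
  ext_dom (starE x) /\ extension (starE x) = (extension x)^#.
Proof.
move=> dx; have h e : 0 < e -> exists d,
    approx (starE x) e d^# /\ `|(extension x)^# - d^#| <= e.
  move=> e0; have [d xd] := dx _ e0; exists d; split; last first.
    by rewrite -adjB adj_norm; exact: extension_approx.
  case: xd => x' Nx Gx; exists (starE x'); last exact: Gmstar.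
  by rewrite -starB; exact: Nstar.
have dcx : ext_dom (starE x) by move=> e /h [d [? _]]; exists d^#.
by split=> //; apply: extension_unique => // e /h [d [? ?]]; exists d^#.
Qed.

Lemma ext_dom_bounded x : ext_dom x -> exists r, N x r.
Proof.
move=> /(_ _ ltr01) [d [x' Nx /GmN [r Nr]]]; exists (1 + r).
by rewrite -[x](subrK x'); exact: ND.
Qed.

Lemma extension_le x r : ext_dom x -> N x r -> `|extension x| <= r.
Proof.
move=> dx Nx; apply: norm_le_addgt0; first exact: N0 Nx.
move=> e e0; have e2 : 0 < e / 2 by rewrite divr_gt0 ?ltr0n.
have [d xd] := dx _ e2; rewrite -(subrK d (extension x)) (splitr e) addrCA.
apply: le_trans (ler_normD _ _) _; rewrite lerD//.
  exact: extension_approx.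
case: xd => x' Nx' Gx; apply: Gmle Gx _.
rewrite -[x'](subrK x) addrC; apply: ND => //.
by rewrite -opprB; exact: NN.
Qed.

Lemma extensionM x y : ext_dom x -> ext_dom y ->
  ext_dom (mulE x y) /\ extension (mulE x y) = extension x ** extension y.
Proof.
move=> dx dy; have [r Nx] := ext_dom_bounded dx.
have [s Ny] := ext_dom_bounded dy.
have r0 := N0 Nx; have s0 := N0 Ny.
have h e : 0 < e -> exists d f,
    approx (mulE x y) e (d ** f) /\
    `|extension x ** extension y - d ** f| <= e.
  move=> e0; pose t := s + r + 1.
  have t1 : 0 < t by rewrite ltr_wpDl// addr_ge0.
  have et : 0 < e + t by rewrite addr_gt0.
  (* This g is at most 1 and satisfies g t <= e. *)
  pose g := e / (e + t); have g0 : 0 < g by rewrite divr_gt0.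
  have g1 : g <= 1 by rewrite ler_pdivrMr// mul1r lerDl ltW.
  have le : g * s + (r + g) * g <= e.
    apply: (@le_trans _ _ (g * t)).
      rewrite [_ * g]mulrC -mulrDr ler_pM2l// addrA lerD2l//.
    by rewrite /g mulrAC ler_pdivrMr// ler_pM2l// lerDr ltW.
  have [d xd] := dx _ g0; have [f yf] := dy _ g0; exists d, f.
  split; last first.
    have -> : extension x ** extension y - d ** f =
      (extension x - d) ** extension y + d ** (extension y - f).
      by rewrite cmulBl cmulBr addrA subrK.
    apply: le_trans (ler_normD _ _) _; apply: le_trans le; rewrite lerD//.
      apply: le_trans (cmul_norm _ _) _; rewrite ler_pM//.
        exact: extension_approx.
      exact: extension_le.
    apply: le_trans (cmul_norm _ _) _; rewrite ler_pM//; last first.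
      exact: extension_approx.
    case: xd => x' Nx' Gx; apply: Gmle Gx _.
    rewrite -[x'](subrK x) addrC; apply: ND => //.
    by rewrite -opprB; exact: NN.
  case: xd => x' Nx' Gx; case: yf => y' Ny' Gy.
  exists (mulE x' y'); last exact: GmM.
  have -> : mulE x y - mulE x' y' = mulE (x - x') y + mulE x' (y - y').
    by rewrite mulBl mulBr addrA subrK.
  apply: Nle le; apply: ND; apply: NM => //.
  rewrite -[x'](subrK x) addrC; apply: ND => //.
  by rewrite -opprB; exact: NN.
have dxy : ext_dom (mulE x y).
  by move=> e /h [d [f [? _]]]; exists (d ** f).
split=> //; apply: extension_unique => // e /h [d [f [? ?]]].
by exists (d ** f).
Qed.

End Extension.

(** * Automatic continuity *)

(** The Archimedean property of the reals, carried over to the positive complex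
    numbers, whose order is partial. *)
Lemma half_pow_small {R : realType} (e : R[i]) : 0 < e ->
  exists n, (2^-1 : R[i]) ^+ n <= e.
Proof.
case: e => a b; rewrite ltcE /= => /andP[/eqP -> a0].
pose n := Num.bound a^-1; exists n.
have an : a^-1 < n%:R by rewrite archi_boundP// invr_ge0 ltW.
have n0 : 0 < n%:R :> R by apply: lt_trans an; rewrite invr_gt0.
have na : n%:R^-1 <= a by rewrite -[a]invrK lef_pV2 ?posrE ?invr_gt0// ltW.
apply: (@le_trans _ _ (n%:R^-1)%:C%C); last by rewrite lecE /= eqxx.
rewrite rmorphV ?unitfE ?gt_eqF// rmorph_nat exprVn lef_pV2 ?posrE ?exprn_gt0 ?ltr0n//.
  by rewrite -natrX ler_nat ltnW// ltn_expl.
Qed.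

Section AutomaticContinuity.
Context {R : realType}.

Lemma norm_half_pow_eq0 (V : normedModType R[i]) (x : V) (c : R[i]) :
  (forall n, `|x| <= c * 2^-1 ^+ n) -> x = 0.
Proof.
move=> h; have c0 : 0 <= c by have := h 0; rewrite expr0 mulr1; apply: le_trans.
apply: norm_small_eq0 => e e0.
have c1 : 0 < c + 1 by rewrite ltr_wpDl.
have e1 : 0 < e / (c + 1) by rewrite divr_gt0.
have [n hn] := half_pow_small e1; apply: le_trans (h n) _.
apply: (@le_trans _ _ (c * (e / (c + 1)))); first by rewrite ler_wpM2l.
by rewrite mulrCA ger_pMr// ler_pdivrMr// mul1r lerDl.
Qed.

Variables (B : cstarType R) (e : B).
Hypothesis ue : is_unit_of e.

(** A square root k of e - h^2 is e - y, where y = (h^2 + y^2) / 2.  The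
    right-hand side is a contraction on the ball of radius 1/2; its iterates are
    self-adjoint and commute with h, and so does its fixed point. *)
Lemma cstar_sqrt (h : B) : h^# = h -> `|h| <= 2^-1 ->
  exists k, [/\ k^# = k, h ** k = k ** h & h ** h + k ** k = e].
Proof.
move=> ha hn; pose H : R[i] := 2^-1.
have H0 : 0 <= H by rewrite invr_ge0 ler0n.
have HH : H + H = 1 by rewrite [RHS](splitr 1) mul1r.
have H1 : H <= 1 by rewrite -HH lerDl.
pose f (y : B) := H *: (h ** h + y ** y).
pose y n := iter n f 0.
have yn n : `|y n| <= H.
  elim: n => [|n IH]; first by rewrite normr0.
  rewrite /= normrZ ger0_norm// -[leRHS]mulr1 ler_wpM2l//.
  apply: le_trans (ler_normD _ _) _; rewrite -HH lerD//;
    apply: le_trans (cmul_norm _ _) _; rewrite -[leRHS]mulr1 ler_pM//;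
    exact: le_trans H1.
have fc (u v : B) : `|f u - f v| <= H * ((`|u| + `|v|) * `|u - v|).
  rewrite -scalerBr normrZ ger0_norm// ler_wpM2l// opprD addrACA subrr add0r.
  have -> : u ** u - v ** v = u ** (u - v) + (u - v) ** v.
    by rewrite cmulBr cmulBl addrA subrK.
  apply: le_trans (ler_normD _ _) _.
  by rewrite mulrDl lerD// ?cmul_norm// [leRHS]mulrC cmul_norm.
(* The iterates are a Cauchy sequence, the contraction factor being 1/2. *)
have yc n m : `|y (n + m)%N - y n| <= H ^+ n.
  elim: n => [|n IH]; first by rewrite add0n subr0 expr0; exact: le_trans H1.
  rewrite addSn exprS; apply: le_trans (fc _ _) _.
  rewrite ler_wpM2l//; apply: le_trans IH; rewrite ler_piMl//.
  by rewrite -HH lerD.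
pose Q (r : R[i]) d := exists2 n, d = y n & H ^+ n <= r.
have [||k kQ] := @complete_approx _ B Q.
- by move=> r /half_pow_small [n hn']; exists (y n), n.
- move=> r r' d d' r0 r'0 [n -> nr] [m -> mr].
  wlog nm : n m r r' r0 r'0 nr mr / (n <= m)%N => [wh|].
    have [/wh|/ltnW/wh] := leqP n m; first exact.
    by rewrite distrC [r + r']addrC; exact.
  rewrite -(subnKC nm) distrC; apply: le_trans (yc _ _) _.
  by apply: le_trans nr _; rewrite lerDl ltW.
have Hp n : 0 < H ^+ n by rewrite exprn_gt0// invr_gt0 ltr0n.
have ky n : `|k - y n| <= H ^+ n by apply: kQ => //; exists n.
have kn : `|k| <= 1 + H.
  rewrite -[k](subrK (y 0)) /= addr0; apply: le_trans (ky 0) _.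
  by rewrite expr0 lerDl.
have ya n : (y n)^# = y n.
  elim: n => [|n IH]; first exact: adj0.
  by rewrite /= adjZ adjD !adjM ha IH geC0_conj.
have yh n : h ** y n = y n ** h.
  elim: n => [|n IH]; first by rewrite cmulr0 cmul0.
  by rewrite /= cmulZl cmulZr cmulDl cmulDr !cmulA IH -!cmulA IH.
have ka : k^# = k.
  apply/subr0_eq/(@norm_half_pow_eq0 _ _ 2) => n.
  have -> : k^# - k = (k - y n)^# - (k - y n).
    by rewrite adjB ya opprB addrA subrK.
  apply: le_trans (ler_normB _ _) _.
  by rewrite adj_norm mulr2n mulrDl mul1r lerD.
have kh : h ** k = k ** h.
  apply/subr0_eq/(@norm_half_pow_eq0 _ _ (2 * `|h|)) => n.
  have -> : h ** k - k ** h = h ** (k - y n) - (k - y n) ** h.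
    by rewrite cmulBr cmulBl yh opprB addrA subrK.
  apply: le_trans (ler_normB _ _) _.
  rewrite mulr2n !mulrDl mul1r lerD//; apply: le_trans (cmul_norm _ _) _.
    by rewrite ler_wpM2l.
  by rewrite mulrC ler_wpM2l.
have kf : k = f k.
  apply/subr0_eq/(@norm_half_pow_eq0 _ _ 2) => n.
  have -> : k - f k = (k - y n.+1) + (f (y n) - f k) by rewrite addrA subrK.
  apply: le_trans (ler_normD _ _) _; rewrite mulr2n mulrDl mul1r lerD//.
    by apply: le_trans (ky _) _; rewrite exprS ler_piMl// ltW.
  apply: le_trans (fc _ _) _; rewrite mulrA.
  apply: (@le_trans _ _ (1 * H ^+ n)); last by rewrite mul1r.
  rewrite distrC ler_pM// ?mulr_ge0 ?addr_ge0//.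
  apply: (@le_trans _ _ (H * (1 + 1))); last by rewrite mulrDr mulr1 HH.
  rewrite ler_wpM2l//; apply: le_trans (lerD (yn n) kn) _.
  by rewrite addrCA HH.
have kk : h ** h + k ** k = k + k.
  by rewrite {3 4}kf -scalerDl HH scale1r.
(* The fixed point k satisfies h^2 + k^2 = 2 k, so (e - k)^2 = e - h^2. *)
exists (e - k); split.
- by rewrite adjB ka unit_adj.
- by rewrite cmulBr cmulBl (ue h).1 (ue h).2 kh.
- rewrite cmulBl !cmulBr !(ue _).1 !(ue _).2 opprB addrCA.
  by rewrite [h ** h + _]addrA kk addrK subrK.
Qed.

Variable D : cstarType R.

Lemma star_homB (phi : B -> D) : star_hom phi -> {morph phi : x y / x - y}.
Proof.
by move=> [pD pZ _ _] x y; rewrite pD -[- y]scaleN1r pZ scaleN1r.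
Qed.

(** For h self-adjoint, u = h + i sqrt(e - h^2) is unitary, and the image of a
    unitary has norm at most 1.  The C*-identity reduces the general case to
    this one.  The radius 1/2 is enough for continuity. *)
Lemma star_hom_bounded (phi : B -> D) x : star_hom phi ->
  `|x| <= 2^-1 -> `|phi x| <= 1.
Proof.
move=> [pD pZ pM pS].
have pe : is_projection (phi e).
  have [ea ee] := unit_projection ue.
  by split; [rewrite -pS ea | rewrite -pM ee].
have sa h : h^# = h -> `|h| <= 2^-1 -> `|phi h| <= 1.
  move=> ha hn; have [k [ka hk hkk]] := cstar_sqrt ha hn.
  apply: (@unitary_bound _ _ _ (phi k) (phi e)) => //.
  - by rewrite -pS ha.
  - by rewrite -pS ka.
  - by rewrite -!pM hk.
  - by rewrite expr1n scale1r -!pM -pD hkk.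
move=> xn; apply: cstar_norm_le => //.
rewrite expr1n -pS -pM; apply: sa; first by rewrite adjM adjK.
rewrite cstar_identity expr2 -[leRHS]mul1r ler_pM//.
by apply: le_trans xn _; rewrite invf_le1 ?ltr0n ?ler1n.
Qed.

Lemma star_hom_eq (phi psi : B -> D) (S : set B) : star_hom phi -> star_hom psi ->
  closure S = setT -> (forall x, S x -> phi x = psi x) -> phi = psi.
Proof.
move=> hphi hpsi cS eqS; apply/funext => x; apply/subr0_eq/norm_small_eq0 => r r0.
have r2 : 0 < r / 2 by rewrite divr_gt0 ?ltr0n.
have r4 : 0 < r / 2 / 2 by rewrite divr_gt0 ?ltr0n.
have : closure S x by rewrite cS.
move=> /(_ _ (nbhsx_ballx x _ r4)) [s [Ss]]; rewrite -ball_normE /= => xs.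
have bd (chi : B -> D) : star_hom chi -> `|chi x - chi s| <= r / 2.
  move=> hchi; rewrite -star_homB//; have [_ chiZ _ _] := hchi.
  have -> : x - s = (r / 2) *: ((r / 2)^-1 *: (x - s)).
    by rewrite scalerA divff ?scale1r// gt_eqF.
  rewrite chiZ normrZ gtr0_norm// ger_pMr//; apply: star_hom_bounded => //.
  rewrite normrZ gtr0_norm ?invr_gt0// mulrC ler_pdivrMr// mulrC.
  exact: ltW.
have -> : phi x - psi x = (phi x - phi s) - (psi x - psi s).
  by rewrite (eqS s)// opprB addrA subrK.
rewrite (splitr r); apply: le_trans (ler_normB _ _) _.
by rewrite lerD// bd.
Qed.

End AutomaticContinuity.

(** * Uniform closure of a bounded family *)

(** A family of C*-algebras, together with a *-algebra of bounded elements of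
    their product. *)
Record star_family (R : realType) := StarFamily {
  fam_index : Type;
  fam_fibre : fam_index -> cstarType R;
  fam_set : set (forall i, fam_fibre i);
  fam_set0 : fam_set (fun=> 0);
  fam_setD : forall x y, fam_set x -> fam_set y -> fam_set (fun i => x i + y i);
  fam_setZ : forall (c : R[i]) x, fam_set x -> fam_set (fun i => c *: x i);
  fam_setM : forall x y, fam_set x -> fam_set y -> fam_set (fun i => x i ** y i);
  fam_set_adj : forall x, fam_set x -> fam_set (fun i => (x i)^#);
  fam_set_bounded : forall x, fam_set x ->
    exists M : R[i], forall i, `|x i| <= M
}.

Section ClosedSpan.
Context {R : realType} (F : star_family R).
Local Notation S := (@fam_set R F).
Local Notation D := (@fam_fibre R F).

(** The uniform closure of the *-algebra in the product.  Since its elements are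
    families, the algebraic laws hold coordinate by coordinate, and no quotient
    is taken. *)
Record closed_span := ClosedSpan {
  span_val :> forall i, D i;
  span_approx : forall e : R[i], 0 < e ->
    exists2 x, S x & forall i, `|span_val i - x i| <= e
}.
Implicit Types x y z : closed_span.

Lemma span_eq x y : (forall i, x i = y i) -> x = y.
Proof.
case: x y => x Px [y Py] /= h; have xy : x = y by exact: functional_extensionality_dep.
by case: _ / xy Py => Py; congr ClosedSpan; exact: Prop_irrelevance.
Qed.

Lemma mem_approx (x : forall i, D i) (e : R[i]) : S x -> 0 < e ->
  exists2 y, S y & forall i, `|x i - y i| <= e.
Proof. by move=> Sx e0; exists x => // i; rewrite subrr normr0 ltW. Qed.

Definition span_mem (x : forall i, D i) (Sx : S x) : closed_span :=
  ClosedSpan (fun e => mem_approx Sx).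

Lemma span_bounded x : exists M : R[i], forall i, `|x i| <= M.
Proof.
have [y Sy xy] := span_approx x ltr01; have [M yM] := fam_set_bounded Sy.
exists (1 + M) => i; rewrite -(subrK (y i) (x i)).
by apply: le_trans (ler_normD _ _) _; rewrite lerD.
Qed.

Lemma addapprox x y (e : R[i]) : 0 < e ->
  exists2 z, S z & forall i, `|(x i + y i) - z i| <= e.
Proof.
move=> e0; have e2 : 0 < e / 2 by rewrite divr_gt0 ?ltr0n.
have [x' Sx xx] := span_approx x e2; have [y' Sy yy] := span_approx y e2.
exists (fun i => x' i + y' i) => [|i]; first exact: fam_setD.
by rewrite opprD addrACA (splitr e) (le_trans (ler_normD _ _))// lerD.
Qed.

Lemma scaleapprox (c : R[i]) x (e : R[i]) : 0 < e ->
  exists2 z, S z & forall i, `|(c *: x i) - z i| <= e.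
Proof.
move=> e0; have c1 : 0 < `|c| + 1 by rewrite ltr_wpDl.
have e2 : 0 < e / (`|c| + 1) by rewrite divr_gt0.
have [x' Sx xx] := span_approx x e2.
exists (fun i => c *: x' i) => [|i]; first exact: fam_setZ.
rewrite -scalerBr normrZ; apply: (@le_trans _ _ (`|c| * (e / (`|c| + 1)))).
  by apply: ler_wpM2l; [exact: normr_ge0 | exact: xx].
by rewrite mulrCA ger_pMr// ler_pdivrMr// mul1r lerDl.
Qed.

Lemma adjapprox x (e : R[i]) : 0 < e ->
  exists2 z, S z & forall i, `|(x i)^# - z i| <= e.
Proof.
move=> e0; have [x' Sx xx] := span_approx x e0.
exists (fun i => (x' i)^#) => [|i]; first exact: fam_set_adj.
by rewrite -adjB adj_norm.
Qed.

(** Where x and y are bounded by r and s, errors g on both factors make an error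
    of at most g s + (r + g) g on the product, which is at most e for
    g = e / (e + s + r + 1). *)
Lemma mulapprox x y (e : R[i]) : 0 < e ->
  exists2 z, S z & forall i, `|(x i ** y i) - z i| <= e.
Proof.
move=> e0; have [r xr] := span_bounded x; have [s ys] := span_bounded y.
pose t := `|s| + `|r| + 1.
have t1 : 0 < t by rewrite ltr_wpDl// addr_ge0.
have et : 0 < e + t by rewrite addr_gt0.
pose g := e / (e + t); have g0 : 0 < g by rewrite divr_gt0.
have g1 : g <= 1 by rewrite ler_pdivrMr// mul1r lerDl ltW.
have le : g * `|s| + (`|r| + g) * g <= e.
  apply: (@le_trans _ _ (g * t)).
    by rewrite [_ * g]mulrC -mulrDr ler_pM2l// addrA lerD2l.
  by rewrite /g mulrAC ler_pdivrMr// ler_pM2l// lerDr ltW.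
have [x' Sx xx] := span_approx x g0; have [y' Sy yy] := span_approx y g0.
exists (fun i => x' i ** y' i) => [|i]; first exact: fam_setM.
have -> : x i ** y i - x' i ** y' i =
    (x i - x' i) ** y i + x' i ** (y i - y' i).
  by rewrite cmulBl cmulBr addrA subrK.
have nr (u : R[i]) (d : D i) : `|d| <= u -> `|d| <= `|u|.
  by move=> du; rewrite ger0_norm// (le_trans _ du).
apply: le_trans (ler_normD _ _) (le_trans (lerD _ _) le).
  by apply: le_trans (cmul_norm _ _) _; apply: ler_pM => //; [exact: xx|apply: nr; exact: ys].
apply: le_trans (cmul_norm _ _) _; apply: ler_pM => //; last exact: yy.
rewrite -(subrK (x i) (x' i)) addrC; apply: le_trans (ler_normD _ _) _.
by apply: lerD; [apply: nr; exact: xr | rewrite distrC; exact: xx].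
Qed.

Lemma oppapprox x (e : R[i]) : 0 < e ->
  exists2 z, S z & forall i, `|(- x i) - z i| <= e.
Proof.
move=> /(scaleapprox (-1) x) [z Sz h]; exists z => // i.
by rewrite -(scaleN1r (x i)); exact: h.
Qed.

HB.instance Definition _ := gen_eqMixin closed_span.
HB.instance Definition _ := gen_choiceMixin closed_span.

Definition span_zero : closed_span := span_mem (fam_set0 F).
Definition span_add x y : closed_span := ClosedSpan (fun e => addapprox x y (e:=e)).
Definition span_opp x : closed_span := ClosedSpan (fun e => oppapprox x (e:=e)).
Definition span_scale c x : closed_span := ClosedSpan (fun e => scaleapprox c x (e:=e)).
Definition span_mul x y : closed_span := ClosedSpan (fun e => mulapprox x y (e:=e)).
Definition span_adj x : closed_span := ClosedSpan (fun e => adjapprox x (e:=e)).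

Lemma span_addA : associative span_add.
Proof. by move=> *; apply: span_eq => i /=; rewrite addrA. Qed.
Lemma span_addC : commutative span_add.
Proof. by move=> *; apply: span_eq => i /=; rewrite addrC. Qed.
Lemma span_add0 : left_id span_zero span_add.
Proof. by move=> *; apply: span_eq => i /=; rewrite add0r. Qed.
Lemma span_addN : left_inverse span_zero span_opp span_add.
Proof. by move=> *; apply: span_eq => i /=; rewrite addNr. Qed.

HB.instance Definition _ := GRing.isZmodule.Build closed_span
  span_addA span_addC span_add0 span_addN.

Lemma span_scaleA a b x : span_scale a (span_scale b x) = span_scale (a * b) x.
Proof. by apply: span_eq => i /=; rewrite scalerA. Qed.
Lemma span_scale1 : left_id 1 span_scale.
Proof. by move=> *; apply: span_eq => i /=; rewrite scale1r. Qed.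
Lemma span_scaleDr : right_distributive span_scale +%R.
Proof. by move=> *; apply: span_eq => i /=; rewrite scalerDr. Qed.
Lemma span_scaleDl x : {morph span_scale^~ x : a b / a + b}.
Proof. by move=> *; apply: span_eq => i /=; rewrite scalerDl. Qed.

HB.instance Definition _ := GRing.Zmodule_isLmodule.Build (R[i] : numFieldType) closed_span
  span_scaleA span_scale1 span_scaleDr span_scaleDl.

(** The value 0 is added for the sake of an empty family, whose supremum has to
    be 0. *)
Definition span_norms x : set R :=
  [set r | r = 0 \/ exists i, r = complex.Re `|x i|].

Definition span_norm x : R[i] := (sup (span_norms x))%:C%C.

Lemma complex_RRe (c : R[i]) : 0 <= c -> (complex.Re c)%:C%C = c.
Proof. by case: c => a b; rewrite lecE /= => /andP[/eqP ->]. Qed.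

(** All the facts about the norm are derived from this characterization of the
    supremum. *)
Lemma span_norm_le x (c : R[i]) : 0 <= c ->
  (span_norm x <= c) <-> (forall i, `|x i| <= c).
Proof.
move=> c0; rewrite -(complex_RRe c0) /span_norm lecR.
have s0 : span_norms x 0 by left.
split=> [h i|h].
  rewrite -[`|x i|]complex_RRe// lecR; apply: le_trans h; apply: ub_le_sup.
    have [M xM] := span_bounded x; exists `|complex.Re M| => _ [->//|[j ->]].
    have M0 : 0 <= M by apply: le_trans (xM j).
    apply: le_trans (ler_norm _); rewrite -lecR !complex_RRe//; exact: xM.
  by right; exists i.
apply: ge_sup; first by exists 0.
move=> _ [->|[i ->]]; first by rewrite -lecR complex_RRe.
by rewrite -lecR (complex_RRe (normr_ge0 _)); exact: h.
Qed.

Lemma span_norm_ge0 x : 0 <= span_norm x.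
Proof.
rewrite /span_norm (_ : 0 = 0%:C%C)// lecR; apply: ub_le_sup; last by left.
have [M xM] := span_bounded x; exists `|complex.Re M| => _ [->//|[j ->]].
have M0 : 0 <= M by apply: le_trans (xM j).
apply: le_trans (ler_norm _); rewrite -lecR !complex_RRe//; exact: xM.
Qed.

Lemma le_span_norm x i : `|x i| <= span_norm x.
Proof. by move: i; apply/span_norm_le => //; exact: span_norm_ge0. Qed.

Lemma span_normD x y : span_norm (x + y) <= span_norm x + span_norm y.
Proof.
apply/span_norm_le => [|i]; first by rewrite addr_ge0 ?span_norm_ge0.
by apply: le_trans (ler_normD _ _) _; rewrite lerD ?le_span_norm.
Qed.

Lemma span_normZ (c : R[i]) x : span_norm (c *: x) = `|c| * span_norm x.
Proof.
apply/eqP; rewrite eq_le; apply/andP; split.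
  apply/span_norm_le => [|i]; first by rewrite mulr_ge0 ?span_norm_ge0.
  by rewrite normrZ ler_wpM2l// le_span_norm.
have [->|c0] := eqVneq c 0; first by rewrite normr0 mul0r span_norm_ge0.
rewrite -ler_pdivlMl ?normr_gt0//; apply/span_norm_le => [|i].
  by rewrite mulr_ge0 ?invr_ge0 ?span_norm_ge0.
by rewrite ler_pdivlMl ?normr_gt0// -normrZ; exact: le_span_norm (c *: x) i.
Qed.

Lemma span_norm_eq0 x : span_norm x = 0 -> x = 0.
Proof.
move=> x0; apply: span_eq => i; apply/eqP; rewrite -normr_le0 -x0.
exact: le_span_norm.
Qed.

HB.instance Definition _ := Lmodule_isNormed.Build (R[i] : numFieldType) closed_span
  span_normD span_normZ span_norm_eq0.

(** The coordinates of a Cauchy filter converge, and they do so uniformly: the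
    bound at each scale does not depend on the coordinate. *)
Lemma span_complete (G : set_system closed_span) :
  ProperFilter G -> cauchy G -> cvg G.
Proof.
move=> FG /cauchyP cG.
have GG (e : R[i]) x x' e' : G (ball x e) -> G (ball x' e') ->
    forall i, `|x i - x' i| <= e + e'.
  move=> Ge Ge' i; have [y []] := filter_ex (filterI Ge Ge').
  rewrite -!ball_normE /= => xy xy'.
  have -> : x i - x' i = (x i - y i) - (x' i - y i) by rewrite opprB addrA subrK.
  apply: le_trans (ler_normB _ _) _; rewrite lerD//.
    exact: le_trans (le_span_norm (x - y) i) (ltW xy).
  exact: le_trans (le_span_norm (x' - y) i) (ltW xy').
have lQ i : {d : D i | forall (e : R[i]) x, 0 < e ->
    G (ball x e) -> `|d - x i| <= e}.
  apply: cid; pose Q (e : R[i]) d := exists2 x, G (ball x e) & d = x i.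
  have [|| d dP] := @complete_approx _ (D i) Q.
  - by move=> e e0; have [x Gx] := cG _ e0; exists (x i), x.
  - by move=> e e' d d' e0 e'0 [x Gx ->] [x' Gx' ->]; exact: GG.
  - by exists d => e x e0 Gx; apply: dP => //; exists x.
pose l i := sval (lQ i); have lP i := svalP (lQ i).
have lapprox (e : R[i]) : 0 < e -> exists2 z, S z & forall i, `|l i - z i| <= e.
  move=> e0; have e2 : 0 < e / 2 by rewrite divr_gt0 ?ltr0n.
  have [x Gx] := cG _ e2; have [z Sz xz] := span_approx x e2.
  exists z => // i; rewrite -(subrK (x i) (l i)) -addrA (splitr e).
  by apply: le_trans (ler_normD _ _) _; rewrite lerD// lP.
apply/cvg_ex; exists (ClosedSpan lapprox); apply/fcvgrPdist_lt => e e0.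
have e2 : 0 < e / 2 by rewrite divr_gt0 ?ltr0n.
have e4 : 0 < e / 2 / 2 by rewrite divr_gt0 ?ltr0n.
have [x Gx] := cG _ e4; apply: filterS (Gx) => y.
rewrite -ball_normE /= => xy; apply: (@le_lt_trans _ _ (e / 2)); last first.
  by rewrite ltr_pdivrMr ?ltr0n// ltr_pMr// ltr1n.
apply/span_norm_le; first exact: ltW.
move=> i /=.
have -> : l i - y i = (l i - x i) + (x i - y i) by rewrite addrA subrK.
rewrite (splitr (e / 2)); apply: le_trans (ler_normD _ _) _; apply: lerD.
  exact: lP.
exact: le_trans (le_span_norm (x - y) i) (ltW xy).
Qed.

HB.instance Definition _ := Uniform_isComplete.Build closed_span span_complete.

Lemma span_mulA : associative span_mul.
Proof. by move=> *; apply: span_eq => i /=; rewrite cmulA. Qed.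
Lemma span_mulDl : left_distributive span_mul +%R.
Proof. by move=> *; apply: span_eq => i /=; rewrite cmulDl. Qed.
Lemma span_mulDr : right_distributive span_mul +%R.
Proof. by move=> *; apply: span_eq => i /=; rewrite cmulDr. Qed.
Lemma span_mulZl (c : R[i]) x y : span_mul (c *: x) y = c *: span_mul x y.
Proof. by apply: span_eq => i /=; rewrite cmulZl. Qed.
Lemma span_mulZr (c : R[i]) x y : span_mul x (c *: y) = c *: span_mul x y.
Proof. by apply: span_eq => i /=; rewrite cmulZr. Qed.
Lemma span_mul_norm x y : `|span_mul x y| <= `|x| * `|y|.
Proof.
apply/span_norm_le => [|i]; first by rewrite mulr_ge0.
by apply: le_trans (cmul_norm _ _) _; rewrite ler_pM// le_span_norm.
Qed.
Lemma span_adjK : involutive span_adj.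
Proof. by move=> *; apply: span_eq => i /=; rewrite adjK. Qed.
Lemma span_adjD : {morph span_adj : x y / x + y}.
Proof. by move=> *; apply: span_eq => i /=; rewrite adjD. Qed.
Lemma span_adjZ (c : R[i]) x : span_adj (c *: x) = c^* *: span_adj x.
Proof. by apply: span_eq => i /=; rewrite adjZ. Qed.
Lemma span_adjM x y : span_adj (span_mul x y) = span_mul (span_adj y) (span_adj x).
Proof. by apply: span_eq => i /=; rewrite adjM. Qed.
Lemma span_cstar x : `|span_mul (span_adj x) x| = `|x| ^+ 2.
Proof.
apply/eqP; rewrite eq_le; apply/andP; split.
  apply/span_norm_le => [|i]; first by rewrite exprn_ge0.
  by rewrite cstar_identity ler_pXn2r ?nnegrE// le_span_norm.
(* The square root turns the bound of the squares of the coordinates by n into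
   a bound of the norm of x. *)
set n := `|span_mul _ _|; have n0 : 0 <= n by exact: normr_ge0.
rewrite -[leRHS]sqrtCK ler_pXn2r ?nnegrE ?sqrtC_ge0//.
apply/span_norm_le => [|i]; first by rewrite sqrtC_ge0.
rewrite -(@ler_pXn2r _ 2) ?nnegrE ?sqrtC_ge0// sqrtCK -cstar_identity.
exact: (le_span_norm (span_mul (span_adj x) x) i).
Qed.

HB.instance Definition _ := CompleteNormedModule_isCstar.Build R closed_span
  span_mulA span_mulDl span_mulDr span_mulZl span_mulZr span_mul_norm
  span_adjK span_adjD span_adjZ span_adjM span_cstar.

End ClosedSpan.

(** * Existence of the full C*-algebra of a groupoid *)

Section ZeroAlgebra.
Variable R : realType.

(** The empty product is the zero algebra. *)
Definition zero_family : star_family R.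
Proof.
refine (@StarFamily R void (fun i => match i with end) setT _ _ _ _ _ _) => //.
by move=> x _; exists 0; case.
Defined.

Definition zero_algebra : cstarType R := closed_span zero_family.

Lemma zero_algebra_eq (x y : zero_algebra) : x = y.
Proof. by apply: span_eq; case. Qed.

End ZeroAlgebra.

Section FullGroupoidAlgebra.
Context {R : realType} (G : groupoid).
Local Notation C := R[i].
Local Notation T := (ambient G).
Implicit Types f g : T -> C.

Lemma Cc_repP (D : cstarType R) (pi : (T -> C) -> D) :
  [/\ forall f g, Cc f -> Cc g -> pi (f + g) = pi f + pi g,
      forall (c : C) f, Cc f -> pi (fun x => c * f x) = c *: pi f,
      forall f g, Cc f -> Cc g -> pi (convolution f g) = pi f ** pi g &
      forall f, Cc f -> pi (involution f) = (pi f)^#] <-> Cc_rep pi.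
Proof.
split=> -[pD pZ pM pS]; split.
- by move=> f g; rewrite !inE; exact: pD.
- by move=> c f; rewrite !inE; exact: pZ.
- by move=> f g; rewrite !inE; exact: pM.
- by move=> f; rewrite !inE; exact: pS.
- by move=> f g Cf Cg; apply: pD; rewrite inE.
- by move=> c f Cf; apply: pZ; rewrite inE.
- by move=> f g Cf Cg; apply: pM; rewrite inE.
- by move=> f Cf; apply: pS; rewrite inE.
Qed.

Lemma zero_rep : Cc_rep (fun _ : T -> C => 0 : zero_algebra R).
Proof. by apply/Cc_repP; split=> *; exact: zero_algebra_eq. Qed.

Hypothesis Cc0 : Cc (0 : T -> C).
Hypothesis CcD : forall f g, Cc f -> Cc g -> Cc (f + g).
Hypothesis CcZ : forall (c : C) f, Cc f -> Cc (fun x => c * f x).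
Hypothesis CcM : forall f g, Cc f -> Cc g -> Cc (convolution f g).
Hypothesis Ccinv : forall f, Cc f -> Cc (involution f).
Hypothesis rep_bounded : forall f, Cc f ->
  exists M : C, forall (D : cstarType R) (pi : (T -> C) -> D),
    Cc_rep pi -> `|pi f| <= M.

(** A bundle, for the choice of representations indexed by functions. *)
Record representation := Representation {
  rep_alg : cstarType R;
  rep_map :> (T -> C) -> rep_alg;
  rep_proof : Cc_rep rep_map
}.

(** The representations form no set to take a product over; those that nearly
    attain the supremum for some f, one for each f and each n, give the same
    norm. *)
Lemma almost_norming (i : (T -> C) * nat) : exists pi : representation,
  Cc i.1 -> forall pi' : representation, `|pi' i.1| <= `|pi i.1| + 2^-1 ^+ i.2.
Proof.
case: i => f n /=; have [Cf|nCf] := pselect (Cc f); last by exists (Representation zero_rep).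
have [M bM] := rep_bounded Cf.
pose A := [set r : R | exists pi : representation, r = complex.Re `|pi f|].
have A0 : A !=set0 by exists (complex.Re `|(Representation zero_rep) f|),
  (Representation zero_rep).
have Aub : has_ubound A.
  exists (complex.Re M) => _ [pi ->]; have h := bM _ _ (rep_proof pi).
  rewrite -lecR (complex_RRe (normr_ge0 _)) complex_RRe//.
  exact: le_trans h.
have e0 : 0 < 2^-1 ^+ n :> R by rewrite exprn_gt0// invr_gt0 ltr0n.
have [_ [pi ->] lt] := sup_adherent e0 (conj A0 Aub).
exists pi => _ pi'; rewrite -(complex_RRe (normr_ge0 (pi' f))).
rewrite -(complex_RRe (normr_ge0 (pi f))).
have -> : (2^-1 : C) ^+ n = (2^-1 ^+ n)%:C%C.
  by rewrite rmorphXn /= rmorphV ?unitfE ?pnatr_eq0// rmorph_nat.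
rewrite -rmorphD lecR; rewrite -lerBlDr; apply: (@le_trans _ _ (sup A - 2^-1 ^+ n)).
  by rewrite lerD2r; apply: ub_le_sup => //; exists pi'.
exact: ltW.
Qed.

(** The closure of C_c(G) in the product of the almost norming
    representations. *)
Theorem full_groupoid_Cstar_exists : exists B : cstarType R, is_full_groupoid_Cstar G B.
Proof.
pose pi_ (i : (T -> C) * nat) := sval (cid (almost_norming i)).
have piP i := svalP (cid (almost_norming i)).
pose S : set (forall i, rep_alg (pi_ i)) :=
  [set x | exists2 f, Cc f & x = fun i => pi_ i f].
have piE i := (Cc_repP (pi_ i)).2 (rep_proof (pi_ i)).
have E x y : (forall i, x i = y i) -> x = y :> forall i, rep_alg (pi_ i).
  exact: functional_extensionality_dep.
unshelve eset (F := @StarFamily R _ _ S _ _ _ _ _ _).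
- exists 0 => //; apply: E => i; have [_ pZ _ _] := piE i.
  rewrite -(scale0r (pi_ i 0)) -pZ//; congr (rep_map _ _).
  by apply/funext => x; rewrite mul0r.
- move=> _ _ [f Cf ->] [g Cg ->]; exists (f + g); first exact: CcD.
  by apply: E => i; have [h _ _ _] := piE i; rewrite h.
- move=> c _ [f Cf ->]; exists (fun x => c * f x); first exact: CcZ.
  by apply: E => i; have [_ h _ _] := piE i; rewrite h.
- move=> _ _ [f Cf ->] [g Cg ->]; exists (convolution f g); first exact: CcM.
  by apply: E => i; have [_ _ h _] := piE i; rewrite h.
- move=> _ [f Cf ->]; exists (involution f); first exact: Ccinv.
  by apply: E => i; have [_ _ _ h] := piE i; rewrite h.
- move=> _ [f Cf ->]; have [M bM] := rep_bounded Cf; exists M => i.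
  exact/bM/rep_proof.
have SC f : Cc f -> fam_set (s:=F) (fun i => pi_ i f) by move=> Cf; exists f.
pose iota f : closed_span F :=
  if pselect (Cc f) is left Cf then span_mem (SC f Cf) else 0.
have iotaE f i : Cc f -> iota f i = pi_ i f.
  by rewrite /iota; case: pselect.
exists (closed_span F), iota; split.
- apply/Cc_repP; split.
  + move=> f g Cf Cg; apply: span_eq => i /=; have [pD _ _ _] := piE i.
    by rewrite !iotaE ?pD//; exact: CcD.
  + move=> c f Cf; apply: span_eq => i /=; have [_ pZ _ _] := piE i.
    by rewrite !iotaE ?pZ//; exact: CcZ.
  + move=> f g Cf Cg; apply: span_eq => i /=; have [_ _ pM _] := piE i.
    by rewrite !iotaE ?pM//; exact: CcM.
  + move=> f Cf; apply: span_eq => i /=; have [_ _ _ pS] := piE i.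
    by rewrite !iotaE ?pS//; exact: Ccinv.
- apply/seteqP; split=> // x _ U /nbhs_ballP [e /= e0 eU].
  have e2 : 0 < e / 2 by rewrite divr_gt0 ?ltr0n.
  have [_ [f Cf ->] xf] := span_approx x e2.
  exists (iota f); split; first by exists f.
  apply: eU; rewrite -ball_normE /=; apply: (@le_lt_trans _ _ (e / 2)).
    by apply/span_norm_le => [|i /=]; [exact: ltW | rewrite iotaE//; exact: xf].
  by rewrite ltr_pdivrMr ?ltr0n// ltr_pMr// ltr1n.
- move=> f Cf; split.
    move=> _ [D [pi [pirep ->]]]; apply: norm_le_addgt0 => // e /half_pow_small [n ne].
    apply: le_trans (piP (f, n) Cf (Representation pirep)) _; rewrite lerD//=.
    by have := le_span_norm (iota f) (f, n); rewrite iotaE.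
  move=> u uP; apply/span_norm_le => [|i].
    by apply: le_trans (normr_ge0 (pi_ (f, 0) f)) _; apply: uP; exists _, (pi_ (f, 0));
      split=> //; exact: rep_proof.
  by rewrite iotaE//; apply: uP; exists _, (pi_ i); split=> //; exact: rep_proof.
Qed.

End FullGroupoidAlgebra.

(** * The partial action of the free group on sequences *)

Section Words.
Context {A : pointedType}.
Implicit Types (x y z : nat -> A) (u v w : seq A).

Lemma wcat0 x : wcat [::] x = x.
Proof. by apply/funext => n; rewrite /wcat nth_nil subn0. Qed.

Lemma wcat_cat u v x : wcat (u ++ v) x = wcat u (wcat v x).
Proof.
apply/funext => n; rewrite /wcat nth_cat size_cat; case: ltnP => h.
  exact: set_nth_default.
by rewrite subnDA [RHS]nth_default.
Qed.

Lemma wcat_inj w : injective (wcat w).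
Proof.
move=> x y h; apply/funext => n; have := congr1 (@^~ (size w + n)%N) h.
by rewrite /wcat !nth_default ?leq_addr// addKn.
Qed.

Lemma wcat1_inj (l m : A) x y : wcat [:: l] x = wcat [:: m] y -> l = m /\ x = y.
Proof.
move=> h; have lm : l = m by have := congr1 (@^~ 0%N) h.
by split=> //; move: h; rewrite lm => /wcat_inj.
Qed.

Lemma block_wcat w x : block w (wcat w x).
Proof.
exists 0%N, (size w); apply: (@eq_from_nth _ (x 0%N)) => [|i iw].
  by rewrite size_map size_iota.
rewrite (nth_map 0%N) ?size_iota// nth_iota// add0n /wcat.
exact: set_nth_default.
Qed.

Lemma block_cat u w x : block w x -> block w (wcat u x).
Proof.
move=> [m [n ->]]; exists (size u + m)%N, n; rewrite iotaDl -map_comp.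
by apply: eq_map => i /=; rewrite /wcat nth_default ?leq_addr// addKn.
Qed.

Lemma blockP w x : block w x -> exists u y, x = wcat u (wcat w y).
Proof.
move=> [m [n ->]]; exists [seq x i | i <- iota 0 m], (fun k => x (k + (m + n))%N).
rewrite -wcat_cat -map_cat -{2}[m]add0n -iotaD; apply/funext => k; rewrite /wcat.
rewrite size_map size_iota; case: (ltnP k (m + n)) => h.
  by rewrite (nth_map 0%N) ?size_iota// nth_iota.
by rewrite nth_default ?size_map ?size_iota// subnK.
Qed.

End Words.

Section PartialAction.
Context {A : pointedType} (X : set (nat -> A)).
Hypothesis tailX : forall w x, X (wcat w x) -> X x.
Implicit Types (x y z : nat -> A) (a b w : seq A) (Y Z : set (nat -> A)).
Implicit Types (m : A * bool) (t u v : seq (A * bool)).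

Lemma languageP w : w = [::] \/ (exists x, X (wcat w x)) <-> language X w.
Proof.
split=> [[->|[x Xx]]|[->|[x Xx /blockP [u [y xE]]]]]; first by left.
- by right; exists (wcat w x) => //; exact: block_wcat.
- by left.
- by right; exists y; apply: (tailX (w := u)); rewrite -xE.
Qed.

Lemma language_wcat w x : X (wcat w x) -> language X w.
Proof. by move=> h; apply/languageP; right; exists x. Qed.

Lemma language_cat w w' : language X (w ++ w') -> language X w /\ language X w'.
Proof.
move=> /languageP [|[x]].
  by case: w => //= ->; split; left.
rewrite wcat_cat => h; split; first exact: language_wcat h.
exact: language_wcat (tailX h).
Qed.

Lemma Cset_language a b y : Cset X a b y -> language X a /\ language X b.
Proof.
by move=> [x [_ hb ha]]; split; [exact: language_wcat ha|exact: language_wcat hb].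
Qed.

Lemma Cset_nil : Cset X [::] [::] = X.
Proof.
apply/seteqP; split=> [y [x [-> h _]] //|y Xy].
by exists y; rewrite !wcat0.
Qed.

(** Each step also provides that the sets which it combines belong to the
    Boolean algebra; a bare induction on the generated algebra does not. *)
Lemma balg_ind (P : set (nat -> A) -> Prop) :
  P set0 -> P X ->
  (forall Y Z, balg X Y -> balg X Z -> P Y -> P Z -> P (Y `|` Z)) ->
  (forall Y Z, balg X Y -> balg X Z -> P Y -> P Z -> P (Y `&` Z)) ->
  (forall Y, balg X Y -> P Y -> P (X `\` Y)) ->
  (forall a b, language X a -> language X b -> P (Cset X a b)) ->
  forall Y, balg X Y -> P Y.
Proof.
move=> P0 PX PU PI PD PC Y BY.
pose M := [set Z | balg X Z /\ P Z].
suff : M Y by case.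
apply: BY; split; last first.
  move=> _ [a la [b lb <-]]; split; last exact: PC.
  by move=> N [_ NC]; apply: NC; exists a => //; exists b.
split.
- by split=> // N [[]].
- by split=> // N [[]].
- move=> U V [BU PU'] [BV PV]; split; last exact: PU.
  by move=> N NP; have [[_ _ NU _ _] _] := NP; apply: NU; [exact: BU|exact: BV].
- move=> U V [BU PU'] [BV PV]; split; last exact: PI.
  by move=> N NP; have [[_ _ _ NI _] _] := NP; apply: NI; [exact: BU|exact: BV].
- move=> U [BU PU']; split; last exact: PD.
  by move=> N NP; have [[_ _ _ _ ND] _] := NP; apply: ND; exact: BU.
Qed.

Lemma balg0 : balg X set0. Proof. by move=> N [[]]. Qed.
Lemma balgX : balg X X. Proof. by move=> N [[]]. Qed.
Lemma balgU Y Z : balg X Y -> balg X Z -> balg X (Y `|` Z).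
Proof.
move=> BU BV N NP; have [[_ _ NU _ _] _] := NP.
by apply: NU; [exact: BU|exact: BV].
Qed.
Lemma balgC Y : balg X Y -> balg X (X `\` Y).
Proof. by move=> BU N NP; have [[_ _ _ _ ND] _] := NP; apply: ND; exact: BU. Qed.
Lemma balg_Cset a b : language X a -> language X b -> balg X (Cset X a b).
Proof. by move=> la lb N [_ NC]; apply: NC; exists a => //; exists b. Qed.

Lemma balg_sub Y : balg X Y -> Y `<=` X.
Proof.
move: Y; apply: balg_ind => //.
- by move=> Y Z _ _ h h' y [/h|/h'].
- by move=> Y Z _ _ h h' y [/h].
- by move=> a b _ _ _ [x [-> ]].
Qed.

(** The letter (l, true) puts l in front of a sequence, (l, false) deletes a
    leading l; both are partial bijections of X. *)
Definition step m x y :=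
  [/\ X x, X y & if m.2 then y = wcat [:: m.1] x else x = wcat [:: m.1] y].

Lemma step_inv m x y : step m x y -> step (letter_inv m) y x.
Proof. by case: m => l [] [? ? /= ?]. Qed.

Lemma step_fun m x y y' : step m x y -> step m x y' -> y = y'.
Proof.
by case: m => l [] [_ _ /= e] [_ _ /=]; rewrite e => // /wcat_inj.
Qed.

(** The partial action of a word, its last letter acting first, as is the case
    for the product in the free group. *)
Fixpoint chain t x z : Prop :=
  if t is m :: t' then exists2 y, chain t' x y & step m y z
  else X x /\ x = z.

Lemma chain1 m x z : chain [:: m] x z <-> step m x z.
Proof.
split=> [[y [Xx <-]] //|h]; exists x => //=; by case: h.
Qed.

Lemma chain_X t x z : chain t x z -> X x /\ X z.
Proof.
by elim: t z => [|m t IH] z /= [] => [? <-//|y /IH [? ?] []].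
Qed.

Lemma chain_fun t x y z : chain t x y -> chain t x z -> y = z.
Proof.
elim: t y z => [|m t IH] y z /= []; first by move=> _ <- [_ <-].
by move=> y' h s [z' h' s']; move: s'; rewrite -(IH _ _ h h'); exact: step_fun.
Qed.

Lemma chain_cat t u x z :
  chain (t ++ u) x z <-> exists2 y, chain u x y & chain t y z.
Proof.
elim: t z => [|m t IH] z /=.
  split=> [h|[y h [_ <-]]//]; exists z => //; by have [] := chain_X h.
split=> [[y /IH [y' ? ?] ?]|[y' ? [y ? ?]]].
  by exists y' => //; exists y.
by exists y => //; apply/IH; exists y'.
Qed.

Lemma chain_inv t x z : chain t x z -> chain (rev (map letter_inv t)) z x.
Proof.
elim: t z => [|m t IH] z /=; first by move=> [? <-].
move=> [y /IH h /step_inv s]; rewrite rev_cons -cats1; apply/chain_cat.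
by exists y => //; apply/chain1.
Qed.

Lemma chain_invE t x z : chain (rev (map letter_inv t)) z x <-> chain t x z.
Proof.
split; last exact: chain_inv.
move=> /chain_inv; rewrite map_rev revK -map_comp (eq_map (g := id)) ?map_id//.
exact: letter_invK.
Qed.

(** Cancelling adjacent letters enlarges the domain and keeps the values: the
    partial action of a product extends the composite of the actions. *)
Lemma chain_push m t x y z :
  chain t x y -> step m y z -> chain (push m t) x z.
Proof.
case: t => [|n t] /= h s; first by exists y.
case: eqP => [nE|_]; last by exists y.
case: h => y' h; rewrite nE => /step_inv; rewrite letter_invK => s'.
by rewrite (step_fun s s').
Qed.

Lemma chain_mul t u x y z :
  chain u x y -> chain t y z -> chain (foldr push u t) x z.
Proof.
move=> hu; elim: t z => [|m t IH] z /=; first by move=> [_ <-].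
by move=> [y' /IH h s]; exact: chain_push h s.
Qed.

Lemma chain_inj t x y z : chain t x z -> chain t y z -> x = y.
Proof. by move=> /chain_inv h /chain_inv; exact: chain_fun. Qed.

Lemma chain_pos b y z :
  chain [seq (l, true) | l <- b] y z <-> [/\ X y, X z & z = wcat b y].
Proof.
elim: b z => [|l b IH] z /=.
  by split=> [[h <-]|[h _ ->]]; rewrite wcat0; split.
split=> [[y' /IH [? ? yE] [_ ? /= zE]]|[Xy Xz zE]].
  by split=> //; rewrite zE yE -wcat_cat.
have zE' : z = wcat [:: l] (wcat b y) by rewrite -wcat_cat.
have Xby : X (wcat b y) by apply: (tailX (w := [:: l])); rewrite -zE'.
by exists (wcat b y); [apply/IH | split].
Qed.

Lemma chain_form a b x z :
  chain ([seq (l, true) | l <- b] ++ rev [seq (l, false) | l <- a]) x z <->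
  exists y, [/\ X x, X z, x = wcat a y & z = wcat b y].
Proof.
have aE : rev [seq (l, false) | l <- a] =
    rev (map letter_inv [seq (l, true) | l <- a]) by rewrite -map_comp.
rewrite aE; split=> [/chain_cat [y /chain_invE/chain_pos [? ? ?]]|].
  by move=> /chain_pos [? ? ?]; exists y.
move=> [y [Xx Xz xE zE]]; apply/chain_cat; exists y.
  apply/chain_invE/chain_pos; split=> //.
  by apply: (tailX (w := a)); rewrite -xE.
by apply/chain_pos; split=> //; apply: (tailX (w := a)); rewrite -xE.
Qed.

(** In a reduced word that acts somewhere, no letter is put in front before
    another one is deleted: these two would have to be equal, and would cancel.
    So only the elements b a^-1, with a and b positive, have a nonempty domain. *)
Lemma reduced_chain_form t x z : reduced t -> chain t x z -> exists a b,
  t = [seq (l, true) | l <- b] ++ rev [seq (l, false) | l <- a].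
Proof.
elim: t z => [|[l s] t IH] z rt /=; first by exists [::], [::].
move=> [y hy sy]; have [a [b tE]] := IH _ (path_sorted rt) hy.
case: s rt sy => rt sy; first by exists a, (l :: b); rewrite tE.
case: b tE => [|k b] tE /=.
  by exists (rcons a l), [::]; rewrite tE /= map_rcons rev_rcons.
move: hy sy; rewrite tE /= => -[y' _ [_ _ /= ->]] [_ _ /= /wcat1_inj [kl _]].
by move: rt; rewrite tE /= kl /letter_inv /= eqxx.
Qed.

Definition theta t Y : set (nat -> A) := [set z | exists2 x, Y x & chain t x z].

Lemma theta_sub t Y : theta t Y `<=` X.
Proof. by move=> z [x _ /chain_X []]. Qed.

Lemma theta_nil Y : Y `<=` X -> theta [::] Y = Y.
Proof.
move=> YX; apply/seteqP; split=> [z [x Yx [_ <-]]//|z Yz].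
by exists z => //; split=> //; exact: YX.
Qed.

Lemma theta_cat t u Y : theta (t ++ u) Y = theta t (theta u Y).
Proof.
apply/seteqP; split=> [z [x Yx /chain_cat [y ? ?]]|z [y [x Yx ?] ?]].
  by exists y => //; exists x.
by exists x => //; apply/chain_cat; exists y.
Qed.

Lemma thetaI t Y Z : theta t (Y `&` Z) = theta t Y `&` theta t Z.
Proof.
apply/seteqP; split=> [z [x [Yx Zx] c]|z [[x Yx c] [x' Zx c']]].
  by split; exists x.
by exists x => //; split=> //; rewrite (chain_inj c c').
Qed.

Lemma thetaU t Y Z : theta t (Y `|` Z) = theta t Y `|` theta t Z.
Proof.
apply/seteqP; split=> [z [x [Yx|Zx] c]|z [[x Yx c]|[x Zx c]]].
- by left; exists x.
- by right; exists x.
- by exists x => //; left.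
- by exists x => //; right.
Qed.

Lemma thetaC t Y : theta t (X `\` Y) = theta t X `&` (X `\` theta t Y).
Proof.
apply/seteqP; split=> [z [x [Xx nYx] c]|z [[x Xx c] [_ nz]]].
  split; first by exists x.
  split; first by have [] := chain_X c.
  by move=> [x' Yx' c']; apply: nYx; rewrite (chain_inj c c').
by exists x => //; split=> // Yx; apply: nz; exists x.
Qed.

Lemma theta0 t : theta t set0 = set0.
Proof. by apply/seteqP; split=> // z []. Qed.

Lemma thetaS t Y Z : Y `<=` Z -> theta t Y `<=` theta t Z.
Proof. by move=> YZ z [x /YZ Zx c]; exists x. Qed.

Lemma theta_pos_Cset l a b :
  theta [:: (l, true)] (Cset X a b) = Cset X a (l :: b).
Proof.
apply/seteqP; split=> [z [x [y [-> Xb Xa]] /chain1 [_ Xz /= zE]]|].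
  by exists y; rewrite (wcat_cat [:: l] b) -zE.
move=> z [y [-> ]]; rewrite (wcat_cat [:: l] b) => Xz Xa.
have Xb := tailX Xz; exists (wcat b y); first by exists y.
by apply/chain1.
Qed.

Lemma theta_pos_Cset0 l a b : ~ language X (l :: b) ->
  theta [:: (l, true)] (Cset X a b) = set0.
Proof.
move=> nl; apply/seteqP; split=> // z [x [y [-> _ _]] /chain1 [_ Xz /= zE]].
by apply: nl; apply: (@language_wcat _ y); rewrite (wcat_cat [:: l] b) -zE.
Qed.

Lemma theta_neg_nil l a :
  theta [:: (l, false)] (Cset X a [::]) = Cset X (rcons a l) [::].
Proof.
apply/seteqP; split=> z.
  move=> [x [y [-> ]]]; rewrite !wcat0 => Xy Xa /chain1 [_ Xz /= yE].
  by exists z; rewrite wcat0 -cats1 wcat_cat -yE.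
move=> [y [->]]; rewrite wcat0 -cats1 wcat_cat => Xy Xa.
have Xl := tailX Xa.
exists (wcat [:: l] y); last by apply/chain1.
by exists (wcat [:: l] y); rewrite !wcat0.
Qed.

Lemma theta_neg_cons l a b :
  theta [:: (l, false)] (Cset X a (l :: b)) = Cset X a b `&` Cset X [:: l] [::].
Proof.
apply/seteqP; split=> z.
  move=> [x [y [-> ]]]; rewrite (wcat_cat [:: l] b) => Xy Xa.
  move=> /chain1 [_ Xz /= /wcat_inj zE]; rewrite -zE.
  split; first by exists y; rewrite zE.
  by exists z; rewrite wcat0; split=> //; rewrite -zE.
move=> [[y [-> Xb Xa]] [y' []]]; rewrite !wcat0 => yE Xy' Xl.
exists (wcat (l :: b) y); last first.
  by apply/chain1; split=> //=; rewrite (wcat_cat [:: l] b)// yE.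
by exists y; split=> //; rewrite (wcat_cat [:: l] b) yE.
Qed.

Lemma theta_neg_neq l k a b : l != k ->
  theta [:: (l, false)] (Cset X a (k :: b)) = set0.
Proof.
move=> lk; apply/seteqP; split=> // z [x [y [-> ]]].
rewrite (wcat_cat [:: k] b) => _ _ /chain1 [_ _ /= /wcat1_inj [kl _]].
by rewrite kl eqxx in lk.
Qed.

Lemma Cset_set0 a b : ~ (language X a /\ language X b) -> Cset X a b = set0.
Proof. by move=> n; apply/seteqP; split=> // y /Cset_language. Qed.

Lemma balg_Csetw a b : balg X (Cset X a b).
Proof.
have [[la lb]|n] := pselect (language X a /\ language X b).
  exact: balg_Cset.
by rewrite Cset_set0//; exact: balg0.
Qed.

(** The partial bijections of the letters are compatible with the Boolean
    operations, so it is enough to transport the generators C(a, b). *)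
Lemma theta1_balg m Y : balg X Y -> balg X (theta [:: m] Y).
Proof.
have BC a b : balg X (theta [:: m] (Cset X a b)).
  case: m => l []; last first.
    case: b => [|k b]; first by rewrite theta_neg_nil; exact: balg_Csetw.
    have [->|lk] := eqVneq l k; last by rewrite theta_neg_neq//; exact: balg0.
    by rewrite theta_neg_cons; apply: balgI; exact: balg_Csetw.
  have [ll|nl] := pselect (language X (l :: b)).
    by rewrite theta_pos_Cset//; exact: balg_Csetw.
  by rewrite theta_pos_Cset0//; exact: balg0.
have BX := BC [::] [::]; rewrite Cset_nil in BX.
move: Y; apply: balg_ind => //.
- by rewrite theta0; exact: balg0.
- by move=> Y Z _ _ h h'; rewrite thetaU; exact: balgU.
- by move=> Y Z _ _ h h'; rewrite thetaI; exact: balgI.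
- by move=> Y _ h; rewrite thetaC; apply: balgI => //; exact: balgC.
Qed.

Lemma theta_balg t Y : balg X Y -> balg X (theta t Y).
Proof.
move=> BY; elim: t => [|m t IH]; first by rewrite theta_nil//; exact: balg_sub.
by rewrite -cat1s theta_cat; exact: theta1_balg.
Qed.

End PartialAction.

(** * The Stone space *)

(** A compact set is near-covering; this is applied to the filter of the finite
    sequences of indices, ordered by inclusion. *)
Lemma compact_subcover (T : topologicalType) (I : eqType) (K : set T)
    (P : I -> Prop) (U : I -> set T) : compact K ->
  (forall x, K x -> exists2 i, P i & nbhs x (U i)) ->
  exists s : seq I, (forall i, i \in s -> P i) /\
    forall x, K x -> exists2 i, i \in s & U i x.
Proof.
move=> /compact_near_coveringP cK cov.
pose F : set_system (seq I) :=
  filter_from setT (fun s : seq I => [set s' : seq I | {subset s <= s'}]).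
have FF : Filter F.
  apply: filter_from_filter; first by exists [::].
  move=> s s' _ _; exists (s ++ s') => // u su.
  by split=> i hi; apply: su; rewrite mem_cat hi ?orbT.
have [|s _ /(_ s) h] := cK _ F (fun (s : seq I) x => exists i, [/\ P i, i \in s & U i x]) FF.
  move=> x Kx; have [i Pi Ui] := cov x Kx.
  exists (U i, [set s : seq I | i \in s]).
    split=> //; exists [:: i] => // s h; apply: h; exact: mem_head.
  by move=> [x' s] [/= Ux' si]; exists i.
exists [seq i <- s | `[< P i >]]; split.
  by move=> i; rewrite mem_filter => /andP[/asboolP].
move=> x Kx; have [//|i [Pi si Ux]] := h _ x Kx; exists i => //.
by rewrite mem_filter si andbT; apply/asboolP.
Qed.

Section Stone.
Context {A : pointedType} (X : set (nat -> A)).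
Implicit Types (x y z : nat -> A) (Y Z : set (nat -> A)).
Implicit Types (xi eta zeta : stone X).

Lemma stone_balg xi Y : sval xi Y -> balg X Y.
Proof. by have [[h _ _ _ _] _] := svalP xi; exact: h. Qed.
Lemma stone_X xi : sval xi X.
Proof. by have [[_ h _ _ _] _] := svalP xi. Qed.
Lemma stone_0 xi : ~ sval xi set0.
Proof. by have [[_ _ h _ _] _] := svalP xi. Qed.
Lemma stone_I xi Y Z : sval xi Y -> sval xi Z -> sval xi (Y `&` Z).
Proof. by have [[_ _ _ h _] _] := svalP xi; exact: h. Qed.
Lemma stone_up xi Y Z : sval xi Y -> balg X Z -> Y `<=` Z -> sval xi Z.
Proof. by have [[_ _ _ _ h] _] := svalP xi; exact: h. Qed.

Lemma stone_disjoint xi Y Z : sval xi Y -> sval xi Z -> Y `&` Z = set0 -> False.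
Proof. by move=> hY hZ YZ; apply: (@stone_0 xi); rewrite -YZ; exact: stone_I. Qed.

(** If neither Y nor its complement is in xi, then xi and Y generate a proper
    filter larger than xi. *)
Lemma stone_prime xi Y : balg X Y -> sval xi Y \/ sval xi (X `\` Y).
Proof.
move=> BY; have [|nC] := pselect (sval xi (X `\` Y)); first by right.
left; have [_ max] := svalP xi.
pose zeta : set (set (nat -> A)) :=
  [set Z | balg X Z /\ exists2 W, sval xi W & W `&` Y `<=` Z].
have pz : proper_filter X zeta.
  split.
  - by move=> Z [].
  - by split; [exact: balgX | exists X => [|z []//]; exact: stone_X].
  - move=> [_ [W xW WY]]; apply: nC; apply: (stone_up xW); first exact: balgC.
    move=> z Wz; split; first exact: (balg_sub (stone_balg xW)).
    by move=> Yz; have := WY z (conj Wz Yz).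
  - move=> U V [BU [W xW WU]] [BV [W' xW' WV]]; split; first exact: balgI.
    exists (W `&` W'); first exact: stone_I.
    by move=> z [[Wz W'z] Yz]; split; [apply: WU|apply: WV].
  - move=> U V [BU [W xW WU]] BV UV; split=> //; exists W => //.
    by move=> z /WU /UV.
have <- : zeta = sval xi.
  apply: max => // Z xZ; split; first exact: stone_balg xZ.
  by exists Z => // z [].
by split=> //; exists X => [|z []//]; exact: stone_X.
Qed.

Lemma prime_ultrafilter (xi : set (set (nat -> A))) : proper_filter X xi ->
  (forall Y, balg X Y -> xi Y \/ xi (X `\` Y)) -> ultrafilter X xi.
Proof.
move=> pxi prime; split=> // zeta [zB _ z0 zI _] sub; apply/seteqP; split=> // Y zY.
have [//|/sub zC] := prime _ (zB _ zY); exfalso; apply: z0.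
suff -> : set0 = Y `&` (X `\` Y) by exact: zI.
by apply/seteqP; split=> // z [Yz []].
Qed.

Lemma stone_C xi Y : balg X Y -> sval xi (X `\` Y) <-> ~ sval xi Y.
Proof.
move=> BY; split=> [hC hY|hY]; last by have [] := stone_prime xi BY.
by apply: (stone_disjoint hY hC); apply/seteqP; split=> // z [Yz []].
Qed.

Lemma stone_U xi Y Z : balg X Y -> balg X Z ->
  sval xi (Y `|` Z) <-> (sval xi Y \/ sval xi Z).
Proof.
move=> BY BZ; split=> [h|]; last first.
  case=> h; apply: (stone_up h); try exact: balgU.
    by move=> z; left.
  by move=> z; right.
have [|/(stone_I h) h'] := stone_prime xi BY; first by left.
by right; apply: (stone_up h') => // z [[Yz|//] [_ nYz]].
Qed.

Lemma stone_IE xi Y Z : balg X Y -> balg X Z ->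
  sval xi (Y `&` Z) <-> (sval xi Y /\ sval xi Z).
Proof.
move=> BY BZ; split=> [h|[]]; last exact: stone_I.
by split; apply: (stone_up h) => // z [].
Qed.

Lemma stone_eq xi eta : (forall Y, sval xi Y -> sval eta Y) -> xi = eta.
Proof.
move=> sub; have [_ max] := svalP xi; have [peta _] := svalP eta.
have := max _ peta sub; case: xi eta {sub max peta} => [u pu] [v pv] /= e.
by case: _ / e pu => pu; congr exist; exact: Prop_irrelevance.
Qed.

(** A nonempty member of the Boolean algebra belongs to some ultrafilter; the
    points of X provide enough of them. *)
Lemma principal_stone x : X x ->
  exists xi, forall Y, balg X Y -> (sval xi Y <-> Y x).
Proof.
move=> Xx; have ux : ultrafilter X [set Y | balg X Y /\ Y x].
  apply: prime_ultrafilter.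
    split.
    - by move=> Y [].
    - by split=> //; exact: balgX.
    - by case.
    - by move=> Y Z [BY Yx] [BZ Zx]; split; [exact: balgI|split].
    - by move=> Y Z [BY Yx] BZ YZ; split=> //; exact: YZ.
  move=> Y BY; have [Yx|nYx] := pselect (Y x); first by left.
  by right; split=> //; exact: balgC.
by exists (exist _ _ ux) => Y BY /=; split=> [[]|].
Qed.

Lemma nbhs_stoneP xi (U : set (stone X)) :
  nbhs xi U <-> exists Y, sval xi Y /\ stone_open X Y `<=` U.
Proof.
split.
  rewrite nbhsE => -[B [[D' sD' <-] [Y D'Y xiY]] BU].
  by exists Y; split=> // eta eY; apply: BU; exists Y.
move=> [Y [xY YU]]; rewrite nbhsE; exists (stone_open X Y) => //; split=> //.
exists [set Y]; first by move=> _ ->; exact: stone_balg xY.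
by rewrite bigcup_set1.
Qed.

(** An ultrafilter F on the Stone space converges to the ultrafilter of those Y
    whose open set is in F. *)
Lemma stone_compact : compact [set: stone X].
Proof.
rewrite compact_ultra => F UF _.
have uF : ultrafilter X [set Y | balg X Y /\ F (stone_open X Y)].
  apply: prime_ultrafilter.
    split.
    - by move=> Y [].
    - split; first exact: balgX.
      suff -> : stone_open X X = setT by exact: filterT.
      by apply/seteqP; split=> // xi _; exact: stone_X.
    - by case=> _ /filter_ex [xi /stone_0].
    - move=> Y Z [BY FY] [BZ FZ]; split; first exact: balgI.
      by apply: filterS (filterI FY FZ) => xi [? ?]; exact: stone_I.
    - move=> Y Z [BY FY] BZ YZ; split=> //.
      by apply: filterS FY => xi h; exact: stone_up YZ.
  move=> Y BY; have [FY|FC] := in_ultra_setVsetC (stone_open X Y) UF.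
    by left.
  right; split; first exact: balgC.
  by apply: filterS FC => xi h; apply/stone_C.
exists (exist _ _ uF); split=> // U /nbhs_stoneP [Y [[BY FY] YU]].
exact: filterS FY.
Qed.

Lemma stone_cover_finite (P : set (nat -> A) -> Prop) :
  (forall xi, exists2 Y, P Y & sval xi Y) ->
  exists s : seq (set (nat -> A)),
    (forall Y, Y \in s -> P Y) /\ forall xi, exists2 Y, Y \in s & sval xi Y.
Proof.
move=> cov; have [|s [sP scov]] := compact_subcover (P := P)
  (U := stone_open X) stone_compact.
  move=> xi _; have [Y PY xY] := cov xi; exists Y => //.
  by apply/nbhs_stoneP; exists Y; split=> // zeta.
by exists s; split=> // xi; exact: scov.
Qed.

Hypothesis tailX : forall w x, X (wcat w x) -> X x.
Implicit Types (t s : seq (A * bool)).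
Local Notation theta := (theta X).

(** The transport of the sets of eta into xi.  Both ultrafilters being maximal,
    one inclusion determines each of them from the other. *)
Definition is_arrow xi t eta := forall Z, sval eta Z -> sval xi (theta t Z).

Lemma arr_E xi t eta Z : is_arrow xi t eta -> balg X Z ->
  sval xi (theta t Z) -> sval eta Z.
Proof.
move=> h BZ xZ; have [//|/h h'] := stone_prime eta BZ; exfalso.
apply: (stone_disjoint xZ h'); rewrite -thetaI.
suff -> : Z `&` (X `\` Z) = set0 by exact: theta0.
by apply/seteqP; split=> // z [? []].
Qed.

Lemma arr_dom xi t eta : is_arrow xi t eta -> sval xi (theta t X).
Proof. by apply; exact: stone_X. Qed.

(** The source is the inverse image of xi under the partial bijection of t; it is
    an ultrafilter as soon as the range of t belongs to xi. *)
Lemma arr_source_ex xi t : sval xi (theta t X) -> exists eta, is_arrow xi t eta.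
Proof.
move=> xt; have u : ultrafilter X [set Y | balg X Y /\ sval xi (theta t Y)].
  apply: prime_ultrafilter.
    split.
    - by move=> Y [].
    - by split=> //; exact: balgX.
    - by case=> _; rewrite theta0 => /stone_0.
    - move=> Y Z [BY FY] [BZ FZ]; split; first exact: balgI.
      by rewrite thetaI; exact: stone_I.
    - move=> Y Z [BY FY] BZ YZ; split=> //.
      by apply: (stone_up FY); [exact: theta_balg|exact: thetaS].
  move=> Y BY; have [FY|FC] := stone_prime xi (theta_balg tailX t BY).
    by left.
  right; split; first exact: balgC.
  by rewrite thetaC; exact: stone_I.
by exists (exist _ _ u) => Z [].
Qed.

Lemma arr_source_uniq xi t eta eta' : is_arrow xi t eta -> is_arrow xi t eta' -> eta = eta'.
Proof.
move=> h h'; apply: stone_eq => Y eY; apply: (arr_E h'); last exact: h.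
exact: stone_balg eY.
Qed.

Lemma arr_mul xi s eta t zeta : is_arrow xi s eta -> is_arrow eta t zeta ->
  is_arrow xi (foldr push t s) zeta.
Proof.
move=> h h' Z zZ; apply: (stone_up (h _ (h' _ zZ))).
  by apply: theta_balg => //; exact: stone_balg zZ.
by move=> z [y [x Zx c] c']; exists x => //; exact: chain_mul c c'.
Qed.

Local Notation inv t := (rev (map letter_inv t)).

Lemma arr_inv xi t eta : is_arrow xi t eta -> is_arrow eta (inv t) xi.
Proof.
move=> h Z xZ; have BZ := stone_balg xZ.
have BtZ : balg X (theta (inv t) Z) by exact: theta_balg.
have [//|/h h'] := stone_prime eta BtZ; exfalso.
apply: (stone_disjoint xZ h'); apply/seteqP; split=> // z [Zz [x [_ nx] c]].
by apply: nx; exists z => //; exact: chain_inv.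
Qed.

Lemma arr_nil xi eta : is_arrow xi [::] eta <-> xi = eta.
Proof.
split=> [h|-> Z eZ]; last by rewrite theta_nil//; apply: balg_sub; exact: stone_balg eZ.
apply/esym/stone_eq => Z eZ; have := h Z eZ.
by rewrite theta_nil//; apply: balg_sub; exact: stone_balg eZ.
Qed.

(** This identifies V_t with the clopen set of [theta t X]. *)
Lemma theta_form (t : free_group A) a b : is_reduced_form t b a ->
  theta t X = Cset X a b.
Proof.
rewrite /is_reduced_form => tE; apply/seteqP; split=> z.
  move=> [x _]; rewrite tE => /(chain_form tailX) [y [Xx Xz xE zE]].
  by exists y; split=> //; rewrite -?zE -?xE.
move=> [y [-> Xb Xa]]; exists (wcat a y) => //.
by rewrite tE; apply/(chain_form tailX); exists y.
Qed.

Lemma stone_act_domE (t : free_group A) xi :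
  stone_act_dom X t xi <-> sval xi (theta t X).
Proof.
split=> [[a [b [_ _ f]]]|h]; first by rewrite (theta_form f).
have [[z hz]|none] := pselect (theta t X !=set0); last first.
  by case: (@stone_0 xi); have <- : theta t X = set0;
    [apply/seteqP; split=> // z hz; apply: none; exists z|].
have [x _ c] := hz; have [a [b tE]] := reduced_chain_form (free_reduced t) c.
have f : is_reduced_form t b a by [].
have := hz; rewrite (theta_form f) => /(Cset_language tailX) [la lb].
by exists a, b; split=> //; rewrite /stone_open /= -(theta_form f).
Qed.

Lemma stone_actE (t : free_group A) eta : sval eta (theta (t^-1)%g X) ->
  stone_act t eta = [set Y | balg X Y /\ sval eta (theta (t^-1)%g Y)].
Proof.
move=> et; apply/seteqP; split=> Y [BY h]; split=> //.
  move: h => [a [b [_ _ f [Z eZ ZY]]]].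
  have BtY : balg X (theta (t^-1)%g Y) by exact: theta_balg.
  apply: (stone_up (stone_I eZ et)) => // z [Zz [y Xy c]].
  have [_ Xz] := chain_X c.
  have c' : chain X t z y by apply/chain_invE.
  rewrite f in c'; have {c'} [x [_ _ zE yE]] := (chain_form tailX _ _ _ _).1 c'.
  exists y; last exact: c.
  rewrite yE; suff /ZY [_] : rel_range X Z b x by [].
  split; last by rewrite -zE.
  by apply: (tailX (w := b)); rewrite -zE.
have [[z hz]|none] := pselect (theta (t^-1)%g Y !=set0); last first.
  by case: (@stone_0 eta); have <- : theta (t^-1)%g Y = set0;
    [apply/seteqP; split=> // z hz; apply: none; exists z|].
have [y Yy /= /chain_invE c] := hz.
have [b [a tE]] := reduced_chain_form (free_reduced t) c.
have := c; rewrite tE => /(chain_form tailX) [x [Xz Xy zE yE]].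
exists a, b; split=> //.
- by apply: (language_wcat tailX (x := x)); rewrite -yE.
- by apply: (language_wcat tailX (x := x)); rewrite -zE.
exists (theta (t^-1)%g Y) => // w [Xw [y' Yy' /= /chain_invE]].
rewrite tE => /(chain_form tailX) [x' [_ _ /wcat_inj -> y'E]].
rewrite y'E in Yy'; split=> //; apply: (tailX (w := a)).
exact: balg_sub Yy'.
Qed.

(** The defining conditions, on the domain of t^-1 and on the family of sets
    phi_t(eta), amount to transporting the sets of eta into xi. *)
Lemma arrowsE xi (t : free_group A) eta :
  arrows (transformation_groupoid X) (xi, t, eta) <-> is_arrow xi t eta.
Proof.
rewrite /arrows /=; split.
  move=> [/stone_act_domE et]; rewrite stone_actE// => xiE Z eZ.
  have BZ := stone_balg eZ; rewrite xiE; split; first exact: theta_balg.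
  apply: (stone_up (stone_I eZ et)); first by do 2 apply: theta_balg => //.
  move=> z [Zz [y _ c]]; exists y => //; exists z => //.
  by apply/chain_invE.
move=> h; have et : sval eta (theta (t^-1)%g X) by have := arr_dom (arr_inv h).
split; first exact/stone_act_domE.
rewrite stone_actE//; apply/seteqP; split=> [Y xY|Y [BY eY]].
  by split; [exact: stone_balg xY | exact: (arr_inv h)].
apply: (stone_up (h _ eY)) => // z [y [x Yx /= /chain_invE c] c'].
by rewrite (chain_fun c' c).
Qed.

End Stone.

(** * Continuous functions on the groupoid *)

Section Slices.
Context {R : realType} {A : pointedType} (X : set (nat -> A)).
Hypothesis tailX : forall w x, X (wcat w x) -> X x.
Local Notation C := R[i].
Local Notation G := (transformation_groupoid X).
Local Notation T := (stone X * free_group A * stone X)%type.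
Local Notation theta := (theta X).
Implicit Types (xi eta zeta : stone X) (t s r : free_group A).
Implicit Types (h k : stone X -> C) (f g : T -> C) (K : stone X -> stone X -> C).

(** Continuity on the Stone space, in terms of its base. *)
Definition scont h := forall xi (e : C), 0 < e ->
  exists Y, sval xi Y /\ forall xi', sval xi' Y -> `|h xi - h xi'| < e.

(** A function on the arrows labelled by t, read as a function of their range,
    which determines them; it is extended by 0 outside of V_t. *)
Definition pull t (k : stone X -> stone X -> C) : stone X -> C := fun xi =>
  if pselect (exists eta, is_arrow xi t eta) is left e then k xi (sval (cid e)) else 0.

Lemma pullE t K xi eta : is_arrow xi t eta -> pull t K xi = K xi eta.
Proof.
move=> a; rewrite /pull; case: pselect => [e|[]]; last by exists eta.
by rewrite (arr_source_uniq (svalP (cid e)) a).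
Qed.

Lemma pull0 t K xi : ~ sval xi (theta t X) -> pull t K xi = 0.
Proof.
move=> n; rewrite /pull; case: pselect => // -[eta a]; exfalso; apply: n.
exact: arr_dom a.
Qed.

Lemma pull_dom t K xi : (~ sval xi (theta t X) /\ pull t K xi = 0) \/
  exists2 eta, is_arrow xi t eta & pull t K xi = K xi eta.
Proof.
have [h|n] := pselect (sval xi (theta t X)).
  by right; have [eta a] := arr_source_ex tailX h; exists eta => //; exact: pullE.
by left; split=> //; exact: pull0.
Qed.

(** V_t is clopen, so the extension by 0 is continuous. *)
Lemma scont_pull t K :
  (forall xi eta, is_arrow xi t eta -> forall e : C, 0 < e ->
     exists Y, sval xi Y /\ forall xi' eta', is_arrow xi' t eta' -> sval xi' Y ->
       `|K xi eta - K xi' eta'| < e) ->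
  scont (pull t K).
Proof.
move=> hk xi e e0; have [h|n] := pselect (sval xi (theta t X)).
  have [eta a] := arr_source_ex tailX h; have [Y [xY hY]] := hk _ _ a _ e0.
  exists (Y `&` theta t X); split; first exact: stone_I.
  move=> xi' /(stone_IE _ (stone_balg xY) (stone_balg h)) [xY' h'].
  have [eta' a'] := arr_source_ex tailX h'.
  by rewrite (pullE _ a) (pullE _ a'); exact: hY.
have BX : balg X (theta t X) by apply: theta_balg => //; exact: balgX.
exists (X `\` theta t X); split; first exact/stone_C.
by move=> xi' /stone_C - /(_ BX) n'; rewrite !pull0// subrr normr0.
Qed.

(** The function k o phi_t^-1, extended by 0 outside of V_t. *)
Definition transport t k : stone X -> C := pull t (fun _ eta => k eta).

Lemma scont_transport t k : scont k -> scont (transport t k).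
Proof.
move=> ck; apply: scont_pull => xi eta a e e0; have [Y [eY hY]] := ck eta e e0.
exists (theta t Y); split; first exact: a.
by move=> xi' eta' a' xY'; apply: hY; apply: (arr_E a') xY'; exact: stone_balg eY.
Qed.

(** The element h delta_t of the partial crossed product. *)
Definition slice t h : T -> C := fun z =>
  if `[< arrows G z /\ z.1.2 = t >] then h z.1.1 else 0.

Definition coef f t : stone X -> C := pull t (fun xi eta => f (xi, t, eta)).

Lemma slice_arr t h xi eta : is_arrow xi t eta -> slice t h (xi, t, eta) = h xi.
Proof.
by move=> a; rewrite /slice; case: asboolP => // -[]; split=> //; apply/arrowsE.
Qed.

Lemma slice0 t h (z : T) : ~ (arrows G z /\ z.1.2 = t) -> slice t h z = 0.
Proof. by move=> n; rewrite /slice; case: asboolP. Qed.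

Lemma eq_slice t h k : (forall xi, sval xi (theta t X) -> h xi = k xi) ->
  slice t h = slice t k.
Proof.
move=> hk; apply/funext => -[[xi s] eta]; rewrite /slice; case: asboolP => //=.
by move=> [/arrowsE a /= st]; apply: hk; rewrite -st; apply: arr_dom (a _).
Qed.

Lemma coef_slice t s h xi : coef (slice t h) s xi =
  if s == t then (if `[< sval xi (theta t X) >] then h xi else 0) else 0.
Proof.
rewrite /coef; have [[n ->]|[eta a ->]] := pull_dom s (fun xi eta => slice t h (xi, s, eta)) xi.
  by case: eqP => // <-; case: asboolP.
case: eqP => [st|st]; last by rewrite slice0//= => -[_].
rewrite -st; case: asboolP => [_|[]]; last exact: arr_dom a.
exact: slice_arr.
Qed.

Lemma nbhs_T xi t eta (U : set T) :
  nbhs ((xi, t, eta) : T) U <-> exists Y Z, [/\ sval xi Y, sval eta Z &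
    forall xi' eta', sval xi' Y -> sval eta' Z -> U (xi', t, eta')].
Proof.
split.
  move=> [[U1 U2] [/= [[V1 V2] [/= hV1 hV2] V12] hU2] U12].
  have [Y [xY YV]] := (nbhs_stoneP _ _).1 hV1.
  have [Z [eZ ZU]] := (nbhs_stoneP _ _).1 hU2.
  exists Y, Z; split=> // xi' eta' xY' eZ'; apply: (U12 (xi', t, eta')).
  split=> /=; last exact: ZU.
  apply: (V12 (xi', t)); split=> /=; first exact: YV.
  exact: nbhs_singleton hV2.
move=> [Y [Z [xY eZ h]]].
exists ([set p : stone X * free_group A | sval p.1 Y /\ p.2 = t], stone_open X Z).
  split=> /=; last by apply/nbhs_stoneP; exists Z; split=> // ?.
  exists (stone_open X Y, [set t]) => /=.
    by split; [apply/nbhs_stoneP; exists Y; split=> // ?|exact: discrete_set1].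
  by move=> [xi' t'] [].
by move=> [[xi' t'] eta'] /= [[xY' /= ->] eZ']; exact: h.
Qed.

Lemma within_continuousP f :
  {within arrows G, continuous (f : T -> C^o)} <-> forall t, scont (coef f t).
Proof.
rewrite (subspace_continuousP (arrows G)); split.
  move=> hf t; apply: scont_pull => xi eta a e e0.
  have aG : arrows G (xi, t, eta) by apply/arrowsE.
  have := hf _ aG; move=> /cvgrPdist_lt /(_ e e0) /nbhs_T [Y [Z [xY eZ h]]].
  (* A source eta' of an arrow with range in theta t Z lies in Z. *)
  exists (Y `&` theta t Z); split; first by apply: stone_I => //; exact: a.
  have Btz := stone_balg (a _ eZ).
  move=> xi' eta' a' /(stone_IE _ (stone_balg xY) Btz) [xY' xtZ].
  apply: h => //; last exact/arrowsE.
  by apply: (arr_E a') xtZ; exact: stone_balg eZ.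
move=> hf [[xi t] eta] aG; apply/cvgrPdist_lt => e e0; apply/nbhs_T.
have a := (arrowsE tailX _ _ _).1 aG.
have [Y [xY hY]] := hf t xi e e0; exists Y, X; split=> //; first exact: stone_X.
move=> xi' eta' xY' _ /(arrowsE tailX) a'.
by have := hY xi' xY'; rewrite /coef (pullE _ a) (pullE _ a').
Qed.

Lemma arrows_closed : closed (arrows G : set T).
Proof.
rewrite -[arrows G]setCK; apply: open_closedC; rewrite openE => -[[xi t] eta] na.
have [Z [eZ nZ]] : exists Z, sval eta Z /\ ~ sval xi (theta t Z).
  apply: contrapT => h; apply: na; apply/arrowsE => // Z eZ.
  by apply: contrapT => nZ; apply: h; exists Z.
have BZ := stone_balg eZ.
have BtZ : balg X (theta t Z) by exact: theta_balg.
apply/nbhs_T; exists (X `\` theta t Z), Z; split=> //; first exact/stone_C.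
move=> xi' eta' xC eZ' /(arrowsE tailX) a'.
by move/(stone_C _ BtZ): xC; apply; exact: a'.
Qed.

Lemma stripe_compact (L : seq (free_group A)) : compact [set z : T | z.1.2 \in L].
Proof.
have -> : [set z : T | z.1.2 \in L] = (setT `*` [set` L]) `*` setT.
  by apply/seteqP; split=> -[[xi t] eta] //= [[]].
apply: compact_setX; last exact: stone_compact.
apply: compact_setX; first exact: stone_compact.
exact/finite_compact/finite_seq.
Qed.

Lemma stripe_closed (L : seq (free_group A)) : closed [set z : T | z.1.2 \in L].
Proof.
rewrite -[X in closed X]setCK; apply: open_closedC; rewrite openE.
move=> [[xi t] eta] n; apply/nbhs_T; exists X, X; split; try exact: stone_X.
by move=> xi' eta' _ _.
Qed.

(** For a continuous function supported in the groupoid, the support is compact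
    iff it meets finitely many labels: the groupoid is closed in the ambient
    space, and the elements of the ambient space with finitely many labels form
    a compact set. *)
Lemma CcP f : @Cc R G f <-> [/\ forall z, f z != 0 -> arrows G z,
  exists L : seq (free_group A), forall z, f z != 0 -> z.1.2 \in L &
  forall t, scont (coef f t)].
Proof.
split=> [[cf sf kf]|[sf [L hL] cf]].
  split; [exact: sf | | exact/within_continuousP].
  have [|L [_ hL]] := @compact_subcover T (free_group A) _ (fun=> True)
    (fun t => [set z : T | z.1.2 = t]) kf.
    move=> [[xi t] eta] _; exists t => //; apply/nbhs_T; exists X, X.
    by split; try exact: stone_X.
  exists L => z fz; have [|t tL /= ->//] := hL z; split; first exact: sf.
  exact: subset_closure.
split=> //; first exact/within_continuousP.
have -> : arrows G `&` closure [set z : T | f z != 0] =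
    [set z : T | z.1.2 \in L] `&` (arrows G `&` closure [set z : T | f z != 0]).
  apply/seteqP; split=> z; last by case.
  move=> [az cz]; split=> //.
  by apply: (@stripe_closed L); move: cz; apply: closureS; exact: hL.
apply: compact_closedI; first exact: stripe_compact.
by apply: closedI; [exact: arrows_closed | exact: closed_closure].
Qed.

Lemma coefD f g t : coef (f + g) t = coef f t + coef g t.
Proof.
apply/funext => xi; change (coef (f + g) t xi = coef f t xi + coef g t xi).
by rewrite /coef /pull; case: pselect => [e|_] //; rewrite addr0.
Qed.

Lemma coefZ (c : C) f t : coef (fun z => c * f z) t = fun xi => c * coef f t xi.
Proof.
by apply/funext => xi; rewrite /coef /pull; case: pselect => [e|_] //; rewrite mulr0.
Qed.

Lemma coef_arr f xi t eta : is_arrow xi t eta -> coef f t xi = f (xi, t, eta).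
Proof. exact: pullE. Qed.

Lemma scont_cst (c : C) : scont (fun=> c).
Proof.
by move=> xi e e0; exists X; split=> [|xi' _]; rewrite ?subrr ?normr0//; exact: stone_X.
Qed.

Lemma scontD h k : scont h -> scont k -> scont (h + k).
Proof.
move=> ch ck xi e e0; have e2 : 0 < e / 2 by rewrite divr_gt0 ?ltr0n.
have [Y [xY hY]] := ch xi _ e2; have [Z [xZ hZ]] := ck xi _ e2.
exists (Y `&` Z); split; first exact: stone_I.
move=> xi' /(stone_IE _ (stone_balg xY) (stone_balg xZ)) [xY' xZ'].
rewrite !fctE opprD addrACA (splitr e).
by apply: le_lt_trans (ler_normD _ _) _; rewrite ltrD ?hY ?hZ.
Qed.

Lemma scontZ (c : C) h : scont h -> scont (fun xi => c * h xi).
Proof.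
move=> ch xi e e0; have c1 : 0 < `|c| + 1 by rewrite ltr_wpDl.
have e2 : 0 < e / (`|c| + 1) by rewrite divr_gt0.
have [Y [xY hY]] := ch xi _ e2; exists Y; split=> // xi' xY'.
rewrite -mulrBr normrM.
apply: (@le_lt_trans _ _ (`|h xi - h xi'| * (`|c| + 1))).
  by rewrite mulrC ler_wpM2l// lerDl.
by rewrite -ltr_pdivlMr// hY.
Qed.

Lemma scont_bounded h : scont h -> exists2 M : C, 0 <= M & forall xi, `|h xi| <= M.
Proof.
move=> ch.
have [|s [sP scov]] := stone_cover_finite (X := X)
  (P := fun Y => exists M : C, 0 <= M /\ forall xi, sval xi Y -> `|h xi| <= M).
  move=> xi; have [Y [xY hY]] := ch xi 1 ltr01; exists Y => //.
  exists (`|h xi| + 1); split; first by rewrite addr_ge0.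
  move=> xi' /hY; rewrite distrC => /ltW le.
  by rewrite -[h xi'](subrK (h xi)) addrC (le_trans (ler_normD _ _))// lerD2l.
have : exists2 M : C, 0 <= M & forall xi Y, Y \in s -> sval xi Y -> `|h xi| <= M.
  elim: s sP {scov} => [|Y s IH] sP; first by exists 0.
  have [|M M0 hM] := IH; first by move=> Z Zs; apply: sP; rewrite inE Zs orbT.
  have [N [N0 hN]] := sP Y (mem_head _ _).
  exists (N + M); first by rewrite addr_ge0.
  move=> xi Z; rewrite inE => /predU1P[->|Zs] xZ.
    by apply: le_trans (hN _ xZ) _; rewrite lerDl.
  by apply: le_trans (hM _ _ Zs xZ) _; rewrite lerDr.
move=> [M M0 hM]; exists M => // xi; have [Y Ys xY] := scov xi.
exact: hM xY.
Qed.

Lemma scontM h k : scont h -> scont k -> scont (fun xi => h xi * k xi).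
Proof.
move=> ch ck xi e e0.
have [M M0 hM] := scont_bounded ch; have [N N0 hN] := scont_bounded ck.
have s0 : 0 < M + N + 1 by rewrite ltr_wpDl// addr_ge0.
have e2 : 0 < e / (M + N + 1) by rewrite divr_gt0.
have [Y [xY hY]] := ch xi _ e2; have [Z [xZ hZ]] := ck xi _ e2.
exists (Y `&` Z); split; first exact: stone_I.
move=> xi' /(stone_IE _ (stone_balg xY) (stone_balg xZ)) [xY' xZ'].
have -> : h xi * k xi - h xi' * k xi' =
    h xi * (k xi - k xi') + (h xi - h xi') * k xi'.
  by rewrite mulrBr mulrBl addrA subrK.
apply: le_lt_trans (ler_normD _ _) _; rewrite !normrM.
apply: (@le_lt_trans _ _ ((M + N) * (e / (M + N + 1)))); last first.
  by rewrite mulrCA gtr_pMr// ltr_pdivrMr// mul1r ltrDl.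
rewrite mulrDl lerD//; first by rewrite ler_pM// ltW// hZ.
by rewrite mulrC ler_pM// ltW// hY.
Qed.

Lemma scont_conj h : scont h -> scont (fun xi => (h xi)^*).
Proof.
move=> ch xi e e0; have [Y [xY hY]] := ch xi e e0; exists Y; split=> // xi' xY'.
by rewrite -rmorphB norm_conjC hY.
Qed.

Definition indic (Y : set (nat -> A)) : stone X -> C := fun xi =>
  if `[< sval xi Y >] then 1 else 0.

Lemma scont_indic Y : balg X Y -> scont (indic Y).
Proof.
move=> BY xi e e0; have [xY|xC] := stone_prime xi BY.
  exists Y; split=> // xi' xY'; rewrite /indic.
  by do 2 (case: asboolP => //); rewrite subrr normr0.
exists (X `\` Y); split=> // xi' /(stone_C _ BY) nY'.
move/(stone_C _ BY): xC => nY; rewrite /indic.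
by do 2 (case: asboolP => // _); rewrite subrr normr0.
Qed.

Lemma Cc_slice t h : scont h -> @Cc R G (slice t h).
Proof.
move=> ch; apply/CcP; split.
- by move=> z; rewrite /slice; case: asboolP => [[]|_ /eqP].
- exists [:: t] => z; rewrite /slice; case: asboolP => [[_ <-] _|_ /eqP //].
  exact: mem_head.
- move=> s; have -> : coef (slice t h) s = if s == t then
      (fun xi => h xi * indic (theta t X) xi) else fun=> 0.
    apply/funext => xi; rewrite coef_slice /indic; case: eqP => // _.
    by case: asboolP => _; rewrite ?mulr1 ?mulr0.
  case: eqP => _; last exact: scont_cst.
  apply: scontM => //; apply: scont_indic; apply: theta_balg => //; exact: balgX.
Qed.

Lemma Cc0 : @Cc R G 0.
Proof.
apply/CcP; split=> [z|/=|t]; first by rewrite eqxx.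
  by exists [::] => z; rewrite eqxx.
have -> : coef 0 t = fun=> 0; last exact: scont_cst.
by apply/funext => xi; rewrite /coef /pull; case: pselect.
Qed.

Lemma CcD f g : @Cc R G f -> @Cc R G g -> @Cc R G (f + g).
Proof.
have nz (z : T) : (f + g) z != 0 -> f z != 0 \/ g z != 0.
  rewrite fctE; have [->|] := eqVneq (f z) 0; last by left.
  by rewrite add0r; right.
move=> /CcP [sf [L hL] cf] /CcP [sg [L' hL'] cg]; apply/CcP; split.
- by move=> z /nz [/sf|/sg].
- exists (L ++ L') => z; rewrite mem_cat => /nz [/hL ->//|/hL' ->].
  by rewrite orbT.
- by move=> t; rewrite coefD; exact: scontD.
Qed.

Lemma CcZ (c : C) f : @Cc R G f -> @Cc R G (fun z => c * f z).
Proof.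
move=> /CcP [sf [L hL] cf]; apply/CcP; split.
- by move=> z; rewrite mulf_eq0 negb_or => /andP[_ /sf].
- by exists L => z; rewrite mulf_eq0 negb_or => /andP[_ /hL].
- by move=> t; rewrite coefZ; exact: scontZ.
Qed.

Lemma Cc_decomp f (L : seq (free_group A)) : @Cc R G f -> uniq L ->
  (forall z, f z != 0 -> z.1.2 \in L) -> f = \sum_(t <- L) slice t (coef f t).
Proof.
move=> /CcP [sf _ _] uL hL; apply/funext => -[[xi t] eta].
rewrite fct_sumE.
have [az|naz] := pselect (arrows G (xi, t, eta)); last first.
  rewrite big1 => [|s _]; last by rewrite slice0// => -[].
  by apply/eqP; apply: contrapT => /negP /sf.
have a := (arrowsE tailX _ _ _).1 az.
have [tL|ntL] := boolP (t \in L).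
  rewrite (bigD1_seq t)//= slice_arr// (coef_arr _ a) big1 ?addr0// => s st.
  by rewrite slice0//= => -[_ ts]; rewrite ts eqxx in st.
rewrite big1_seq => [|s /= sL]; last first.
  by rewrite slice0//= => -[_ ts]; rewrite ts sL in ntL.
by apply/eqP; apply: contrapT => /negP /hL /=; apply/negP.
Qed.

(** A function in C_c(G) is the sum of the slices of its coefficients. *)
Lemma Cc_ind (P : (T -> C) -> Prop) : P 0 ->
  (forall f g, @Cc R G f -> @Cc R G g -> P f -> P g -> P (f + g)) ->
  (forall t h, scont h -> P (slice t h)) -> forall f, @Cc R G f -> P f.
Proof.
move=> P0 PD Ps f Cf; have [_ [L hL] cf] := (CcP f).1 Cf.
rewrite (Cc_decomp Cf (undup_uniq L)) => [|z /hL]; last by rewrite mem_undup.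
suff [] : @Cc R G (\sum_(t <- undup L) slice t (coef f t)) /\
  P (\sum_(t <- undup L) slice t (coef f t)) by [].
elim: (undup L) => [|t s [IHC IHP]]; first by rewrite big_nil; split => //; exact: Cc0.
rewrite big_cons; have Ct : @Cc R G (slice t (coef f t)) by exact: Cc_slice.
by split; [exact: CcD|apply: PD => //; exact: Ps].
Qed.

End Slices.

(** * The convolution algebra *)

Section Convolution.
Context {R : realType} {A : pointedType} (X : set (nat -> A)).
Hypothesis tailX : forall w x, X (wcat w x) -> X x.
Local Notation C := R[i].
Local Notation G := (transformation_groupoid X).
Local Notation T := (stone X * free_group A * stone X)%type.
Local Notation theta := (theta X).
Implicit Types (xi eta zeta : stone X) (t s r : free_group A).
Implicit Types (h k : stone X -> C) (f g : T -> C) (z : T).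

Definition factorizations z : set (T * T) := [set xy | [/\ arrows G xy.1,
  arrows G xy.2, xy.1.2 = xy.2.1.1 &
  (xy.1.1.1, (xy.1.1.2 * xy.2.1.2)%g, xy.2.2) = z]].

Lemma convolutionE f g z :
  @convolution R G f g z = \sum_(xy \in factorizations z) f xy.1 * g xy.2.
Proof. by []. Qed.

Lemma factorizationsP xi r zeta xy : factorizations (xi, r, zeta) xy ->
  exists eta s t, [/\ xy = ((xi, s, eta), (eta, t, zeta)), r = (s * t)%g,
    is_arrow xi s eta & is_arrow eta t zeta].
Proof.
case: xy => [[[x1 s] x2] [[y1 t] y2]] [/= /(arrowsE tailX) ax /(arrowsE tailX) ay].
by move=> /= xy [<- <- <-]; exists y1, s, t; rewrite -xy; split=> //; rewrite xy.
Qed.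

Lemma mem_factorizations xi s eta t zeta : is_arrow xi s eta -> is_arrow eta t zeta ->
  factorizations (xi, (s * t)%g, zeta) ((xi, s, eta), (eta, t, zeta)).
Proof. by move=> h h'; split=> //; apply/arrowsE. Qed.

(** A factorization (x, y) of z is determined by the label of x.  So convolution
    sums over finitely many terms, which makes it bilinear. *)
Lemma finite_factorizations z (L : seq (free_group A)) :
  finite_set (factorizations z `&` [set xy | xy.1.1.2 \in L]).
Proof.
case: z => [[xi r] zeta].
(* The value zeta is a default, for the labels that occur in no factorization. *)
pose src s := if pselect (exists eta, is_arrow xi s eta) is left e then sval (cid e) else zeta.
apply: (@sub_finite_set _ _ ((fun s =>
  ((xi, s, src s), (src s, (s^-1 * r)%g, zeta))) @` [set` L])); last first.
  exact/finite_image/finite_seq.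
move=> xy [/factorizationsP [eta [s [t [-> -> h h']]]] /= sL].
exists s => //; rewrite mulKg.
suff -> : src s = eta by [].
rewrite /src; case: pselect => [e|[]]; last by exists eta.
exact: arr_source_uniq (svalP (cid e)) h.
Qed.

Lemma convolution_restrict f g z (L : seq (free_group A)) :
  (forall z, f z != 0 -> z.1.2 \in L) ->
  @convolution R G f g z =
  \sum_(xy \in factorizations z `&` [set xy | xy.1.1.2 \in L]) f xy.1 * g xy.2.
Proof.
move=> hL; rewrite convolutionE; apply/esym/fsbig_widen; first by move=> xy [].
move=> xy [h1 h2] /=; have [->|/hL fL] := eqVneq (f xy.1) 0.
  by rewrite mul0r.
by exfalso; apply: h2.
Qed.

Lemma Cc_labels f : @Cc R G f ->
  exists L : seq (free_group A), forall z, f z != 0 -> z.1.2 \in L.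
Proof. by move=> /(CcP tailX) []. Qed.

Let addE f g z : (f + g) z = f z + g z. Proof. by []. Qed.

Lemma convolutionDl f1 f2 g : @Cc R G f1 -> @Cc R G f2 ->
  @convolution R G (f1 + f2) g = @convolution R G f1 g + @convolution R G f2 g.
Proof.
move=> /Cc_labels [L1 h1] /Cc_labels [L2 h2]; apply/funext => z.
have h1' z' : f1 z' != 0 -> z'.1.2 \in L1 ++ L2 by rewrite mem_cat => /h1 ->.
have h2' z' : f2 z' != 0 -> z'.1.2 \in L1 ++ L2.
  by rewrite mem_cat => /h2 ->; rewrite orbT.
rewrite addE !(convolution_restrict _ _ (L := L1 ++ L2))//; last first.
  move=> z'; rewrite addE; have [->|/h1'//] := eqVneq (f1 z') 0.
  by rewrite add0r => /h2'.
rewrite -fsbig_split//=; last exact: finite_factorizations.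
by apply: eq_fsbigr => xy _; rewrite addE mulrDl.
Qed.

Lemma convolutionDr f g1 g2 : @Cc R G f ->
  @convolution R G f (g1 + g2) = @convolution R G f g1 + @convolution R G f g2.
Proof.
move=> /Cc_labels [L hL]; apply/funext => z.
rewrite addE !(convolution_restrict _ _ (L := L))//.
rewrite -fsbig_split//=; last exact: finite_factorizations.
by apply: eq_fsbigr => xy _; rewrite addE mulrDr.
Qed.

Lemma convolution0l g : @convolution R G 0 g = 0.
Proof. by apply/funext => z; apply: fsbig1 => xy _; rewrite mul0r. Qed.

Lemma convolution0r f : @convolution R G f 0 = 0.
Proof. by apply/funext => z; apply: fsbig1 => xy _; rewrite mulr0. Qed.

(** An arrow (xi, s t, zeta) has at most one factorization with labels s and t;
    it has one iff xi is in V_s. *)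
Lemma convolution_slice s t h k :
  @convolution R G (slice s h) (slice t k) =
  slice (s * t)%g (fun xi => h xi * transport s k xi).
Proof.
apply/funext => -[[xi r] zeta]; rewrite convolutionE.
have nz xy : factorizations (xi, r, zeta) xy ->
    slice s h xy.1 * slice t k xy.2 != 0 -> exists eta,
    [/\ is_arrow xi s eta, is_arrow eta t zeta, r = (s * t)%g &
     xy = ((xi, s, eta), (eta, t, zeta))].
  move=> /factorizationsP [eta [s' [t' [-> -> a a']]]].
  rewrite /slice; case: asboolP; last by rewrite mul0r eqxx.
  move=> [_ /= ss]; case: asboolP; last by rewrite mulr0 eqxx.
  by move=> [_ /= tt] _; exists eta; subst s' t'.
have [[eta [a a' rE]]|none] := pselect (exists eta,
    [/\ is_arrow xi s eta, is_arrow eta t zeta & r = (s * t)%g]); last first.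
  rewrite fsbig1 => [|xy xyz].
    rewrite /slice; case: asboolP => // -[/(arrowsE tailX) az /= rE].
    have [[n E]|[eta a tE]] := pull_dom tailX s (fun _ eta => k eta) xi.
      by rewrite [transport _ _ _]E mulr0.
    exfalso; apply: none; exists eta; split=> //.
    by have := arr_mul tailX (arr_inv tailX a) az; rewrite rE /=
      -[foldr _ _ _]/(free_word (s^-1 * (s * t))%g) mulKg.
  apply: contrapT => /eqP /(nz _ xyz) [eta [a a' rE _]].
  by apply: none; exists eta.
have ast : is_arrow xi (s * t)%g zeta by exact: arr_mul a a'.
rewrite rE (slice_arr tailX _ ast).
rewrite /transport (pullE _ a).
rewrite -(@fsbig_widen _ _ _ _ [set ((xi, s, eta), (eta, t, zeta))]).
- by rewrite fsbig_set1 /= !(slice_arr tailX).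
- by move=> _ ->; exact: mem_factorizations.
- move=> xy [xyz /= nxy]; apply: contrapT => /eqP; rewrite -rE in xyz.
  move=> /(nz _ xyz) [eta' [b b' _ xyE]]; apply: nxy.
  by rewrite xyE (arr_source_uniq a b).
Qed.

Lemma involution_slice t h : @involution R G (slice t h) =
  slice (t^-1)%g (transport (t^-1)%g (fun xi => (h xi)^*)).
Proof.
apply/funext => -[[xi r] zeta]; rewrite /involution /= /slice /=.
case: asboolP => [[/(arrowsE tailX) a /= rE]|n].
  have rE' : r = (t^-1)%g by rewrite -rE invgK.
  have a' : is_arrow xi r zeta by have := arr_inv tailX a; rewrite -[rev _]/(free_word
    (r^-1)^-1%g) invgK.
  case: asboolP => [_|[]]; last by split=> //; apply/arrowsE.
  by rewrite /transport (pullE _ (eta := zeta))// -rE'.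
case: asboolP => [[/(arrowsE tailX) a /= rE]|_]; last by rewrite conjC0.
exfalso; apply: n; split; last by rewrite rE invgK.
by apply/arrowsE => //; exact: arr_inv.
Qed.

Lemma involutionD f g :
  @involution R G (f + g) = @involution R G f + @involution R G g.
Proof. by apply/funext => z; exact: rmorphD. Qed.

Lemma involution0 : @involution R G 0 = 0.
Proof. by apply/funext => z; exact: conjC0. Qed.

Lemma CcM f g : @Cc R G f -> @Cc R G g -> @Cc R G (@convolution R G f g).
Proof.
move=> Cf Cg; move: f Cf; apply: (Cc_ind tailX).
- by rewrite convolution0l; exact: Cc0.
- by move=> f1 f2 C1 C2 h1 h2; rewrite convolutionDl//; exact: CcD.
move=> s h ch; move: g Cg; apply: (Cc_ind tailX).
- by rewrite convolution0r; exact: Cc0.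
- move=> g1 g2 C1 C2 h1 h2; rewrite convolutionDr//; first exact: CcD.
  exact: Cc_slice.
move=> t k ck; rewrite convolution_slice; apply: Cc_slice => //.
by apply: scontM => //; exact: scont_transport.
Qed.

Lemma Cc_involution f : @Cc R G f -> @Cc R G (@involution R G f).
Proof.
move: f; apply: (Cc_ind tailX).
- by rewrite involution0; exact: Cc0.
- by move=> f1 f2 C1 C2 h1 h2; rewrite involutionD; exact: CcD.
move=> t h ch; rewrite involution_slice; apply: Cc_slice => //.
by apply: scont_transport => //; exact: scont_conj.
Qed.

Lemma transport1 h : transport 1%g h = h.
Proof.
apply/funext => xi; have a : is_arrow xi (1%g : free_group A) xi by exact: (arr_nil xi xi).2.
by rewrite /transport (pullE _ a).
Qed.

Lemma sliceD t h k : slice t (h + k) = slice t h + slice t k.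
Proof.
apply/funext => z; rewrite addE /slice; case: asboolP => // _.
by rewrite addr0.
Qed.

Lemma sliceZ (c : C) t h : slice t (fun xi => c * h xi) = fun z => c * slice t h z.
Proof.
by apply/funext => z; rewrite /slice; case: asboolP => // _; rewrite mulr0.
Qed.

(** From |sqrt a - sqrt b| <= sqrt a + sqrt b. *)
Lemma sqrtC_dist (a b : C) : 0 <= a -> 0 <= b ->
  `|sqrtC a - sqrtC b| ^+ 2 <= `|a - b|.
Proof.
move=> a0 b0; have ra : 0 <= sqrtC a by rewrite sqrtC_ge0.
have rb : 0 <= sqrtC b by rewrite sqrtC_ge0.
rewrite -{2}(sqrtCK a) -{2}(sqrtCK b) subr_sqr normrM expr2 ler_wpM2l//.
by rewrite (le_trans (ler_normB _ _))// !ger0_norm// addr_ge0.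
Qed.

Lemma scont_sqrt h : (forall xi, 0 <= h xi) -> scont h ->
  scont (fun xi => sqrtC (h xi)).
Proof.
move=> h0 ch xi e e0; have e2 : 0 < e ^+ 2 by rewrite exprn_gt0.
have [Y [xY hY]] := ch xi _ e2; exists Y; split=> // xi' xY'.
rewrite -(@ltr_pXn2r _ 2) ?nnegrE// ?(ltW e0)//.
by apply: le_lt_trans (sqrtC_dist _ _) (hY _ xY').
Qed.

Section RepresentationTheory.
Variables (D : cstarType R) (pi : (T -> C) -> D).
Hypothesis rep_pi : @Cc_rep R G D pi.

Lemma rep_ops : [/\ forall f g, @Cc R G f -> @Cc R G g -> pi (f + g) = pi f + pi g,
      forall (c : C) f, @Cc R G f -> pi (fun x => c * f x) = c *: pi f,
      forall f g, @Cc R G f -> @Cc R G g -> pi (@convolution R G f g) = pi f ** pi g &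
      forall f, @Cc R G f -> pi (@involution R G f) = (pi f)^#].
Proof. exact/(Cc_repP (G := G)). Qed.

Lemma rep_sliceM s t h k : scont h -> scont k ->
  pi (slice s h) ** pi (slice t k) =
  pi (slice (s * t)%g (fun xi => h xi * transport s k xi)).
Proof.
move=> ch ck; have [_ _ pM _] := rep_ops.
by rewrite -pM ?convolution_slice//; exact: Cc_slice.
Qed.

Lemma rep_slice_adj t h : scont h -> (pi (slice t h))^# =
  pi (slice (t^-1)%g (transport (t^-1)%g (fun xi => (h xi)^*))).
Proof.
move=> ch; have [_ _ _ pS] := rep_ops.
by rewrite -pS ?involution_slice//; exact: Cc_slice.
Qed.

Lemma rep_sliceD t h k : scont h -> scont k ->
  pi (slice t (h + k)) = pi (slice t h) + pi (slice t k).
Proof.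
move=> ch ck; have [pD _ _ _] := rep_ops.
by rewrite sliceD pD//; exact: Cc_slice.
Qed.

Lemma rep_sliceZ (c : C) t h : scont h ->
  pi (slice t (fun xi => c * h xi)) = c *: pi (slice t h).
Proof.
move=> ch; have [_ pZ _ _] := rep_ops.
by rewrite sliceZ pZ//; exact: Cc_slice.
Qed.

Lemma rep_projection : is_projection (pi (slice 1%g (fun=> 1))).
Proof.
have c1 := scont_cst (X := X) (1 : C).
split.
  rewrite rep_slice_adj// invg1 transport1; congr (pi (slice _ _)).
  by apply/funext => xi; rewrite rmorph1.
rewrite rep_sliceM// mulg1 transport1; congr (pi (slice _ _)).
by apply/funext => xi; rewrite mulr1.
Qed.

(** The bound [unitary_bound] for k = sqrt(M^2 - h^2), which is continuous and
    therefore belongs to C_c(G).  No continuity of the representation is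
    assumed. *)
Lemma rep_diag_le h (M : C) : scont h -> 0 <= M ->
  (forall xi, h xi \is Num.real) -> (forall xi, `|h xi| <= M) ->
  `|pi (slice 1%g h)| <= M.
Proof.
move=> ch M0 hr hM; pose k xi := sqrtC (M ^+ 2 - h xi ^+ 2).
have hk0 xi : 0 <= M ^+ 2 - h xi ^+ 2.
  by rewrite subr_ge0 -real_normK// ler_pXn2r ?nnegrE.
have ck : scont k.
  apply: scont_sqrt => //.
  have -> : (fun xi => M ^+ 2 - h xi ^+ 2) =
      (fun=> M ^+ 2) + (fun xi => -1 * (h xi * h xi)).
    by apply/funext => xi; rewrite fctE mulN1r expr2.
  by apply: scontD; [exact: scont_cst | apply: scontZ; exact: scontM].
have self (l : stone X -> C) : scont l -> (forall xi, l xi \is Num.real) ->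
    (pi (slice 1%g l))^# = pi (slice 1%g l).
  move=> cl lr; rewrite rep_slice_adj// invg1 transport1.
  by congr (pi (slice _ _)); apply/funext => xi; rewrite conj_Creal.
apply: (unitary_bound M0 (k := pi (slice 1%g k)) (self h ch hr) _ _ rep_projection).
- by apply: self => // xi; apply: ger0_real; rewrite sqrtC_ge0.
- rewrite !rep_sliceM// mulg1 !transport1; congr (pi (slice _ _)).
  by apply/funext => xi; rewrite mulrC.
rewrite !rep_sliceM// mulg1 !transport1 -rep_sliceD//; try exact: scontM.
rewrite -rep_sliceZ; last exact: scont_cst.
congr (pi (slice _ _)); apply/funext => xi; rewrite fctE /k -!expr2 sqrtCK.
by rewrite addrCA subrr addr0 mulr1.
Qed.

(** The C*-identity: the product of the adjoint of a slice by the slice is a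
    slice over the units, with nonnegative coefficient. *)
Lemma rep_slice_le t h (M : C) : scont h -> 0 <= M ->
  (forall xi, `|h xi| <= M) -> `|pi (slice t h)| <= M.
Proof.
move=> ch M0 hM; apply: cstar_norm_le => //.
have cc := scont_conj ch; have ctc := scont_transport tailX (t^-1)%g cc.
have ct := scont_transport tailX (t^-1)%g ch.
rewrite rep_slice_adj// rep_sliceM// mulVg.
have E xi : 0 <= transport (t^-1)%g (fun xi => (h xi)^*) xi * transport (t^-1)%g h xi <= M ^+ 2.
  rewrite /transport /pull; case: pselect => [e|_]; last by rewrite mulr0 lexx exprn_ge0.
  rewrite mulrC -normCK; apply/andP; split; first by rewrite exprn_ge0.
  by rewrite ler_pXn2r ?nnegrE.
apply: rep_diag_le; first exact: scontM.
- by rewrite exprn_ge0.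
- by move=> xi; have /andP[/ger0_real] := E xi.
- by move=> xi; have /andP[h0 hle] := E xi; rewrite ger0_norm.
Qed.

Lemma rep_0 : pi 0 = 0.
Proof.
have [_ pZ _ _] := rep_ops; rewrite -[RHS](scale0r (pi 0)) -pZ; last exact: Cc0.
by congr pi; apply/funext => z; rewrite mul0r.
Qed.

End RepresentationTheory.

Lemma rep_bounded f : @Cc R G f ->
  exists M : C, forall (D : cstarType R) (pi : (T -> C) -> D),
    @Cc_rep R G D pi -> `|pi f| <= M.
Proof.
move: f; apply: (Cc_ind tailX).
- by exists 0 => D pi r; rewrite (rep_0 r) normr0.
- move=> f g Cf Cg [M hM] [N hN]; exists (M + N) => D pi r.
  have [pD _ _ _] := rep_ops r; rewrite pD//.
  by apply: le_trans (ler_normD _ _) _; rewrite lerD ?hM ?hN.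
move=> t h ch; have [M M0 hM] := scont_bounded ch; exists M => D pi r.
exact: rep_slice_le.
Qed.

Theorem full_Cstar_exists : exists B : cstarType R, is_full_groupoid_Cstar G B.
Proof.
apply: full_groupoid_Cstar_exists.
- exact: Cc0.
- exact: CcD.
- exact: CcZ.
- exact: CcM.
- exact: Cc_involution.
- exact: rep_bounded.
Qed.

End Convolution.

(** * Simple functions and the spectral integral *)

Section SimpleFunctions.
Context {R : realType} {A : pointedType} (X : set (nat -> A)).
Local Notation C := R[i].
Implicit Types (xi : stone X) (h k : stone X -> C).

Definition clopen := {Y : set (nat -> A) | balg X Y}.
(** Simple functions are kept as formal combinations of clopen sets: such a
    combination has a value both among the functions ([simple_fun]) and in a
    C*-algebra with projections ([simple_op]). *)
Definition simple := seq (C * clopen).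
Implicit Types (l : simple) (Y Z : clopen).

Definition clopenI Y Z : clopen := exist _ _ (balgI (svalP Y) (svalP Z)).
Definition clopenC Y : clopen := exist _ _ (balgC (svalP Y)).
Definition clopenT : clopen := exist _ _ (@balgX A X).

Definition simple_fun l xi : C := \sum_(i <- l) i.1 * indic (sval i.2) xi.

Definition simpleZ (c : C) l : simple := [seq (c * i.1, i.2) | i <- l].
Definition simple_adj l : simple := [seq (i.1^*, i.2) | i <- l].
Definition simpleM l l' : simple :=
  [seq (i.1 * j.1, clopenI i.2 j.2) | i <- l, j <- l'].

Lemma indic1 (Y : set (nat -> A)) xi : sval xi Y -> indic (R := R) Y xi = 1.
Proof. by rewrite /indic => h; case: asboolP. Qed.

Lemma indic0 (Y : set (nat -> A)) xi : ~ sval xi Y -> indic (R := R) Y xi = 0.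
Proof. by rewrite /indic => h; case: asboolP. Qed.

Lemma indicI (Y Z : set (nat -> A)) xi : balg X Y -> balg X Z ->
  indic (R := R) (Y `&` Z) xi = indic Y xi * indic Z xi.
Proof.
move=> BY BZ; have [xY|nY] := pselect (sval xi Y); last first.
  by rewrite (indic0 nY) mul0r indic0// => /(stone_IE _ BY BZ) [].
have [xZ|nZ] := pselect (sval xi Z).
  by rewrite !indic1 ?mulr1//; exact: stone_I.
by rewrite (indic0 nZ) mulr0 indic0// => /(stone_IE _ BY BZ) [].
Qed.

Lemma indicC (Y : set (nat -> A)) xi : balg X Y ->
  indic (R := R) (X `\` Y) xi = 1 - indic Y xi.
Proof.
move=> BY; have [xY|nY] := pselect (sval xi Y).
  by rewrite (indic1 xY) subrr indic0// => /(stone_C _ BY).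
by rewrite (indic0 nY) subr0 indic1//; exact/stone_C.
Qed.

Lemma indicX xi : indic (R := R) X xi = 1.
Proof. by apply: indic1; exact: stone_X. Qed.

Lemma indicU (Y Z : set (nat -> A)) xi : balg X Y -> balg X Z ->
  indic (R := R) (Y `|` Z) xi = indic Y xi + indic Z xi - indic (Y `&` Z) xi.
Proof.
move=> BY BZ; rewrite indicI//; have [xY|nY] := pselect (sval xi Y).
  by rewrite (indic1 xY) mul1r addrK indic1//; apply/stone_U => //; left.
rewrite (indic0 nY) mul0r subr0 add0r; have [xZ|nZ] := pselect (sval xi Z).
  by rewrite !indic1//; apply/stone_U => //; right.
by rewrite !indic0// => /(stone_U _ BY BZ) [].
Qed.

Lemma simple_fun_cat l l' xi : simple_fun (l ++ l') xi = simple_fun l xi + simple_fun l' xi.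
Proof. by rewrite /simple_fun big_cat. Qed.

Lemma simple_fun_cons i l xi : simple_fun (i :: l) xi = i.1 * indic (sval i.2) xi +
  simple_fun l xi.
Proof. by rewrite /simple_fun big_cons. Qed.

Lemma simple_fun_nil xi : simple_fun [::] xi = 0.
Proof. by rewrite /simple_fun big_nil. Qed.

Lemma simple_funZ (c : C) l xi : simple_fun (simpleZ c l) xi = c * simple_fun l xi.
Proof. by rewrite /simple_fun big_map mulr_sumr; apply: eq_bigr => i _; rewrite mulrA. Qed.

Lemma indic_conj (Y : set (nat -> A)) xi : (indic (R := R) Y xi)^* = indic Y xi.
Proof. by rewrite /indic; case: asboolP => _; rewrite ?conjC1 ?conjC0. Qed.

Lemma simple_fun_adj l xi : simple_fun (simple_adj l) xi = (simple_fun l xi)^*.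
Proof.
rewrite /simple_fun big_map rmorph_sum; apply: eq_bigr => i _.
by rewrite rmorphM /= indic_conj.
Qed.

Lemma simple_funM l l' xi : simple_fun (simpleM l l') xi = simple_fun l xi * simple_fun l' xi.
Proof.
rewrite /simple_fun big_allpairs_dep mulr_suml; apply: eq_bigr => i _.
rewrite mulr_sumr; apply: eq_bigr => j _ /=.
by rewrite (indicI xi (svalP i.2) (svalP j.2)) mulrACA.
Qed.

Lemma scont_simple_fun l : scont (simple_fun l).
Proof.
elim: l => [|i l IH].
  have -> : simple_fun [::] = fun=> 0 by apply/funext => xi; rewrite simple_fun_nil.
  exact: scont_cst.
have -> : simple_fun (i :: l) = (fun xi => i.1 * indic (sval i.2) xi) + simple_fun l.
  by apply/funext => xi; rewrite simple_fun_cons.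
by apply: scontD => //; apply: scontZ; apply: scont_indic; exact: svalP.
Qed.

(** By induction on the number of clopen sets, for all psi at once: the first
    set Y, with coefficient a, splits the space into Y, where psi(a + .) is
    composed with the rest, and its complement, where psi is. *)
Lemma simple_fun_comp (psi : C -> C) l :
  exists l', forall xi, simple_fun l' xi = psi (simple_fun l xi).
Proof.
elim: l psi => [|[a Y] l IH] psi.
  by exists [:: (psi 0, clopenT)] => xi; rewrite simple_fun_cons !simple_fun_nil addr0
    /= indicX mulr1.
have [l1 h1] := IH (fun z => psi (a + z)); have [l2 h2] := IH psi.
exists (simpleM [:: (1, Y)] l1 ++ simpleM [:: (1, clopenC Y)] l2) => xi.
rewrite simple_fun_cat !simple_funM !simple_fun_cons !simple_fun_nil !addr0 !mul1r /=
  h1 h2 (indicC xi (svalP Y)).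
have [xY|nY] := pselect (sval xi (sval Y)).
  by rewrite (indic1 xY) subrr mul0r addr0 mul1r mulr1.
by rewrite (indic0 nY) subr0 mul0r mul1r mulr0 !add0r.
Qed.

(** By compactness, h is within e of a constant on each member of a finite
    clopen cover; the members are made disjoint one after the other. *)
Lemma simple_approx h (e : C) : scont h -> 0 < e ->
  exists l, forall xi, `|h xi - simple_fun l xi| <= e.
Proof.
move=> ch e0.
have [|s [sP scov]] := stone_cover_finite (X := X)
  (P := fun Y : set (nat -> A) => balg X Y /\
    exists c : C, forall xi, sval xi Y -> `|h xi - c| <= e).
  move=> xi; have [Y [xY hY]] := ch xi e e0; exists Y => //.
  split; first exact: stone_balg xY.
  by exists (h xi) => xi' /hY; rewrite distrC => /ltW.
suff [l hl] : exists l, forall xi (Y : set (nat -> A)),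
    Y \in s -> sval xi Y -> `|h xi - simple_fun l xi| <= e.
  by exists l => xi; have [Y Ys xY] := scov xi; exact: hl xY.
elim: s sP {scov} => [|Y s IH] sP; first by exists [::].
have [|l hl] := IH; first by move=> Z Zs; apply: sP; rewrite inE Zs orbT.
have [BY [c hc]] := sP Y (mem_head _ _).
pose Y' : clopen := exist _ _ BY.
exists ((c, Y') :: simpleM [:: (1, clopenC Y')] l) => xi Z.
rewrite simple_fun_cons simple_funM simple_fun_cons simple_fun_nil addr0 mul1r /=
  (indicC xi BY).
have [xY _ _|nY] := pselect (sval xi Y).
  by rewrite (indic1 xY) subrr mul0r addr0 mulr1; exact: hc.
rewrite inE => /predU1P[->//|Zs] xZ.
by rewrite (indic0 nY) subr0 mul1r mulr0 add0r; exact: hl xZ.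
Qed.

Section Integral.
Context (D : cstarType R) (e : D) (p : set (nat -> A) -> D).
Hypothesis ue : is_unit_of e.
Hypothesis p_proj : forall Y : set (nat -> A), balg X Y -> is_projection (p Y).
Hypothesis pX : p X = e.
Hypothesis pI : forall Y Z : set (nat -> A), balg X Y -> balg X Z -> p (Y `&` Z) = p Y ** p Z.
Hypothesis pU : forall Y Z : set (nat -> A), balg X Y -> balg X Z ->
  p (Y `|` Z) = p Y + p Z - p (Y `&` Z).
Hypothesis p0 : p set0 = 0.

Definition simple_op l : D := \sum_(i <- l) i.1 *: p (sval i.2).

Lemma simple_op_cat l l' : simple_op (l ++ l') = simple_op l + simple_op l'.
Proof. by rewrite /simple_op big_cat. Qed.

Lemma simple_op_cons i l : simple_op (i :: l) = i.1 *: p (sval i.2) + simple_op l.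
Proof. by rewrite /simple_op big_cons. Qed.

Lemma simple_op_nil : simple_op [::] = 0.
Proof. by rewrite /simple_op big_nil. Qed.

Lemma simple_opZ (c : C) l : simple_op (simpleZ c l) = c *: simple_op l.
Proof. by rewrite /simple_op big_map scaler_sumr; apply: eq_bigr => i _; rewrite scalerA. Qed.

Lemma simple_op_adj l : simple_op (simple_adj l) = (simple_op l)^#.
Proof.
elim: l => [|i l IH]; first by rewrite !simple_op_nil adj0.
rewrite [simple_adj _]/= !simple_op_cons IH adjD adjZ.
by have [-> _] := p_proj (svalP i.2).
Qed.

Lemma cmul_sumr (x : D) (I : Type) (s : seq I) (F : I -> D) :
  x ** (\sum_(i <- s) F i) = \sum_(i <- s) (x ** F i).
Proof. by elim/big_rec2: _ => [|i y z _ <-]; rewrite ?cmulr0 ?cmulDr. Qed.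

Lemma cmul_suml (x : D) (I : Type) (s : seq I) (F : I -> D) :
  (\sum_(i <- s) F i) ** x = \sum_(i <- s) (F i ** x).
Proof. by elim/big_rec2: _ => [|i y z _ <-]; rewrite ?cmul0 ?cmulDl. Qed.

Lemma simple_opM l l' : simple_op (simpleM l l') = simple_op l ** simple_op l'.
Proof.
rewrite /simple_op big_allpairs_dep cmul_suml; apply: eq_bigr => i _.
rewrite cmul_sumr; apply: eq_bigr => j _ /=.
by rewrite cmulZl cmulZr scalerA (pI (svalP i.2) (svalP j.2)).
Qed.

Lemma p_split (Y Z : set (nat -> A)) : balg X Y -> balg X Z ->
  p Z = p (Z `&` Y) + p (Z `&` (X `\` Y)).
Proof.
move=> BY BZ; have BC := balgC BY.
have {1}-> : Z = (Z `&` Y) `|` (Z `&` (X `\` Y)).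
  apply/seteqP; split=> [z Zz|z [[]|[]]//].
  have [Yz|nYz] := pselect (Y z); first by left.
  by right; split=> //; split=> //; exact: balg_sub Zz.
rewrite pU; try exact: balgI.
suff -> : Z `&` Y `&` (Z `&` (X `\` Y)) = set0 by rewrite p0 subr0.
by apply/seteqP; split=> // z [[_ Yz] [_ []]].
Qed.

(** Splitting Z along the first clopen set reduces the number of sets.  Once
    none is left, either c = 0, or Z is empty and its projection is 0. *)
Lemma simple_op_vanish l (c : C) (Z : set (nat -> A)) : balg X Z ->
  (forall xi, sval xi Z -> c + simple_fun l xi = 0) -> p Z ** (c *: e + simple_op l) = 0.
Proof.
elim: l c Z => [|[a Y] l IH] c Z BZ h.
  rewrite simple_op_nil addr0; have [[z Zz]|none] := pselect (Z !=set0).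
    have [xi hxi] := principal_stone (balg_sub BZ Zz).
    by have := h xi ((hxi Z BZ).2 Zz); rewrite simple_fun_nil addr0 => ->; rewrite
      scale0r cmulr0.
  have -> : Z = set0 by apply/seteqP; split=> // z Zz; apply: none; exists z.
  by rewrite p0 cmul0.
have BY := svalP Y; have BC := balgC BY.
have BZY : balg X (Z `&` sval Y) by exact: balgI.
have BZC : balg X (Z `&` (X `\` sval Y)) by exact: balgI.
rewrite (p_split BY BZ) cmulDl.
have -> : p (Z `&` sval Y) ** (c *: e + simple_op ((a, Y) :: l)) = 0.
  rewrite simple_op_cons addrA !cmulDr !cmulZr /= -pI//.
  rewrite (_ : Z `&` sval Y `&` sval Y = Z `&` sval Y); last by rewrite -setIA setIid.
  rewrite (ue _).2 -scalerDl -[X in _ *: X](ue _).2 -cmulZr -cmulDr IH// => xi xZY.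
  have [xZ xY] := (stone_IE _ BZ BY).1 xZY.
  by have := h xi xZ; rewrite simple_fun_cons /= indic1// mulr1 addrA.
rewrite add0r simple_op_cons addrA !cmulDr !cmulZr /= -pI//.
rewrite (_ : Z `&` (X `\` sval Y) `&` sval Y = set0); last first.
  by apply/seteqP; split=> // z [[_ []]].
rewrite p0 scaler0 addr0 -cmulZr -cmulDr IH// => xi xZC.
have [xZ /(stone_C _ BY) nY] := (stone_IE _ BZ BC).1 xZC.
by have := h xi xZ; rewrite simple_fun_cons /= indic0// mulr0 add0r.
Qed.

Lemma simple_op_eq l l' :
  (forall xi, simple_fun l xi = simple_fun l' xi) -> simple_op l = simple_op l'.
Proof.
move=> h; apply/subr0_eq.
have -> : simple_op l - simple_op l' = simple_op (l ++ simpleZ (-1) l').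
  by rewrite simple_op_cat simple_opZ scaleN1r.
have := @simple_op_vanish (l ++ simpleZ (-1) l') 0 X (@balgX A X).
rewrite scale0r add0r pX (ue _).1; apply=> xi _.
by rewrite simple_fun_cat simple_funZ h mulN1r subrr addr0.
Qed.

Lemma simple_op_one : simple_op [:: (1, clopenT)] = e.
Proof. by rewrite simple_op_cons simple_op_nil addr0 scale1r /= pX. Qed.

(** The bound [unitary_bound] for the simple functions h = |f|^2 and
    sqrt(M^4 - h^2). *)
Lemma simple_op_le l (M : C) : 0 <= M ->
  (forall xi, `|simple_fun l xi| <= M) -> `|simple_op l| <= M.
Proof.
move=> M0 hM; apply: cstar_norm_le => //; rewrite -simple_op_adj -simple_opM.
pose a := simpleM (simple_adj l) l.
have aE xi : simple_fun a xi = `|simple_fun l xi| ^+ 2 by rewrite simple_funM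
  simple_fun_adj mulrC normCK.
have [b bE] := simple_fun_comp (fun z => sqrtC ((M ^+ 2) ^+ 2 - z ^+ 2)) a.
have a0 xi : 0 <= (M ^+ 2) ^+ 2 - simple_fun a xi ^+ 2.
  rewrite aE subr_ge0 ler_pXn2r ?nnegrE ?exprn_ge0//.
  by rewrite ler_pXn2r ?nnegrE.
have M20 : 0 <= M ^+ 2 by rewrite exprn_ge0.
apply: (unitary_bound M20 (k := simple_op b) (q := e)).
- rewrite -simple_op_adj; apply: simple_op_eq => xi.
  by rewrite simple_fun_adj aE geC0_conj// exprn_ge0.
- rewrite -simple_op_adj; apply: simple_op_eq => xi.
  by rewrite simple_fun_adj bE geC0_conj// sqrtC_ge0.
- by rewrite -!simple_opM; apply: simple_op_eq => xi; rewrite (simple_funM a b)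
  (simple_funM b a) mulrC.
- exact: unit_projection.
rewrite -!simple_opM -simple_op_cat -simple_op_one -simple_opZ; apply: simple_op_eq => xi.
rewrite simple_fun_cat (simple_funM a a) (simple_funM b b) bE -!expr2 sqrtCK
  simple_funZ simple_fun_cons simple_fun_nil addr0 /= indicX.
by rewrite !mulr1 addrCA subrr addr0.
Qed.

Definition sup_le (h : stone X -> C^o) (r : C) := 0 <= r /\ forall xi, `|h xi : C| <= r.
Definition simple_pair (h : stone X -> C^o) (d : D) :=
  exists2 l, h = simple_fun l & d = simple_op l.
Definition fun_mul (h k : stone X -> C^o) : stone X -> C^o := fun xi => h xi * k xi.
Definition fun_conj (h : stone X -> C^o) : stone X -> C^o := fun xi => (h xi : C)^*.

(** The *-homomorphism on the continuous functions that extends Y |-> p_Y, by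
    uniform approximation. *)
Definition integral : (stone X -> C) -> D :=
  @extension R D (stone X -> C^o) sup_le simple_pair.

Lemma simple_relation : contractive_relation fun_mul fun_conj sup_le simple_pair.
Proof.
split.
- by move=> h r [].
- move=> h r s [r0 h1] rs; split=> [|xi]; first exact: le_trans rs.
  exact: le_trans (h1 xi) rs.
- move=> h k r s [r0 h1] [s0 h2]; split=> [|xi]; first exact: addr_ge0.
  by apply: le_trans (ler_normD _ _) _; exact: lerD.
- move=> c h r [r0 h1]; split=> [|xi]; first exact: mulr_ge0.
  by rewrite (normrM c (h xi)); exact: ler_wpM2l.
- move=> h k r s [r0 h1] [s0 h2]; split=> [|xi]; first exact: mulr_ge0.
  by rewrite (normrM (h xi) (k xi)); exact: ler_pM.
- by move=> h r [r0 h1]; split=> // xi; rewrite norm_conjC.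
- by move=> h k g; apply/funext => xi; exact: mulrBl.
- by move=> h k g; apply/funext => xi; exact: mulrBr.
- by move=> h k; apply/funext => xi; exact: rmorphB.
- move=> h k d f [l -> ->] [l' -> ->]; exists (l ++ l'); last by rewrite simple_op_cat.
  by apply/funext => xi; rewrite simple_fun_cat.
- move=> c h d [l -> ->]; exists (simpleZ c l); last by rewrite simple_opZ.
  by apply/funext => xi; rewrite simple_funZ.
- move=> h k d f [l -> ->] [l' -> ->]; exists (simpleM l l'); last by rewrite simple_opM.
  by apply/funext => xi; rewrite simple_funM.
- move=> h d [l -> ->]; exists (simple_adj l); last by rewrite simple_op_adj.
  by apply/funext => xi; rewrite simple_fun_adj.
- by move=> h d r [l -> ->] [r0 h1]; exact: simple_op_le.
- move=> h d [l -> _]; have [M M0 hM] := scont_bounded (scont_simple_fun l).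
  by exists M.
Qed.

Lemma integral_dom h : scont h -> ext_dom sup_le simple_pair (h : stone X -> C^o).
Proof.
move=> ch r r0; have [l hl] := simple_approx ch r0.
by exists (simple_op l), (simple_fun l); [split => //; exact: ltW | exists l].
Qed.

Lemma integral_simple_fun l : integral (simple_fun l) = simple_op l.
Proof. by apply: (extension_Gm simple_relation); exists l. Qed.

Lemma integral_indic (Y : set (nat -> A)) : balg X Y -> integral (indic Y) = p Y.
Proof.
move=> BY; pose l : simple := [:: (1, exist _ _ BY)].
have -> : indic Y = simple_fun l by apply/funext => xi; rewrite simple_fun_cons
  simple_fun_nil addr0 mul1r.
by rewrite integral_simple_fun simple_op_cons simple_op_nil addr0 scale1r.
Qed.

Lemma integralD h k : scont h -> scont k ->
  integral (h + k) = integral h + integral k.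
Proof.
move=> /integral_dom ch /integral_dom ck.
by have [_ ] := extensionD simple_relation ch ck.
Qed.

Lemma integralZ (c : C) h : scont h ->
  integral (fun xi => c * h xi) = c *: integral h.
Proof.
by move=> /integral_dom ch; have [_] := extensionZ simple_relation c ch.
Qed.

Lemma integralM h k : scont h -> scont k ->
  integral (fun xi => h xi * k xi) = integral h ** integral k.
Proof.
move=> /integral_dom ch /integral_dom ck.
by have [_] := extensionM simple_relation ch ck.
Qed.

Lemma integral_adj h : scont h ->
  integral (fun xi => (h xi)^*) = (integral h)^#.
Proof.
by move=> /integral_dom ch; have [_] := extension_star simple_relation ch.
Qed.

Lemma integral_le h (M : C) : scont h -> 0 <= M -> (forall xi, `|h xi| <= M) ->
  `|integral h| <= M.
Proof.
by move=> /integral_dom ch M0 hM; apply: (extension_le simple_relation ch); split.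
Qed.

Lemma integral_dist h k (M : C) : scont h -> scont k -> 0 <= M ->
  (forall xi, `|h xi - k xi| <= M) -> `|integral h - integral k| <= M.
Proof.
move=> ch ck M0 hM; have ck' := scontZ (-1) ck.
have -> : integral h - integral k = integral (h + (fun xi => -1 * k xi)).
  by rewrite integralD// integralZ// scaleN1r.
apply: integral_le => //; first exact: scontD.
move=> xi; have := hM xi; congr (_ <= _); congr (`|_|).
by rewrite -[- k xi]mulN1r.
Qed.

Hypothesis tailX : forall w x, X (wcat w x) -> X x.

(** Both sides are continuous in h, and they agree on indicator functions by
    assumption. *)
Lemma integral_transport (t : free_group A) (u : D) h : scont h -> `|u| <= 1 ->
  (forall Y : set (nat -> A), balg X Y -> u ** p Y ** u^# = p (theta X t Y)) ->
  integral (transport t h) = u ** integral h ** u^#.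
Proof.
move=> ch u1 cov; apply/subr0_eq/norm_small_eq0 => d d0.
have d2 : 0 < d / 2 by rewrite divr_gt0 ?ltr0n.
have d20 := ltW d2.
have [l hl] := simple_approx ch d2.
have cth := scont_transport tailX t ch.
have ctl := scont_transport tailX t (scont_simple_fun l).
have thl xi : `|transport t h xi - transport t (simple_fun l) xi| <= d / 2.
  rewrite /transport /pull; case: pselect => [a|_]; first exact: hl.
  by rewrite subrr normr0.
pose l' : simple := [seq (i.1, exist _ _ (theta_balg tailX t (svalP i.2))) | i <- l].
have evl' : transport t (simple_fun l) = simple_fun l'.
  apply/funext => xi; rewrite /simple_fun big_map.
  have [[n E]|[eta a E]] := pull_dom tailX t (fun _ eta => simple_fun l eta) xi.
    rewrite [LHS]E big1// => i _ /=; rewrite indic0 ?mulr0// => /stone_up h'.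
    by apply: n; apply: h'; [apply: theta_balg => //; exact: balgX
      | apply: thetaS; exact: balg_sub (svalP i.2)].
  rewrite [LHS]E /simple_fun; apply: eq_bigr => i _ /=; congr (_ * _).
  have [eY|nY] := pselect (sval eta (sval i.2)).
    by rewrite !indic1//; exact: a.
  by rewrite !indic0// => /(arr_E a (svalP i.2)).
have evDl' : simple_op l' = u ** simple_op l ** u^#.
  rewrite /simple_op big_map cmul_sumr cmul_suml; apply: eq_bigr => i _ /=.
  by rewrite cmulZr cmulZl cov//; exact: svalP.
have -> : integral (transport t h) - u ** integral h ** u^# =
    (integral (transport t h) - integral (transport t (simple_fun l))) -
    u ** (integral h - integral (simple_fun l)) ** u^#.
  by rewrite evl' !integral_simple_fun evDl' cmulBr cmulBl opprB addrA subrK.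
rewrite (splitr d); apply: le_trans (ler_normB _ _) _; apply: lerD.
  exact: integral_dist.
apply: le_trans (cmul_norm _ _) _; rewrite -[leRHS]mulr1 adj_norm.
apply: ler_pM => //; apply: le_trans (cmul_norm _ _) _; rewrite -[leRHS]mul1r.
by apply: ler_pM => //; apply: integral_dist => //; exact: scont_simple_fun.
Qed.

End Integral.
End SimpleFunctions.

(** * Consequences of the relations *)

(** The element y = x x^# x - x satisfies y^# y = q^3 - 2 q^2 + q = 0, where
    q = x^# x. *)
Lemma projection_isometry {R : realType} (D : cstarType R) (x : D) :
  is_projection (x^# ** x) -> x ** x^# ** x = x.
Proof.
set q := x^# ** x => -[qa qq]; rewrite -cmulA -/q; apply/subr0_eq/cstar_eq0.
have xq : x^# ** (x ** q) = q by rewrite cmulA.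
by rewrite adjB adjM qa cmulBl !cmulBr -!(cmulA q) xq -/q !qq !subrr.
Qed.

Section Relations.
Context {R : realType} {A : pointedType} (X : set (nat -> A)).
Hypothesis tailX : forall w x, X (wcat w x) -> X x.
Local Notation C := R[i].
Local Notation G := (transformation_groupoid X).
Local Notation T := (stone X * free_group A * stone X)%type.
Local Notation theta := (theta X).
Context (D : cstarType R) (e : D) (p : set (nat -> A) -> D) (s : A -> D).
Hypothesis ue : is_unit_of e.
Hypothesis rel : subshift_relations X e p s.
Implicit Types (Y Z : set (nat -> A)) (l k : A) (a b : seq A).
Implicit Types (m : A * bool) (u v w : seq (A * bool)).

Let p_proj Y : balg X Y -> is_projection (p Y).
Proof. by case: rel => h _ _ _ _; exact: h. Qed.
Let pX : p X = e. Proof. by case: rel => _ _ [h _ _ _] _ _. Qed.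
Let pI Y Z : balg X Y -> balg X Z -> p (Y `&` Z) = p Y ** p Z.
Proof. by case: rel => _ _ [_ h _ _] _ _; exact: h. Qed.
Let pU Y Z : balg X Y -> balg X Z -> p (Y `|` Z) = p Y + p Z - p (Y `&` Z).
Proof. by case: rel => _ _ [_ _ h _] _ _; exact: h. Qed.
Let p0 : p set0 = 0. Proof. by case: rel => _ _ [_ _ _ h] _ _. Qed.
Let s0 l : ~ language X [:: l] -> s l = 0.
Proof. by case: rel => _ _ _ _; exact. Qed.
Let pC Y : balg X Y -> p (X `\` Y) = e - p Y.
Proof.
move=> BY; have h := p_split pU p0 BY (@balgX A X).
have XY : X `&` Y = Y.
  by apply/seteqP; split=> z; [case|move=> Yz; split=> //; exact: balg_sub Yz].
have XC : X `&` (X `\` Y) = X `\` Y by apply/seteqP; split=> z; [case|case].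
by rewrite -pX h XY XC addrC addKr.
Qed.
Let ea : e^# = e. Proof. exact: unit_adj. Qed.
Let el x : e ** x = x. Proof. by have [] := ue x. Qed.
Let er x : x ** e = x. Proof. by have [] := ue x. Qed.
Let pComm Y Z : balg X Y -> balg X Z -> p Y ** p Z = p Z ** p Y.
Proof. by move=> BY BZ; rewrite -!pI// setIC. Qed.

Local Notation sw := (sword e s).

Let relC a b : language X a -> language X b ->
  sw b ** (sw a)^# ** sw a ** (sw b)^# = p (Cset X a b).
Proof. by case: rel => _ _ _ h _; exact: h. Qed.

Let lang0 : language X [::]. Proof. by left. Qed.

Lemma sword_cat a b : sw (a ++ b) = sw a ** sw b.
Proof. by elim: a => [|l a IH] /=; rewrite ?el// IH cmulA. Qed.

Lemma sword1 l : sw [:: l] = s l.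
Proof. by rewrite /= er. Qed.

Lemma sword_source a : language X a -> (sw a)^# ** sw a = p (Cset X a [::]).
Proof. by move=> la; rewrite -relC//= ea el er. Qed.

Lemma sword_range b : language X b -> sw b ** (sw b)^# = p (Cset X [::] b).
Proof. by move=> lb; rewrite -relC//= ea !er. Qed.

Lemma sword_isometry a : language X a -> sw a ** (sw a)^# ** sw a = sw a.
Proof.
move=> la; apply: projection_isometry; rewrite sword_source//.
by apply: p_proj; exact: balg_Cset.
Qed.

(** The source projection of s_a and the range projection of s_b are orthogonal,
    as no sequence of X begins with a b. *)
Lemma sword_mul0 a b : language X a -> language X b -> ~ language X (a ++ b) ->
  sw a ** sw b = 0.
Proof.
move=> la lb nab; rewrite -(sword_isometry la) -(sword_isometry lb).
have -> : sw a ** (sw a)^# ** sw a ** (sw b ** (sw b)^# ** sw b) =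
    sw a ** (((sw a)^# ** sw a) ** (sw b ** (sw b)^#)) ** sw b.
  by rewrite !cmulA.
rewrite sword_source// sword_range// -pI; try exact: balg_Cset.
rewrite (_ : _ `&` _ = set0) ?p0 ?cmulr0 ?cmul0//.
apply/seteqP; split=> // y [[x [yE _ Xa]] [z [yE' _ _]]]; apply: nab.
apply: (language_wcat tailX (x := z)).
by rewrite wcat_cat -yE' yE wcat0.
Qed.

Definition letter m : D := if m.2 then s m.1 else (s m.1)^#.

Lemma letter_adj m : (letter m)^# = letter (letter_inv m).
Proof. by case: m => l []; rewrite /letter //= adjK. Qed.

(** The relations give the cases where all words involved are in the language;
    in the other cases both sides vanish. *)
Lemma letter_Cset m a b : language X a -> language X b ->
  letter m ** p (Cset X a b) ** (letter m)^# = p (theta [:: m] (Cset X a b)).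
Proof.
move=> la lb; case: m => l c; have [ll|nl] := pselect (language X [:: l]); last first.
  rewrite /letter /= s0//; have -> : theta [:: (l, c)] (Cset X a b) = set0.
    apply/seteqP; split=> // z [x _ /chain1 [Xx Xz /= h]]; apply: nl.
    by case: c h => h; [apply: (language_wcat tailX (x := x)); rewrite -h
      | apply: (language_wcat tailX (x := z)); rewrite -h].
  by rewrite p0; case: c; rewrite /= ?adj0 ?cmul0.
case: c; rewrite /letter /=.
  have [lb'|nlb] := pselect (language X (l :: b)).
    by rewrite theta_pos_Cset// -!relC//= adjM !cmulA.
  rewrite theta_pos_Cset0// p0 -relC// !cmulA.
  by have := sword_mul0 ll lb nlb; rewrite sword1 => ->; rewrite !cmul0.
have sl := sword_source ll; rewrite sword1 in sl.
have rl := sword_range ll; rewrite sword1 in rl.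
have il := sword_isometry ll; rewrite sword1 in il.
rewrite adjK; case: b lb => [_|k b lb].
  rewrite (theta_neg_nil tailX) -(sword_source la) !cmulA.
  have -> : (s l)^# ** (sw a)^# ** sw a ** s l =
      (sw (rcons a l))^# ** sw (rcons a l).
    by rewrite -cats1 sword_cat sword1 adjM !cmulA.
  have [lal|nal] := pselect (language X (rcons a l)); first exact: sword_source.
  rewrite (Cset_set0 tailX) ?p0; last by case.
  by rewrite -cats1 sword_cat sword_mul0 ?cmulr0// cats1.
have [lk lb'] := @language_cat _ _ tailX [:: k] b lb.
have [lk'|lk'] := eqVneq l k; last first.
  have rk := sword_range lk; rewrite sword1 in rk.
  have ik := sword_isometry lk; rewrite sword1 in ik.
  rewrite theta_neg_neq// p0 -relC//= !cmulA.
  suff -> : (s l)^# ** s k = 0 by rewrite !cmul0.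
  rewrite -il -ik !adjM adjK.
  have -> : (s l)^# ** (s l ** (s l)^#) ** (s k ** (s k)^# ** s k) =
      (s l)^# ** ((s l ** (s l)^#) ** (s k ** (s k)^#)) ** s k.
    by rewrite !cmulA.
  rewrite rl rk -pI; try exact: balg_Cset.
  rewrite (_ : _ `&` _ = set0) ?p0 ?cmulr0 ?cmul0//.
  apply/seteqP; split=> // y [[x [yE _ _]] [z [yE' _ _]]].
  have [kl _] := @wcat1_inj _ l k x z (etrans (esym yE) yE').
  by rewrite kl eqxx in lk'.
subst k; rewrite theta_neg_cons -relC//= adjM.
have -> : (s l)^# ** (s l ** sw b ** (sw a)^# ** sw a ** ((sw b)^# ** (s l)^#)) ** s l =
   ((s l)^# ** s l) ** (sw b ** (sw a)^# ** sw a ** (sw b)^#) ** ((s l)^# ** s l).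
  by rewrite !cmulA.
rewrite relC// sl.
have BC := balg_Cset la lb'; have Bl := balg_Cset ll lang0.
by rewrite pI// (pComm Bl BC) -cmulA -pI// setIid.
Qed.

Lemma letter_X m : letter m ** (letter m)^# = p (theta [:: m] X).
Proof. by have := letter_Cset m lang0 lang0; rewrite Cset_nil pX er. Qed.

Lemma letter_source m : (letter m)^# ** letter m = p (theta [:: letter_inv m] X).
Proof. by rewrite -letter_X -letter_adj adjK. Qed.

Lemma letter_isometry m : letter m ** ((letter m)^# ** letter m) = letter m.
Proof.
rewrite cmulA; apply: projection_isometry; rewrite letter_source.
by apply: p_proj; apply: theta_balg => //; exact: balgX.
Qed.

Let BtX w : balg X (theta w X). Proof. by apply: theta_balg => //; exact: balgX. Qed.

(** The source projection of a letter is some p_Z, which commutes with p_Y. *)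
Lemma letter_comm m Y : balg X Y ->
  letter m ** p Y = letter m ** p Y ** ((letter m)^# ** letter m).
Proof.
move=> BY; rewrite letter_source -cmulA pComm// cmulA -letter_source.
by rewrite letter_isometry.
Qed.

Lemma letter_conjM m Y Z : balg X Y -> balg X Z ->
  letter m ** (p Y ** p Z) ** (letter m)^# =
  (letter m ** p Y ** (letter m)^#) ** (letter m ** p Z ** (letter m)^#).
Proof. by move=> BY BZ; rewrite [in LHS]cmulA [in LHS](letter_comm m BY) !cmulA. Qed.

(** Both sides are compatible with the Boolean operations in Y. *)
Lemma letter_cov m Y : balg X Y ->
  letter m ** p Y ** (letter m)^# = p (theta [:: m] Y).
Proof.
move: Y; apply: balg_ind => //.
- by rewrite theta0 p0 cmulr0 cmul0.
- by rewrite pX er letter_X.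
- move=> Y Z BY BZ hY hZ; rewrite thetaU !pU//; try exact: theta_balg.
  rewrite (pI BY BZ) cmulBr cmulBl cmulDr cmulDl hY hZ; congr (_ - _).
  by rewrite letter_conjM// hY hZ pI//; exact: theta_balg.
- move=> Y Z BY BZ hY hZ; rewrite thetaI !pI//; try exact: theta_balg.
  by rewrite letter_conjM// hY hZ.
- move=> Y BY hY; have Bt := theta_balg tailX [:: m] BY.
  rewrite pC// cmulBr cmulBl hY er letter_X thetaC pI//; last exact: balgC.
  rewrite pC// cmulBr er; congr (_ - _); rewrite -pI//; congr p.
  apply/seteqP; split=> z; last by case.
  by move=> h; split=> //; apply: thetaS h; exact: balg_sub.
- by move=> a b la lb; exact: letter_Cset.
Qed.

Let theta_cons m w Y : theta (m :: w) Y = theta [:: m] (theta w Y).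
Proof. exact: (theta_cat X [:: m] w). Qed.

Definition word_op w : D := foldr (fun m y => letter m ** y) e w.

Lemma word_op_cat u v : word_op (u ++ v) = word_op u ** word_op v.
Proof. by elim: u => [|m u IH] /=; rewrite ?el// IH cmulA. Qed.

Lemma word_op_inv w : word_op (rev (map letter_inv w)) = (word_op w)^#.
Proof.
elim: w => [|m w IH] /=; first by rewrite ea.
by rewrite rev_cons -cats1 word_op_cat IH /= er adjM letter_adj.
Qed.

Lemma word_op_cov w Y : balg X Y ->
  word_op w ** p Y ** (word_op w)^# = p (theta w Y).
Proof.
move=> BY; elim: w => [|m w IH] /=.
  by rewrite ea el er theta_nil//; exact: balg_sub.
rewrite adjM theta_cons -letter_cov; last exact: theta_balg.
by rewrite -IH !cmulA.
Qed.

Lemma word_op_range w : word_op w ** (word_op w)^# = p (theta w X).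
Proof. by rewrite -word_op_cov ?pX ?er//; exact: balgX. Qed.

Lemma word_op_norm w : `|word_op w| <= 1.
Proof.
rewrite -adj_norm; apply: cstar_norm_le => //.
by rewrite adjK word_op_range expr1n; apply: projection_norm; exact: p_proj.
Qed.

Lemma word_op_isometry w : p (theta w X) ** word_op w = word_op w.
Proof.
apply: (can_inj (@adjK R D)); rewrite adjM -word_op_range adjM adjK cmulA.
rewrite -{2}(adjK (word_op w)); apply: projection_isometry.
by rewrite adjK word_op_range; exact: p_proj.
Qed.

(** The operators of the reduced words form a partial representation of the free
    group: cancelling a letter against its inverse leaves a range projection. *)
Lemma word_op_push u v :
  word_op u ** word_op v = p (theta u X) ** word_op (foldr push v u).
Proof.
elim: u => [|m u IH] /=; first by rewrite theta_nil// pX.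
rewrite -cmulA IH cmulA theta_cons -letter_cov//.
case: (foldr push v u) => [|n w] /=.
  by rewrite !er -cmulA -letter_comm.
case: eqP => [->|_] /=; first by rewrite -letter_adj !cmulA.
by rewrite [in RHS]cmulA -(cmulA (letter m ** _)) -letter_comm.
Qed.

End Relations.

(** * The representation of C_c(G) given by the relations *)

Section CovariantRepresentation.
Context {R : realType} {A : pointedType} (X : set (nat -> A)).
Hypothesis tailX : forall w x, X (wcat w x) -> X x.
Local Notation C := R[i].
Local Notation G := (transformation_groupoid X).
Local Notation T := (stone X * free_group A * stone X)%type.
Local Notation theta := (theta X).
Context (D : cstarType R) (e : D) (p : set (nat -> A) -> D) (s : A -> D).
Hypothesis ue : is_unit_of e.
Hypothesis rel : subshift_relations X e p s.
Implicit Types (Y Z : set (nat -> A)) (t r : free_group A).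
Implicit Types (f g : T -> C) (h k : stone X -> C).

Let p_proj Y : balg X Y -> is_projection (p Y).
Proof. by case: rel => h _ _ _ _; exact: h. Qed.
Let pX : p X = e. Proof. by case: rel => _ _ [h _ _ _] _ _. Qed.
Let pI Y Z : balg X Y -> balg X Z -> p (Y `&` Z) = p Y ** p Z.
Proof. by case: rel => _ _ [_ h _ _] _ _; exact: h. Qed.
Let pU Y Z : balg X Y -> balg X Z -> p (Y `|` Z) = p Y + p Z - p (Y `&` Z).
Proof. by case: rel => _ _ [_ _ h _] _ _; exact: h. Qed.
Let p0 : p set0 = 0. Proof. by case: rel => _ _ [_ _ _ h] _ _. Qed.
Let BtX t : balg X (theta t X). Proof. by apply: theta_balg => //; exact: balgX. Qed.

Definition group_op t : D := word_op e s t.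

Lemma group_opM t r : group_op t ** group_op r = p (theta t X) ** group_op (t * r)%g.
Proof. exact: word_op_push. Qed.

Lemma group_op_adj t : (group_op t)^# = group_op (t^-1)%g.
Proof. by rewrite /group_op -word_op_inv. Qed.

Lemma group_op_isometry t : p (theta t X) ** group_op t = group_op t.
Proof. exact: word_op_isometry. Qed.

Lemma group_op_isometry_r t : group_op t ** p (theta (t^-1)%g X) = group_op t.
Proof.
apply: (can_inj (@adjK R D)); rewrite adjM group_op_adj.
by have [-> _] := p_proj (BtX (t^-1)%g); exact: group_op_isometry.
Qed.

Local Notation Int := (integral p : (stone X -> C) -> D).

Let IntM h k : scont h -> scont k -> Int (fun xi => h xi * k xi) = Int h ** Int k.
Proof. exact: (integralM ue p_proj pX pI pU p0). Qed.

Let I_indic Y : balg X Y -> Int (indic Y) = p Y.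
Proof. exact: (integral_indic ue p_proj pX pI pU p0). Qed.

Lemma integral_comm h Y : scont h -> balg X Y -> Int h ** p Y = p Y ** Int h.
Proof.
move=> ch BY; rewrite -I_indic// -!IntM//; try exact: scont_indic.
by congr integral; apply/funext => xi; rewrite mulrC.
Qed.

Lemma integral_cov t h : scont h ->
  Int (transport t h) = group_op t ** Int h ** (group_op t)^#.
Proof.
move=> ch; apply: (integral_transport ue p_proj pX pI pU p0) => //; first exact:
  (word_op_norm tailX ue rel).
by move=> Y BY; exact: (word_op_cov tailX ue rel).
Qed.

Lemma integral0 : Int (fun=> 0) = 0.
Proof.
have := @integral_simple_fun _ _ X _ _ _ ue p_proj pX pI pU p0 [::]; rewrite
  simple_op_nil => <-.
by congr integral; apply/funext => xi; rewrite simple_fun_nil.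
Qed.

Lemma integral1 : Int (fun=> 1) = e.
Proof.
have E : (fun=> 1) = indic (R := R) X :> (stone X -> C).
  by apply/funext => xi; rewrite indicX.
by rewrite E I_indic//; exact: balgX.
Qed.

(** The integrated form of the covariant pair of the integral and of the
    operators u_t. *)
Definition rep_of_relations f : D :=
  \sum_(t \in [set: free_group A]) (Int (coef f t) ** group_op t).

Lemma rep_of_relationsE f (L : seq (free_group A)) : uniq L ->
  (forall z, f z != 0 -> z.1.2 \in L) ->
  rep_of_relations f = \sum_(t <- L) (Int (coef f t) ** group_op t).
Proof.
move=> uL hL; rewrite /rep_of_relations (fsbigE L)//.
  by apply: eq_bigl => t; apply/mem_set.
move=> t _ tL; rewrite (_ : coef f t = fun=> 0) ?integral0 ?cmul0//.
apply/funext => xi; have [[_ //]|[eta _ E]] := pull_dom tailX t (fun xi eta => f (xi,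
  t, eta)) xi.
rewrite [LHS]E; apply/eqP; apply: contrapT => /negP /hL /= tL'.
by rewrite tL' in tL.
Qed.

Lemma rep_of_slice t h : scont h ->
  rep_of_relations (slice t h) = Int h ** group_op t.
Proof.
move=> ch; rewrite (@rep_of_relationsE _ [:: t])//; last first.
  move=> z; rewrite /slice; case: asboolP => [[_ <-] _|_ /eqP//].
  exact: mem_head.
rewrite big_seq1 (_ : coef _ _ = fun xi => h xi * indic (theta t X) xi); last first.
  apply/funext => xi; rewrite coef_slice// eqxx /indic.
  by case: asboolP => _; rewrite ?mulr1 ?mulr0.
rewrite IntM//; last exact: scont_indic.
by rewrite I_indic// -cmulA group_op_isometry.
Qed.

Lemma rep_of_relationsD f g : @Cc R G f -> @Cc R G g ->
  rep_of_relations (f + g) = rep_of_relations f + rep_of_relations g.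
Proof.
move=> Cf Cg; have [_ [L hL] cf] := (CcP tailX f).1 Cf.
have [_ [L' hL'] cg] := (CcP tailX g).1 Cg.
pose M := undup (L ++ L').
have hM z : f z != 0 -> z.1.2 \in M by rewrite mem_undup mem_cat => /hL ->.
have hM' z : g z != 0 -> z.1.2 \in M.
  by rewrite mem_undup mem_cat => /hL' ->; rewrite orbT.
rewrite !(@rep_of_relationsE _ M) ?undup_uniq//; last first.
  move=> z; have [fz|/hM//] := eqVneq (f z) 0.
  have -> : (f + g) z = f z + g z by [].
  by rewrite fz add0r => /hM'.
rewrite -big_split /=; apply: eq_bigr => t _.
by rewrite coefD -cmulDl; congr (_ ** _); exact: (integralD ue p_proj pX pI pU p0).
Qed.

Lemma rep_of_relations0 : rep_of_relations 0 = 0.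
Proof.
by rewrite (@rep_of_relationsE _ [::]) ?big_nil// => z; rewrite eqxx.
Qed.

Lemma rep_of_relationsZ (c : C) f : @Cc R G f ->
  rep_of_relations (fun z => c * f z) = c *: rep_of_relations f.
Proof.
move=> Cf; have [_ [L hL] cf] := (CcP tailX f).1 Cf.
have hM z : f z != 0 -> z.1.2 \in undup L by rewrite mem_undup => /hL ->.
rewrite !(@rep_of_relationsE _ (undup L)) ?undup_uniq//; last first.
  by move=> z; rewrite mulf_eq0 negb_or => /andP[_ /hM].
rewrite scaler_sumr; apply: eq_bigr => t _.
by rewrite coefZ -cmulZl; congr (_ ** _); exact: (integralZ ue p_proj pX pI pU p0).
Qed.

(** For slices: Int h u_s Int k u_t = Int h (u_s Int k u_s^#) u_st, since
    u_s^# u_st = p u_t for the source projection p of u_s, which commutes with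
    Int k and is absorbed by u_s. *)
Lemma rep_of_relationsM f g : @Cc R G f -> @Cc R G g ->
  rep_of_relations (@convolution R G f g) =
  rep_of_relations f ** rep_of_relations g.
Proof.
move=> Cf Cg; move: f Cf; apply: (Cc_ind tailX).
- by rewrite convolution0l rep_of_relations0 cmul0.
- move=> f1 f2 C1 C2 h1 h2; rewrite convolutionDl// !rep_of_relationsD ?h1 ?h2 ?cmulDl//;
    exact: CcM.
move=> t h ch; have Cth : @Cc R G (slice t h) by exact: Cc_slice.
move: g Cg; apply: (Cc_ind tailX).
- by rewrite convolution0r rep_of_relations0 cmulr0.
- move=> g1 g2 C1 C2 h1 h2; rewrite convolutionDr// !rep_of_relationsD ?h1 ?h2 ?cmulDr//;
    exact: CcM.
move=> r k ck; rewrite convolution_slice//.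
have ctk := scont_transport tailX t ck.
rewrite !rep_of_slice//; last exact: scontM.
rewrite IntM// integral_cov// group_op_adj -!cmulA group_opM mulKg.
rewrite (cmulA (Int k)) integral_comm// -cmulA (cmulA (group_op t)).
by rewrite group_op_isometry_r.
Qed.

Lemma rep_of_relations_adj f : @Cc R G f ->
  rep_of_relations (@involution R G f) = (rep_of_relations f)^#.
Proof.
move: f; apply: (Cc_ind tailX).
- by rewrite involution0 rep_of_relations0 adj0.
- move=> f1 f2 C1 C2 h1 h2; rewrite involutionD !rep_of_relationsD ?adjD ?h1 ?h2//;
    exact: Cc_involution.
move=> t h ch; have cc := scont_conj ch.
rewrite involution_slice// !rep_of_slice//; last exact: scont_transport.
rewrite integral_cov// adjM -(integral_adj ue p_proj pX pI pU p0)//.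
rewrite !group_op_adj invgK -cmulA group_opM mulgV [group_op 1%g]/= (ue _).2.
rewrite -cmulA integral_comm// cmulA; congr (_ ** _).
by have := group_op_isometry_r (t^-1)%g; rewrite invgK.
Qed.

Theorem rep_of_relationsP : @Cc_rep R G D rep_of_relations.
Proof.
apply/(Cc_repP (G := G)); split.
- exact: rep_of_relationsD.
- exact: rep_of_relationsZ.
- exact: rep_of_relationsM.
- exact: rep_of_relations_adj.
Qed.

Lemma group_op1 : group_op 1%g = e. Proof. by []. Qed.

Lemma rep_of_unit : rep_of_relations (slice 1%g (fun=> 1)) = e.
Proof.
rewrite rep_of_slice; last exact: scont_cst.
by rewrite integral1 group_op1 (ue e).1.
Qed.

Lemma rep_of_indic Y : balg X Y -> rep_of_relations (slice 1%g (indic Y)) = p Y.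
Proof.
move=> BY; rewrite rep_of_slice; last exact: scont_indic.
by rewrite I_indic// group_op1 (ue _).2.
Qed.

Lemma rep_of_letter t l : free_word t = [:: (l, true)] ->
  rep_of_relations (slice t (fun=> 1)) = s l.
Proof.
move=> tE; rewrite rep_of_slice; last exact: scont_cst.
by rewrite integral1 /group_op tE /= /letter /= (ue _).1 (ue _).2.
Qed.

End CovariantRepresentation.

(** * The relations in the groupoid algebra *)

Section RelationsOfRepresentation.
Context {R : realType} {A : pointedType} (X : set (nat -> A)).
Hypothesis tailX : forall w x, X (wcat w x) -> X x.
Local Notation C := R[i].
Local Notation G := (transformation_groupoid X).
Local Notation T := (stone X * free_group A * stone X)%type.
Local Notation theta := (theta X).
Implicit Types (Y Z : set (nat -> A)) (t r : free_group A) (l : A) (a b w : seq A).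
Implicit Types (f g : T -> C) (h k : stone X -> C).

Lemma transport_indic t Y : balg X Y ->
  transport t (indic Y : stone X -> C) = indic (theta t Y).
Proof.
move=> BY; apply/funext => xi; rewrite /transport.
have [[n ->]|[eta a ->]] := pull_dom tailX t (fun _ eta => indic (R := R) Y eta) xi.
  rewrite indic0// => /stone_up h; apply: n; apply: h; last exact/thetaS/(balg_sub BY).
  by apply: theta_balg => //; exact: balgX.
have [eY|nY] := pselect (sval eta Y); first by rewrite !indic1//; exact: a.
by rewrite !indic0// => /(arr_E a BY).
Qed.

Lemma positive_reduced w : reduced [seq (l, true) | l <- w].
Proof.
by rewrite /reduced; case: w => //= l w; elim: w l => //= m w IH l; rewrite IH andbT
  xpair_eqE andbF.
Qed.

Definition positive w : free_group A := Free (positive_reduced w).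

Context (D : cstarType R) (pi : (T -> C) -> D).
Hypothesis rep_pi : @Cc_rep R G D pi.

(** The image of 1_Y delta_t; it plays the role of p_Y u_t. *)
Definition slice_op t Y : D := pi (slice t (indic Y)).
Definition gen_unit : D := pi (slice 1%g (fun=> 1)).
Definition gen_proj Y : D := slice_op 1%g Y.
(** The slice of the constant 1 is that of the indicator function of V_l.  It is
    0 for a letter that does not occur in X. *)
Definition gen_isom l : D := pi (slice (positive [:: l]) (fun=> 1)).

Let BX : balg X X := @balgX A X.
Let Bt t Y : balg X Y -> balg X (theta t Y). Proof. exact: theta_balg. Qed.

Lemma indicXE : indic X = (fun=> 1) :> (stone X -> C).
Proof. by apply/funext => xi; rewrite indicX. Qed.

Lemma slice_opM t r Y Z : balg X Y -> balg X Z ->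
  slice_op t Y ** slice_op r Z = slice_op (t * r)%g (Y `&` theta t Z).
Proof.
move=> BY BZ; rewrite /slice_op rep_sliceM//; try exact: scont_indic.
rewrite transport_indic//; congr (pi (slice _ _)).
by apply/funext => xi; rewrite indicI//; exact: Bt.
Qed.

Lemma slice_op_adj t Y : balg X Y ->
  (slice_op t Y)^# = slice_op (t^-1)%g (theta (t^-1)%g Y).
Proof.
move=> BY; rewrite /slice_op (rep_slice_adj tailX)//; last exact: scont_indic.
congr (pi (slice _ _)); rewrite -transport_indic//; congr transport.
by apply/funext => xi; rewrite indic_conj.
Qed.

(** A slice at t depends only on the restriction of its coefficient to V_t. *)
Lemma eq_slice_op t Y Z : balg X Y -> balg X Z ->
  (forall z, theta t X z -> (Y z <-> Z z)) -> slice_op t Y = slice_op t Z.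
Proof.
move=> BY BZ YZ; rewrite /slice_op; congr pi; apply: eq_slice => // xi xt.
have [xY|nY] := pselect (sval xi Y).
  rewrite !indic1//; apply: (stone_up (stone_I xY xt)) => // z [Yz tz].
  exact/YZ.
rewrite !indic0// => xZ; apply: nY; apply: (stone_up (stone_I xZ xt)) => // z [Zz tz].
exact/YZ.
Qed.

Lemma theta_one Y : balg X Y -> theta (1%g : free_group A) Y = Y.
Proof. by move=> BY; rewrite [theta _ _]theta_nil//; exact: balg_sub. Qed.

Lemma slice_op_mul_adj t Y : balg X Y ->
  slice_op t Y ** (slice_op t Y)^# = gen_proj (Y `&` theta t X).
Proof.
move=> BY; rewrite slice_op_adj// slice_opM//; last exact: Bt.
rewrite mulgV; congr slice_op; apply/seteqP; split=> z [Yz tz]; split=> //.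
  by apply: thetaS tz; exact: theta_sub.
have [x Xx c] := tz; exists x => //; exists z => //; exact: chain_inv.
Qed.

Lemma gen_isomE l : gen_isom l = slice_op (positive [:: l]) X.
Proof. by rewrite /gen_isom -indicXE. Qed.

Lemma gen_unitE : gen_unit = slice_op 1%g X.
Proof. by rewrite /gen_unit -indicXE. Qed.

Lemma positive_cons l w : (positive [:: l] * positive w)%g = positive (l :: w).
Proof. by apply: val_inj; case: w => //= k w; rewrite xpair_eqE andbF. Qed.

(** No cancellation takes place in a positive word. *)
Lemma gen_sword w : sword gen_unit gen_isom w = slice_op (positive w) X.
Proof.
elim: w => [|l w IH] /=.
  by rewrite gen_unitE; congr slice_op; apply: val_inj.
rewrite IH gen_isomE slice_opM// positive_cons; apply: eq_slice_op => //.
  by apply: balgI => //; exact: Bt.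
move=> z; rewrite /= [theta _ _](theta_cat X [:: (l, true)] [seq (l, true) | l <- w])
  => -[x Xx c].
split; first by case.
by move=> Xz; split=> //; exists x => //; exact: theta_sub Xx.
Qed.

Lemma theta_pos_inv a b :
  theta (positive b) (theta ((positive a)^-1)%g X) = Cset X a b.
Proof.
apply/seteqP; split=> z.
  move=> [y [x Xx /= /chain_invE /(chain_pos tailX) [_ _ xE]]].
  by move=> /(chain_pos tailX) [_ Xz zE]; exists y; rewrite -zE -xE.
move=> [y [-> Xb Xa]]; have Xy := tailX Xa; exists y.
  exists (wcat a y) => //=; apply/chain_invE/(chain_pos tailX).
  by split.
exact/(chain_pos tailX).
Qed.

(** All relations are computed by [slice_opM] and [slice_op_adj].  For the words
    a and b, the element s_b s_a^# s_a s_b^# is y y^# for y = s_b s_a^#, which is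
    the slice at b a^-1 of the indicator function of C(a, b). *)
Theorem representation_relations :
  subshift_relations X gen_unit gen_proj gen_isom.
Proof.
split.
- move=> Y BY; split; rewrite /gen_proj.
    by rewrite slice_op_adj// invg1 theta_one.
  by rewrite slice_opM// mulg1 theta_one// setIid.
- move=> l; rewrite /is_partial_isometry gen_isomE slice_op_mul_adj//.
  rewrite slice_opM//; last by apply: balgI => //; exact: Bt.
  rewrite mul1g theta_one//; apply: eq_slice_op => //.
    by apply: balgI => //; apply: balgI => //; exact: Bt.
  by move=> z tz; split; [case|move=> Xz; split].
- split.
  + by rewrite gen_unitE.
  + by move=> Y Z BY BZ; rewrite /gen_proj slice_opM// mulg1 theta_one.
  + move=> Y Z BY BZ; rewrite /gen_proj /slice_op.
    have cY : scont (indic Y : stone X -> C) by exact: scont_indic.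
    have cZ : scont (indic Z : stone X -> C) by exact: scont_indic.
    have cI : scont (indic (Y `&` Z) : stone X -> C) by apply: scont_indic; exact: balgI.
    rewrite -[- pi _]scaleN1r -(rep_sliceZ tailX rep_pi)//.
    rewrite -!(rep_sliceD tailX rep_pi)//; [|exact: scontD|exact: scontZ].
    congr (pi (slice _ _)); apply/funext => xi; rewrite indicU//.
    by rewrite -[- indic _ _]mulN1r.
  + rewrite /gen_proj /slice_op -[RHS](rep_0 tailX rep_pi); congr pi.
    apply/funext => z; rewrite /slice; case: asboolP => // _.
    by rewrite indic0//; exact: stone_0.
- move=> a b la lb; rewrite !gen_sword -cmulA.
  have -> : (slice_op (positive b) X ** (slice_op (positive a) X)^#) **
     (slice_op (positive a) X ** (slice_op (positive b) X)^#) =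
     (slice_op (positive b) X ** (slice_op (positive a) X)^#) **
     (slice_op (positive b) X ** (slice_op (positive a) X)^#)^#.
    by rewrite adjM adjK.
  rewrite slice_op_adj// slice_opM//; last exact: Bt.
  rewrite theta_pos_inv slice_op_mul_adj; last first.
    by apply: balgI => //; exact: balg_Csetw.
  rewrite /gen_proj; congr slice_op; apply/seteqP; split=> z; first by case=> -[].
  move=> hz; have Xz : X z by case: hz => y [-> ].
  split=> //; move: hz; rewrite -theta_pos_inv => -[y [x Xx c] c'].
  by exists x => //; exact: chain_mul c c'.
- move=> l nl; rewrite gen_isomE -(rep_0 tailX rep_pi); congr pi.
  apply/funext => z; apply: slice0 => // -[]; case: z => -[xi t] eta /(arrowsE tailX) a /= tE.
  apply: (@stone_0 _ _ xi); have <- : theta t X = set0; last exact: arr_dom a.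
  apply/seteqP; split=> // z [x Xx]; rewrite tE => /(chain_pos tailX) [_ Xz zE].
  by apply: nl; apply: (language_wcat tailX (x := x)); rewrite -zE.
Qed.

Lemma gen_unit_slice t h : scont h ->
  gen_unit ** pi (slice t h) = pi (slice t h) /\
  pi (slice t h) ** gen_unit = pi (slice t h).
Proof.
move=> ch; have c1 := scont_cst (X := X) (1 : C); split.
  rewrite /gen_unit rep_sliceM// mul1g transport1//; congr (pi (slice _ _)).
  by apply/funext => xi; rewrite mul1r.
rewrite /gen_unit rep_sliceM// mulg1; congr pi; apply: eq_slice => // xi xt.
have [eta a] := arr_source_ex tailX xt.
by rewrite /transport (pullE _ a) mulr1.
Qed.

Lemma gen_unit_Cc f : @Cc R G f ->
  gen_unit ** pi f = pi f /\ pi f ** gen_unit = pi f.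
Proof.
move: f; have [pD _ _ _] := rep_ops rep_pi; apply: (Cc_ind tailX).
- by rewrite (rep_0 tailX rep_pi) cmul0 cmulr0.
- move=> f g Cf Cg [h1 h2] [k1 k2]; rewrite pD//.
  by rewrite cmulDl cmulDr h1 h2 k1 k2.
- by move=> t h; exact: gen_unit_slice.
Qed.

End RelationsOfRepresentation.

(** * Generation of the groupoid algebra *)

Section Generators.
Context {R : realType} {A : pointedType} (X : set (nat -> A)).
Hypothesis tailX : forall w x, X (wcat w x) -> X x.
Local Notation C := R[i].
Local Notation G := (transformation_groupoid X).
Local Notation T := (stone X * free_group A * stone X)%type.
Context (D : cstarType R) (pi rho : (T -> C) -> D).
Hypothesis rep_pi : @Cc_rep R G D pi.
Hypothesis rep_rho : @Cc_rep R G D rho.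
Hypothesis eq_proj : forall Y, balg X Y -> gen_proj pi Y = gen_proj rho Y.
Hypothesis eq_isom : forall l, gen_isom (X := X) pi l = gen_isom rho l.

Let BX : balg X X := @balgX A X.

(** The slice at a reduced word is the product of the slices of its letters,
    each being a generator or the adjoint of one. *)
Lemma eq_slice_X (t : free_group A) : slice_op pi t X = slice_op rho t X.
Proof.
case: t => w rw; elim: w rw => [|[l c] w IH] rw.
  have -> : Free rw = 1%g by apply: val_inj.
  exact: eq_proj.
have rw' : reduced w := path_sorted rw.
have rl : reduced [:: (l, c)] by [].
have E : Free rw = (Free rl * Free rw')%g.
  apply: val_inj => /=; case: w {IH rw'} rw => //= m w /andP[/negbTE -> _] //.
have step (chi : (T -> C) -> D) : @Cc_rep R G D chi ->
    slice_op chi (Free rw) X = slice_op chi (Free rl) X ** slice_op chi (Free rw') X.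
  move=> rchi; rewrite (slice_opM tailX rchi)// -E; apply: eq_slice_op => //.
    by apply: balgI => //; exact: theta_balg.
  move=> z; rewrite [theta _ _ _](theta_cat X [:: (l, c)] w) => -[x Xx cc].
  split; last by case.
  by move=> Xz; split=> //; exists x => //; exact: theta_sub Xx.
rewrite !step// IH; congr (_ ** _).
case: c {rw E step} rl => rl.
  have -> : Free rl = positive [:: l] by apply: val_inj.
  by rewrite -!gen_isomE.
have letterE (chi : (T -> C) -> D) : @Cc_rep R G D chi ->
    slice_op chi (Free rl) X = (gen_isom chi l)^#.
  move=> rchi; rewrite gen_isomE (slice_op_adj tailX rchi)//.
  have -> : ((positive [:: l])^-1)%g = Free rl by apply: val_inj.
  apply: eq_slice_op => //; first exact: theta_balg.
  by move=> z tz; split=> // _; exact: theta_sub tz.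
by rewrite !letterE// eq_isom.
Qed.

Lemma eq_slice_op_gen t Y : balg X Y -> slice_op pi t Y = slice_op rho t Y.
Proof.
move=> BY.
have step (chi : (T -> C) -> D) : @Cc_rep R G D chi ->
    slice_op chi t Y = gen_proj chi Y ** slice_op chi t X.
  move=> rchi; rewrite (slice_opM tailX rchi)// mul1g theta_one//.
  by congr slice_op; apply/seteqP; split=> z; [move=> h; split=> //; exact: balg_sub h|case].
by rewrite !step// eq_proj// eq_slice_X.
Qed.

(** The generators determine the slices of simple functions, and [rep_slice_le]
    gives continuity in the coefficient. *)
Lemma eq_slice_rep t (h : stone X -> C) : scont h ->
  pi (slice t h) = rho (slice t h).
Proof.
move=> ch; apply/subr0_eq/norm_small_eq0 => d d0.
have d2 : 0 < d / 2 by rewrite divr_gt0 ?ltr0n.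
have d20 := ltW d2.
have [l hl] := simple_approx ch d2.
have evE (chi : (T -> C) -> D) : @Cc_rep R G D chi ->
    chi (slice t (simple_fun l)) = \sum_(i <- l) i.1 *: slice_op chi t (sval i.2).
  move=> rchi; elim: l {hl} => [|i l IH].
    rewrite big_nil -[RHS](rep_0 tailX rchi); congr chi; apply/funext => z.
    by rewrite /slice; case: asboolP => // _; rewrite simple_fun_nil.
  have ci : scont (indic (sval i.2) : stone X -> C) by apply: scont_indic; exact: svalP.
  rewrite big_cons -IH -(rep_sliceZ tailX rchi)// -(rep_sliceD tailX rchi);
    [|exact: scontZ|exact: scont_simple_fun].
  by congr (chi (slice _ _)); apply/funext => xi; rewrite simple_fun_cons.
have evEq : pi (slice t (simple_fun l)) = rho (slice t (simple_fun l)).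
  rewrite !evE//; apply: eq_bigr => i _; rewrite eq_slice_op_gen//; exact: svalP.
have bd (chi : (T -> C) -> D) : @Cc_rep R G D chi ->
    `|chi (slice t h) - chi (slice t (simple_fun l))| <= d / 2.
  move=> rchi; have cl := scont_simple_fun l; have cl' := scontZ (-1) cl.
  rewrite -[- chi _]scaleN1r -(rep_sliceZ tailX rchi)// -(rep_sliceD tailX rchi)//.
  apply: (rep_slice_le tailX rchi) => //; first exact: scontD.
  move=> xi; have := hl xi; congr (_ <= _); congr (`|_|).
  by rewrite -[- simple_fun l xi]mulN1r.
have -> : pi (slice t h) - rho (slice t h) =
    (pi (slice t h) - pi (slice t (simple_fun l))) - (rho (slice t h) - rho (slice t
      (simple_fun l))).
  by rewrite evEq opprB addrA subrK.
by rewrite (splitr d); apply: le_trans (ler_normB _ _) (lerD (bd _ _) (bd _ _)).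
Qed.

Lemma eq_rep f : @Cc R G f -> pi f = rho f.
Proof.
have [pD _ _ _] := rep_ops rep_pi; have [rD _ _ _] := rep_ops rep_rho.
move: f; apply: (Cc_ind tailX).
- by rewrite (rep_0 tailX rep_pi) (rep_0 tailX rep_rho).
- by move=> f g Cf Cg h1 h2; rewrite pD// rD// h1 h2.
- by move=> t h; exact: eq_slice_rep.
Qed.

End Generators.

(** * The universal property *)

Section UniversalProperty.
Context {R : realType} {A : pointedType} (X : set (nat -> A)).
Hypothesis tailX : forall w x, X (wcat w x) -> X x.
Local Notation C := R[i].
Local Notation G := (transformation_groupoid X).
Local Notation T := (stone X * free_group A * stone X)%type.

Lemma rep_comp (B D : cstarType R) (iota : (T -> C) -> B) (phi : B -> D) :
  @Cc_rep R G B iota -> star_hom phi -> @Cc_rep R G D (phi \o iota).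
Proof.
move=> /rep_ops [iD iZ iM iS] [pD pZ pM pS]; apply/(Cc_repP (G := G)); split=> /=.
- by move=> f g Cf Cg; rewrite iD// pD.
- by move=> c f Cf; rewrite iZ// pZ.
- by move=> f g Cf Cg; rewrite iM// pM.
- by move=> f Cf; rewrite iS// pS.
Qed.

Section Full.
Context (B : cstarType R) (iota : (T -> C) -> B).
Hypothesis rep_iota : @Cc_rep R G B iota.
Hypothesis dense_iota : closure (iota @` @Cc R G) = setT.

Lemma dense_approx (x : B) (d : C) : 0 < d ->
  exists2 f, @Cc R G f & `|x - iota f| <= d.
Proof.
move=> d0; have : closure (iota @` @Cc R G) x by rewrite dense_iota.
move=> /(_ _ (nbhsx_ballx x _ d0)) [_ [[f Cf <-]]].
by rewrite -ball_normE /= => /ltW xf; exists f.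
Qed.

(** It is a unit for C_c(G), hence for its closure. *)
Lemma gen_unit_unit : is_unit_of (gen_unit iota).
Proof.
have [_ e2] := rep_projection tailX rep_iota.
have e1 := projection_norm (rep_projection tailX rep_iota).
have key (F : B -> B) (x : B) : {morph F : y z / y - z} ->
    (forall y, `|F y| <= `|y|) -> (forall f, @Cc R G f -> F (iota f) = iota f) -> F x = x.
  move=> FB Fle Ff; apply/subr0_eq/norm_small_eq0 => d d0.
  have d2 : 0 < d / 2 by rewrite divr_gt0 ?ltr0n.
  have [f Cf xf] := dense_approx x d2.
  have -> : F x - x = F (x - iota f) - (x - iota f).
    by rewrite FB Ff// opprB addrA subrK.
  rewrite (splitr d); apply: le_trans (ler_normB _ _) (lerD _ xf).
  exact: le_trans xf.
move=> x; split.
  apply: (key (fun y => gen_unit iota ** y)) => [y z|y|f Cf].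
  - by rewrite cmulBr.
  - by apply: le_trans (cmul_norm _ _) _; rewrite ler_piMl.
  - by have [] := gen_unit_Cc tailX rep_iota Cf.
apply: (key (fun y => y ** gen_unit iota)) => [y z|y|f Cf].
- by rewrite cmulBl.
- by apply: le_trans (cmul_norm _ _) _; rewrite ler_piMr.
- by have [] := gen_unit_Cc tailX rep_iota Cf.
Qed.

Section Factorization.
Context (D : cstarType R) (pi : (T -> C) -> D).
Hypothesis rep_pi : @Cc_rep R G D pi.
Hypothesis pi_le : forall f, @Cc R G f -> `|pi f| <= `|iota f|.

Definition norm_le (x : B) (r : C) := `|x| <= r.
Definition graph (x : B) (d : D) := exists2 f, @Cc R G f & x = iota f /\ d = pi f.

Lemma graph_relation :
  contractive_relation (D := D) (E := B) (@cmul R B) (@adj R B) norm_le graph.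
Proof.
have [iD iZ iM iS] := rep_ops rep_iota; have [pD pZ pM pS] := rep_ops rep_pi.
rewrite /norm_le; split.
- by move=> x r; apply: le_trans.
- by move=> x r r' xr; apply: le_trans.
- by move=> x y r r' xr yr; apply: le_trans (ler_normD _ _) (lerD xr yr).
- by move=> c x r xr; rewrite normrZ; exact: ler_wpM2l.
- by move=> x y r r' xr yr; apply: le_trans (cmul_norm _ _) _; exact: ler_pM.
- by move=> x r; rewrite adj_norm.
- exact: cmulBl.
- by move=> x y z; exact: cmulBr.
- exact: adjB.
- move=> x y d d' [f Cf [-> ->]] [g Cg [-> ->]]; exists (f + g); first exact: CcD.
  by rewrite iD// pD.
- move=> c x d [f Cf [-> ->]]; exists (fun z => c * f z); first exact: CcZ.
  by rewrite iZ// pZ.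
- move=> x y d d' [f Cf [-> ->]] [g Cg [-> ->]].
  by exists (@convolution R G f g); [exact: CcM | rewrite iM// pM].
- move=> x d [f Cf [-> ->]]; exists (@involution R G f); first exact: Cc_involution.
  by rewrite iS// pS.
- by move=> x d r [f Cf [-> ->]]; apply: le_trans; exact: pi_le.
- by move=> x d _; exists `|x|.
Qed.

(** A representation dominated by the norm of B extends to B by continuity. *)
Lemma factorization : exists phi : B -> D,
  star_hom phi /\ forall f, @Cc R G f -> phi (iota f) = pi f.
Proof.
have dom x : ext_dom norm_le graph x.
  by move=> d d0; have [f Cf xf] := dense_approx x d0; exists (pi f), (iota f) => //; exists f.
exists (extension norm_le graph); split.
  split.
  - by move=> x y; have [_] := extensionD graph_relation (dom x) (dom y).
  - by move=> c x; have [_] := extensionZ graph_relation c (dom x).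
  - by move=> x y; have [_] := extensionM graph_relation (dom x) (dom y).
  - by move=> x; have [_] := extension_star graph_relation (dom x).
by move=> f Cf; apply: (extension_Gm graph_relation); exists f.
Qed.

End Factorization.
End Full.

Theorem full_groupoid_Cstar_universal (B : cstarType R) :
  is_full_groupoid_Cstar G B -> is_subshift_Cstar X B.
Proof.
move=> [iota [rep_iota dense_iota sup_iota]].
have ue := gen_unit_unit rep_iota dense_iota.
exists (gen_unit iota), (gen_proj iota), (gen_isom iota); split=> //.
  exact: representation_relations.
move=> D e' p' s' ue' rel'.
have rpi := rep_of_relationsP tailX ue' rel'.
have pi_le f : @Cc R G f -> `|rep_of_relations e' p' s' f| <= `|iota f|.
  by move=> Cf; have [ub _] := sup_iota f Cf; apply: ub; exists D, (rep_of_relations e' p' s').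
have [phi [phi_hom phiE]] := factorization rep_iota dense_iota rpi pi_le.
have phi_e : phi (gen_unit iota) = e'.
  by rewrite phiE ?rep_of_unit//; apply: Cc_slice => //; exact: scont_cst.
have phi_p Y : balg X Y -> phi (gen_proj iota Y) = p' Y.
  move=> BY; rewrite phiE; first exact: rep_of_indic.
  by apply: Cc_slice => //; exact: scont_indic.
have phi_s l : phi (gen_isom iota l) = s' l.
  rewrite phiE; first exact: rep_of_letter.
  by apply: Cc_slice => //; exact: scont_cst.
exists phi; split=> // psi [psi_hom psi_e psi_p psi_s].
apply: (star_hom_eq ue phi_hom psi_hom dense_iota) => _ [f Cf <-].
apply: (eq_rep tailX (rep_comp rep_iota phi_hom) (rep_comp rep_iota psi_hom)) Cf.
  by move=> Y BY; rewrite [LHS]phi_p// [RHS]psi_p.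
by move=> l; rewrite [LHS]phi_s [RHS]psi_s.
Qed.

End UniversalProperty.

Section Uniqueness.
Context {R : realType} {A : pointedType} (X : set (nat -> A)).

Lemma star_hom_id (B : cstarType R) : star_hom (fun x : B => x).
Proof. by split. Qed.

Lemma star_hom_comp (B1 B2 B3 : cstarType R) (phi : B1 -> B2) (psi : B2 -> B3) :
  star_hom phi -> star_hom psi -> star_hom (psi \o phi).
Proof.
move=> [fD fZ fM fS] [gD gZ gM gS]; split=> /=.
- by move=> x y; rewrite /= fD gD.
- by move=> c x; rewrite /= fZ gZ.
- by move=> x y; rewrite /= fM gM.
- by move=> x; rewrite /= fS gS.
Qed.

(** The two canonical morphisms are inverse to each other, as the identity is
    the only endomorphism of a universal object that fixes the generators. *)
Theorem subshift_Cstar_unique (O B : cstarType R) :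
  is_subshift_Cstar X O -> is_subshift_Cstar X B -> cstar_isomorphic O B.
Proof.
move=> [e [p [s [ue rel univ]]]] [e' [p' [s' [ue' rel' univ']]]].
have [phi [[hphi phi_e phi_p phi_s] _]] := univ B e' p' s' ue' rel'.
have [psi [[hpsi psi_e psi_p psi_s] _]] := univ' O e p s ue rel.
exists phi; split=> //; exists psi.
  have [chi [_ uniq]] := univ O e p s ue rel.
  have E1 := uniq (psi \o phi); have E2 := uniq id.
  move=> x; rewrite -[LHS]/((psi \o phi) x) -E1.
    rewrite E2//; split=> //; exact: star_hom_id.
  split; [exact: star_hom_comp | by rewrite /= phi_e | | by move=> l; rewrite /= phi_s].
  by move=> Y BY; rewrite /= phi_p// psi_p.
have [chi [_ uniq]] := univ' B e' p' s' ue' rel'.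
have E1 := uniq (phi \o psi); have E2 := uniq id.
move=> x; rewrite -[LHS]/((phi \o psi) x) -E1.
  rewrite E2//; split=> //; exact: star_hom_id.
split; [exact: star_hom_comp | by rewrite /= psi_e | | by move=> l; rewrite /= psi_s].
by move=> Y BY; rewrite /= psi_p// phi_p.
Qed.

End Uniqueness.

Lemma subshift_tail (A : pointedType) (F : set (seq A)) w x :
  subshift F (wcat w x) -> subshift F x.
Proof. by move=> h v Fv /(block_cat w); exact: h. Qed.

Theorem theorem6p1 (R : realType) (A : pointedType) (F : set (seq A)) :
  let X := subshift F in
  let G := transformation_groupoid X in
  [/\ exists O : cstarType R, is_subshift_Cstar X O,
      exists B : cstarType R, is_full_groupoid_Cstar G B &
      forall O B : cstarType R,
        is_subshift_Cstar X O -> is_full_groupoid_Cstar G B ->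
        cstar_isomorphic O B].
Proof.
move=> X G; have tailX w x : X (wcat w x) -> X x by exact: subshift_tail.
have [B fullB] := full_Cstar_exists (R := R) tailX.
split.
- by exists B; exact: full_groupoid_Cstar_universal.
- by exists B.
move=> O B' univO fullB'; apply: subshift_Cstar_unique univO _.
exact: full_groupoid_Cstar_universal.
Qed.
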